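(* Let $n\ge 2$ and $P_0,P_1\in\mathcal{L}_a$. Let $\varphi$ be the exponentially concave function on $\Delta_n$ (described in the context) whose portfolio map generates the optimal transport map from $\tilde P_1$ to $\tilde P_0$ for the cost $c$. Assume that $\varphi$ is $C^2$ on $\Delta_n$ and that there exist constants $\alpha,\alpha'>0$ such that $\alpha\|q'-q\|^2\le\mathbf{D}[q':q]\le\alpha'\|q'-q\|^2$ for all $q,q'\in\Delta_n$, where $\mathbf{D}$ is the $L$-divergence of $\varphi$. Let $\lambda=\lambda_N=\frac4\alpha N^{2/n}$, and let $M_N=\sum_{\sigma\in\mathcal{S}_N}\nu_N^\sigma M_N^\sigma$ be the random probability measure on the space of right-continuous paths with left limits from $[0,1]$ to $\Delta_n$ defined in the context. Then, $\mathbb{P}$-almost surely, as $N\to\infty$, $M_N$ converges weakly to the law of the random path $(q(t))_{0\le t\le1}$ given by $$q(t)=p\odot\pi(t),\qquad \pi(t)=(1-t)\overline{e}+t\,(q\odot p^{-1}),$$ where $(p,q)$ is chosen at random from the optimal Monge coupling of $P_0$ and $P_1$ for the cost $c$ (so that $q(0)=p$ and $q(1)=q$).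
   Context: Simplex: $\Delta_n=\{p\in(0,1)^n:\sum_i p_i=1\}$, $\overline{e}=(1/n,\dots,1/n)$. Group operation: $(p\odot q)_i=\frac{p_iq_i}{\sum_j p_jq_j}$; inverse: $(p^{-1})_i=\frac{1/p_i}{\sum_j1/p_j}$. Cost: $c(p,q)=\log\left(\frac1n\sum_i\frac{q_i}{p_i}\right)-\frac1n\sum_i\log\frac{q_i}{p_i}$. A coupling is optimal for $(P,Q)$ if it minimizes $\mathbb{E}[c(p,q)]$ among couplings; a Monge coupling is one of the form $(p,T(p))$, $p\sim P$. $\mathcal{L}_a$: Borel probability measures $P$ on $\Delta_n$ with $\sum_i\int|\log p_i|\,dP<\infty$ that are absolutely continuous with respect to $(n-1)$-dimensional Lebesgue measure on $\Delta_n$. $\varphi:\Delta_n\to\mathbb{R}$ is exponentially concave if $e^\varphi$ is concave. Its portfolio map is $(\boldsymbol{\pi}(r))_i=r_i(1+\nabla_{e_i-r}\varphi(r))$, with $e_i$ the standard basis of $\mathbb{R}^n$ and $\nabla_v$ the directional derivative. For differentiable $\varphi$, its $L$-divergence is $\mathbf{D}[r:r']=\log(1+\nabla\varphi(r')\cdot(r-r'))-(\varphi(r)-\varphi(r'))$. $\tilde P_0,\tilde P_1$ are the pushforwards of $P_0,P_1$ under $p\mapsto p^{-1}$. Known fact: there is an exponentially concave $\varphi$ with portfolio map $\boldsymbol{\pi}$ such that $q^{-1}\mapsto q^{-1}\odot\boldsymbol{\pi}(q)$ pushes $\tilde P_1$ forward to $\tilde P_0$ and is the a.e. unique optimal Monge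 map for $c$; this is the $\varphi$ in the claim. Likewise the optimal coupling of $(P_0,P_1)$ for $c$ is a.e. unique and Monge. Random objects on $(\Omega,\mathcal{F},\mathbb{P})$: $p(1),p(2),\dots$ i.i.d. from $P_0$; independently $q(1),q(2),\dots$ i.i.d. from $P_1$; and, independently of these, an i.i.d. sequence $\gamma(j)=(\gamma_1(j,\cdot),\dots,\gamma_n(j,\cdot))$, $j\ge1$, of vectors of $n$ independent standard gamma subordinators (right-continuous increasing L\'evy processes, $\gamma_i(j,0)=0$, $\gamma_i(j,t)\sim\mathrm{Gamma}(t,1)$). For $\lambda>0$, $$f_\lambda(q\mid p)=\frac{\Gamma(\lambda)}{\Gamma(\lambda/n)^n}\frac{1}{\prod_iq_i}\prod_{i=1}^n\left(\frac{q_i}{p_i}\right)^{\lambda/n}\left(\sum_{i=1}^n\frac{q_i}{p_i}\right)^{-\lambda},\qquad \nu_N^\sigma=\frac{\prod_{i=1}^Nf_\lambda(q(\sigma(i))\mid p(i))}{\sum_{\rho\in\mathcal{S}_N}\prod_{i=1}^Nf_\lambda(q(\rho(i))\mid p(i))},\ \sigma\in\mathcal{S}_N,$$ where $\mathcal{S}_N$ is the group of permutations of $\{1,\dots,N\}$. For $\sigma\in\mathcal{S}_N$, $1\le j\le N$, let $\pi^\sigma(j)=q(\sigma(j))\odot p(j)^{-1}$ and, for $1\le i\le n$, $t\in[0,1]$, $\pi_i^\sigma(j,t)=\frac{\gamma_i(j,t\lambda)}{\gamma_i(j,\lambda)}\pi_i^\sigma(j)$. The corresponding path in $\Delta_n$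 is $$q_i^\sigma(j,t)=\frac{(1-t)p_i(j)/n+\pi_i^\sigma(j,t)\,p_i(j)}{\sum_{k=1}^n\left[(1-t)p_k(j)/n+\pi_k^\sigma(j,t)\,p_k(j)\right]},\qquad 1\le i\le n,$$ i.e. $q^\sigma(j,t)=p(j)\odot\pi$, with $\pi\in\Delta_n$ proportional to $\left((1-t)\frac1n+\pi_i^\sigma(j,t)\right)_i$. Then $M_N^\sigma=\frac1N\sum_{j=1}^N\delta_{q^\sigma(j,\cdot)}$ and $M_N=\sum_{\sigma\in\mathcal{S}_N}\nu_N^\sigma M_N^\sigma$. The path space carries the usual Skorokhod topology. *)

(* Defs.v *)
From HB Require Import structures.
From mathcomp Require Import all_boot all_order all_algebra perm.
From mathcomp Require Import all_classical all_reals all_analysis.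

Set Implicit Arguments.
Unset Strict Implicit.
Unset Printing Implicit Defensive.

Import Order.TTheory GRing.Theory Num.Theory.
Import numFieldNormedType.Exports.

Local Open Scope classical_set_scope.
Local Open Scope ring_scope.

Definition borel (T : ptopologicalType) := g_sigma_algebraType (@open T).
HB.instance Definition _ (T : ptopologicalType) := Measurable.on (borel T).

(* Image under f of a measure mu carried by D; the values of f outside D are
   irrelevant, so f may be a map that is only meaningful on D. *)
Definition image_on (T U : Type) (R : realType)
    (D : set T) (mu : set T -> \bar R) (f : T -> U) : set U -> \bar R :=
  fun A => mu (D `&` f @^-1` A).

Definition weakly_converges (R : realType) (T : ptopologicalType)
    (mu : nat -> set (borel T) -> \bar R) (nu : set (borel T) -> \bar R) :=
  forall f : T -> R, continuous f -> (exists M, forall x, `|f x| <= M) ->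
    (\int[mu N]_(x in [set: borel T]) (f x)%:E)%E @[N --> \oo] -->
    (\int[nu]_(x in [set: borel T]) (f x)%:E)%E.

(* The dimension is n = m.+2, so that n >= 2 and the simplex is not empty. *)
Section Simplex.
Context (R : realType) (m : nat).
Local Notation n := m.+2.
Local Notation V := 'rV[R]_n.

Definition simplex : set V :=
  [set p | (forall i, 0 < p 0 i < 1) /\ \sum_i p 0 i = 1].

Definition bary : V := const_mx n%:R^-1.

Definition smul (p q : V) : V :=
  \row_i (p 0 i * q 0 i / \sum_j p 0 j * q 0 j).

Definition sinv (p : V) : V := \row_i ((p 0 i)^-1 / \sum_j (p 0 j)^-1).

(* Euclidean norm; the norm of the normed module 'rV[R]_n is the sup norm. *)
Definition enorm (v : V) : R := Num.sqrt (\sum_i v 0 i ^+ 2).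

Definition cost (p q : V) : R :=
  ln (n%:R^-1 * \sum_i q 0 i / p 0 i) - n%:R^-1 * \sum_i ln (q 0 i / p 0 i).

(* Lebesgue (outer) measure on R^(n-1), by countable covers by boxes. *)
Definition lebesgue_outer (A : set 'rV[R]_m.+1) : \bar R :=
  ereal_inf [set v | exists a b : nat -> 'rV[R]_m.+1,
    A `<=` \bigcup_k [set x | forall i, a k 0 i <= x 0 i <= b k 0 i] /\
    v = (\sum_(0 <= k <oo) (\prod_i Num.max 0 (b k 0 i - a k 0 i))%:E)%E].

(* (n-1)-dimensional Lebesgue measure on the simplex, up to the constant factor
   sqrt n, read in the global chart that drops the last coordinate. *)
Definition simplex_lebesgue (A : set V) : \bar R :=
  lebesgue_outer [set col' ord_max p | p in A].

(* Borel measures on the simplex are Borel measures on R^n carried by it. *)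
Definition class_La (P : probability (borel V) R) :=
  [/\ P simplex = 1%E,
      (\sum_(i < n) \int[P]_(p in (simplex : set (borel V)))
          `|ln ((p : V) 0 i)|%:E < +oo)%E &
      forall A : set (borel V), measurable A -> A `<=` simplex ->
        simplex_lebesgue A = 0%E -> P A = 0%E].

Definition coupling (P Q : set (borel V) -> \bar R)
    (J : probability (borel V * borel V)%type R) :=
  forall A : set (borel V), measurable A ->
    J (A `*` setT) = P A /\ J (setT `*` A) = Q A.

Definition expected_cost (J : probability (borel V * borel V)%type R) : \bar R :=
  (\int[J]_(z in (simplex `*` simplex : set (borel V * borel V)))
     (cost z.1 z.2)%:E)%E.

Definition optimal_coupling (P Q : set (borel V) -> \bar R)
    (J : probability (borel V * borel V)%type R) :=
  coupling P Q J /\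
  forall J' : probability (borel V * borel V)%type R,
    coupling P Q J' -> (expected_cost J <= expected_cost J')%E.

Definition induced_by (P : set (borel V) -> \bar R) (T : borel V -> borel V)
    (J : probability (borel V * borel V)%type R) :=
  measurable_fun (simplex : set (borel V)) T /\
  forall C : set (borel V * borel V), measurable C ->
    J C = image_on simplex P (fun p => (p, T p)) C.

Definition monge_coupling (P : set (borel V) -> \bar R)
    (J : probability (borel V * borel V)%type R) :=
  exists T, induced_by P T J.

Definition exp_concave (phi : V -> R) :=
  forall p q, simplex p -> simplex q -> forall t, 0 <= t <= 1 ->
    t * expR (phi p) + (1 - t) * expR (phi q)
      <= expR (phi (t *: p + (1 - t) *: q)).

(* Functions on the simplex are differentiated only along vectors tangent to
   it, so their values outside the simplex play no role. *)
Definition tangent : set V := [set v | \sum_i v 0 i = 0].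

Definition C2_on_simplex (phi : V -> R) :=
  {within simplex, continuous phi} /\
  forall v, tangent v ->
    [/\ forall p, simplex p -> derivable phi p v,
        {within simplex, continuous ('D_v phi)} &
        forall w, tangent w ->
          (forall p, simplex p -> derivable ('D_v phi) p w) /\
          {within simplex, continuous ('D_w ('D_v phi))}].

Definition portfolio (phi : V -> R) (r : V) : V :=
  \row_i (r 0 i * (1 + 'D_(delta_mx 0 i - r) phi r)).

(* D[r : r'], with grad phi(r') . (r - r') as a directional derivative *)
Definition L_div (phi : V -> R) (r r' : V) : R :=
  ln (1 + 'D_(r - r') phi r') - (phi r - phi r').

(* The map q^-1 |-> q^-1 (.) portfolio phi q, as a function of s = q^-1. *)
Definition portfolio_transport (phi : V -> R) (s : V) : V :=
  smul s (portfolio phi (sinv s)).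

Definition generates_optimal_map (P0 P1 : probability (borel V) R)
    (phi : V -> R) :=
  let invP (P : probability (borel V) R) : set (borel V) -> \bar R :=
    image_on simplex P sinv in
  exists J : probability (borel V * borel V)%type R,
    optimal_coupling (invP P1) (invP P0) J /\
    induced_by (invP P1) (portfolio_transport phi) J.

End Simplex.

Arguments simplex {R m}.
Arguments bary {R m}.

Section Skorokhod.
Context (R : realType) (m : nat).
Local Notation n := m.+2.
Local Notation V := 'rV[R]_n.

(* A path on [0, 1] is encoded by its extension to R that is constant on
   ]-oo, 0] and on [1, +oo[; this makes the encoding unique. *)
Definition cadlag (x : R -> V) :=
  [/\ forall t, simplex (x t),
      forall t, (t <= 0 -> x t = x 0) /\ (1 <= t -> x t = x 1),
      forall t, x s @[s --> t^'+] --> x t &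
      forall t, exists2 l, simplex l & x s @[s --> t^'-] --> l].

Record skorokhod :=
  Skorokhod { path_fun :> R -> V ; path_cadlag : cadlag path_fun }.

Lemma bary_simplex : simplex (bary : V).
Proof.
split=> [i|]; first by rewrite mxE invr_gt0 ltr0n /= invf_lt1 ?ltr0n// ltr1n.
under eq_bigr do rewrite mxE.
by rewrite sumr_const card_ord -[_ *+ _]mulr_natr mulVf// pnatr_eq0.
Qed.

Lemma cadlag_bary : cadlag (fun=> bary).
Proof.
split=> // [_|t|t]; [exact: bary_simplex|exact: cvg_cst|].
by exists bary; [exact: bary_simplex|exact: cvg_cst].
Qed.

HB.instance Definition _ := gen_eqMixin skorokhod.
HB.instance Definition _ := gen_choiceMixin skorokhod.
HB.instance Definition _ := isPointed.Build skorokhod (Skorokhod cadlag_bary).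

Definition time_change (l : R -> R) :=
  [/\ {in `[0, 1] &, {homo l : s t / s < t}},
      {within `[0, 1], continuous l}, l 0 = 0 & l 1 = 1].

(* The sup norm of 'rV[R]_n is used; any other norm gives the same topology. *)
Definition skorokhod_dist (x y : skorokhod) : R :=
  inf [set e | 0 <= e /\ exists2 l, time_change l &
    forall t, t \in `[0, 1] -> `|l t - t| <= e /\ `|x t - y (l t)| <= e].

Definition skorokhod_open : set (set skorokhod) :=
  [set U | forall x, U x -> exists2 e, 0 < e &
    forall y, skorokhod_dist x y < e -> U y].

Let skorokhod_openT : skorokhod_open setT.
Proof. by move=> x _; exists 1. Qed.

Let skorokhod_openI : setI_closed skorokhod_open.
Proof.
move=> A B oA oB x [/oA[e e0 eA] /oB[f f0 fB]].
exists (Num.min e f); first by rewrite lt_min e0.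
by move=> y; rewrite lt_min => /andP[/eA ? /fB ?].
Qed.

Let skorokhod_open_bigU (I : Type) (f : I -> set skorokhod) :
  (forall i, skorokhod_open (f i)) -> skorokhod_open (\bigcup_i f i).
Proof.
move=> of_ x [i _ /of_[e e0 ef]]; exists e => // y /ef fy.
by exists i.
Qed.

HB.instance Definition _ := isOpenTopological.Build skorokhod
  skorokhod_openT skorokhod_openI skorokhod_open_bigU.

(* The path t |-> f t, t in [0, 1]. When this is not a cadlag path in the
   simplex (which for the random paths below only occurs on a null event), it
   is replaced by the constant path at the barycenter. *)
Definition path_of (f : R -> V) : skorokhod :=
  match pselect (cadlag (fun t => f (Num.max 0 (Num.min 1 t)))) with
  | left h => Skorokhod h
  | right _ => Skorokhod cadlag_bary
  end.

End Skorokhod.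

Section Random.
Context d (Omega : measurableType d) (R : realType).
Variable Pr : probability Omega R.

Definition mutually_independent (I : eqType) (F : I -> set (set Omega)) :=
  forall (s : seq I) (A : I -> set Omega), uniq s ->
    (forall i, i \in s -> F i (A i)) ->
    Pr (\bigcap_(i in [set` s]) A i) = (\prod_(i <- s) Pr (A i))%E.

(* Since sigma-algebras contain setT, no condition on pairs is needed. *)
Definition independent3 (F G H : set (set Omega)) :=
  forall A B C, F A -> G B -> H C ->
    Pr (A `&` B `&` C) = (Pr A * Pr B * Pr C)%E.

Definition sigma_of d' (T : measurableType d') (I : Type) (D : set I)
    (X : I -> Omega -> T) : set (set Omega) :=
  <<s \bigcup_(i in D) preimage_set_system setT (X i) measurable >>.

Definition iid d' (T : measurableType d') (X : nat -> {RV Pr >-> T})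
    (P : probability T R) :=
  mutually_independent (fun j => sigma_of [set j] X) /\
  forall j (A : set T), measurable A -> distribution Pr (X j) A = P A.

Definition Gamma (a : R) : R :=
  \int[lebesgue_measure]_(x in `]0, +oo[) (x `^ (a - 1) * expR (- x)).

Definition gamma_law (a : R) (A : set R) : \bar R :=
  (\int[lebesgue_measure]_(x in A `&` `]0%R, +oo[)
     (x `^ (a - 1) * expR (- x) / Gamma a)%:E)%E.

Definition stationary_independent_increments (X : R -> Omega -> R) :=
  [/\ forall t, 0 <= t -> measurable_fun setT (X t),
      forall s t, 0 <= s <= t -> forall A : set R, measurable A ->
        Pr ((fun w => X t w - X s w) @^-1` A) = Pr (X (t - s) @^-1` A) &
      forall t : nat -> R, 0 <= t 0%N -> (forall k, t k <= t k.+1) ->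
        mutually_independent (fun k : nat =>
          sigma_of [set k] (fun k w => X (t k.+1) w - X (t k) w))].

Definition gamma_subordinator (X : R -> Omega -> R) :=
  [/\ stationary_independent_increments X,
      {ae Pr, forall w, [/\ X 0 w = 0,
        forall s t, 0 <= s <= t -> X s w <= X t w &
        forall t, 0 <= t -> X s w @[s --> t^'+] --> X t w]} &
      forall t, 0 < t -> forall A : set R, measurable A ->
        Pr (X t @^-1` A) = gamma_law t A].

(* Only the times t >= 0 of a process X : R -> Omega -> R are relevant. *)
Definition iid_gamma_vectors (n : nat) (g : nat -> 'I_n -> R -> Omega -> R) :=
  [/\ forall j i, gamma_subordinator (g j i),
      forall j, mutually_independent
        (fun i => sigma_of [set t | 0 <= t] (g j i)) &
      mutually_independent (fun j =>
        sigma_of [set it | 0 <= it.2] (fun it => g j it.1 it.2))].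

End Random.

Section Bridge.
Context (R : realType) (m : nat).
Local Notation n := m.+2.
Local Notation V := 'rV[R]_n.

Definition f_density (lambda : R) (q p : V) : R :=
  Gamma lambda / Gamma (lambda / n%:R) ^+ n * (\prod_i q 0 i)^-1 *
  (\prod_i (q 0 i / p 0 i) `^ (lambda / n%:R)) *
  (\sum_i q 0 i / p 0 i) `^ (- lambda).

Definition nu_weight (lambda : R) (N : nat) (p q : nat -> V) (s : 'S_N) : R :=
  (\prod_(i < N) f_density lambda (q (s i)) (p i)) /
  \sum_(r : 'S_N) \prod_(i < N) f_density lambda (q (r i)) (p i).

(* The path from p to q driven by one realization g of the n subordinators *)
Definition gamma_bridge (lambda : R) (g : 'I_n -> R -> R) (p q : V)
    (t : R) : V :=
  let pi i := g i (t * lambda) / g i lambda * smul q (sinv p) 0 i in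
  \row_i (((1 - t) * p 0 i / n%:R + pi i * p 0 i) /
          \sum_k ((1 - t) * p 0 k / n%:R + pi k * p 0 k)).

Definition M_perm (lambda : R) (N : nat) (p q : nat -> V)
    (g : nat -> 'I_n -> R -> R) (s : 'S_N) :
    set (borel (skorokhod R m)) -> \bar R :=
  fun A => ((N%:R^-1)%:E *
    \sum_(j < N)
      \d_(path_of (gamma_bridge lambda (g j) (p j) (q (s j)))
           : borel (skorokhod R m)) A)%E.

Definition M_random (lambda : R) (N : nat) (p q : nat -> V)
    (g : nat -> 'I_n -> R -> R) : set (borel (skorokhod R m)) -> \bar R :=
  fun A => (\sum_(s : 'S_N)
    (nu_weight lambda p q s)%:E * M_perm lambda p q g s A)%E.

Definition displacement (z : V * V) : skorokhod R m :=
  path_of (fun t => smul z.1 ((1 - t) *: bary + t *: smul z.2 (sinv z.1))).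

End Bridge.

(* Main.v *)
(* Write D for the L-divergence of phi. The optimal map T from P0 to P1 is the
   one generated by phi: comparing the cost of its coupling with that of the
   known coupling of (matched_price phi y, y), y ~ P1, shows that P0-almost
   every p is matched by phi to y = T p. For such a pair, c(p, q) = D[q : y] +
   u(q) + v(p), and since the separable terms cancel in nu_N^sigma, nu_N is the
   Gibbs measure with energy lambda sum_j D[q(sigma j) : y(j)]. By Gibbs'
   variational inequality the mean energy exceeds the minimal one by at most
   ln(N!) / lambda = o(N), and the minimal one is o(N) since the y(j) and the
   q(j) have the same law P1, so that they can be matched up to o(N) points
   inside the cells of any finite grid. As D dominates alpha |q - y|^2, under
   nu_N all but a small proportion of the endpoints q(sigma j) are close to
   y(j). By the law of large numbers, gamma(t lambda) / gamma(lambda) is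
   uniformly close to t for all but a small proportion of the subordinators.
   Hence the integral of a bounded continuous functional against M_N is close to
   its average along the displacement paths from p(j) to y(j), and these are
   i.i.d. *)

Require Import Defs.
From HB Require Import structures.
From mathcomp Require Import all_boot all_order all_algebra perm.
From mathcomp Require Import all_classical all_reals all_analysis.
From mathcomp Require Import measurable_realfun ring lra zify.

Set Implicit Arguments.
Unset Strict Implicit.
Unset Printing Implicit Defensive.

Import Order.TTheory GRing.Theory Num.Theory.
Import numFieldNormedType.Exports.

Local Open Scope classical_set_scope.
Local Open Scope ring_scope.

(** * Gibbs weights and matchings *)

(** The exceptional null set must not depend on the test functional, and the bounded continuous
    functionals form an uncountable family. All probability is therefore confined to countably many
    almost sure statements about grid cells and about deviations of subordinators; then one outcome
    is fixed and every functional is treated deterministically. A functional is only pointwise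
    continuous, so it is approximated by a function of the grid cell of the pair (p, y), and the
    cells where this fails are made small in measure by refining the grid. The clock lambda_N
    changes with N; a subordinator is accordingly called bad through an event about all large square
    times, which controls every large lambda at once. The rate enters twice: ln N / lambda_N -> 0
    makes the entropy ln(N!) negligible, and lambda_N -> oo straightens the gamma paths. In the
    comparison of couplings every integrand is kept nonnegative, by shifting the potential by a
    bound on phi, and the log-moments of [class_La] make the integrals finite, so that they can be
    cancelled. *)

Section Gibbs.
Context (R : realType) (S : finType).

(* Gibbs' variational inequality: [\sum_s nu s * ln (1 / (#|S| * nu s)) <= 0]. *)
Lemma gibbs_average_le (E nu : S -> R) (lam : R) (s0 : S) :
  0 < lam ->
  (forall s, nu s = expR (- lam * E s) / \sum_r expR (- lam * E r)) ->
  \sum_s nu s * E s <= E s0 + ln #|S|%:R / lam.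
Proof.
move=> lam0 nuE.
set Z := \sum_r expR (- lam * E r) in nuE.
have S0 : 0 < #|S|%:R :> R by rewrite ltr0n; apply/card_gt0P; exists s0.
have Zge : expR (- lam * E s0) <= Z.
  by rewrite /Z (bigD1 s0)//= lerDl sumr_ge0// => r _; rewrite expR_ge0.
have Z0 : 0 < Z by rewrite (lt_le_trans _ Zge)// expR_gt0.
have nu0 s : 0 < nu s by rewrite nuE divr_gt0// expR_gt0.
have nu1 : \sum_s nu s = 1.
  by under eq_bigr do rewrite nuE; rewrite -mulr_suml mulfV// gt_eqF.
have lnnu s : ln (nu s) = - lam * E s - ln Z.
  by rewrite nuE ln_div ?posrE ?expR_gt0// expRK.
(* This is [ln x <= x - 1] at [x = 1 / (#|S| * nu s)], multiplied by [nu s]; the right-hand sides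
   sum to 0. *)
have key s : nu s * (lam * E s + ln Z - ln #|S|%:R) <= #|S|%:R^-1 - nu s.
  have x0 : 0 < (#|S|%:R * nu s)^-1 by rewrite invr_gt0 mulr_gt0.
  have : ln (#|S|%:R * nu s)^-1 <= (#|S|%:R * nu s)^-1 - 1.
    by rewrite -{1}[_^-1](subrK 1) addrC le_ln1Dx// ltrBrDr addNr.
  rewrite lnV ?posrE ?mulr_gt0// lnM ?posrE// lnnu => h.
  have -> : lam * E s + ln Z - ln #|S|%:R = - (ln #|S|%:R + (- lam * E s - ln Z)).
    by ring.
  rewrite (le_trans (ler_wpM2l (ltW (nu0 s)) h))// mulrBr mulr1 lerD2r.
  by rewrite invfM mulrCA mulfV ?mulr1// gt_eqF.
have : \sum_s nu s * (lam * E s + ln Z - ln #|S|%:R) <= 0.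
  rewrite (le_trans (ler_sum _ (fun s _ => key s)))// sumrB nu1.
  by rewrite sumr_const -[_ *+ _]mulr_natr mulVf ?subrr// gt_eqF.
under eq_bigr do rewrite -addrA mulrDr mulrCA.
rewrite big_split/= -mulr_sumr -mulr_suml nu1 mul1r => h.
rewrite -(ler_pM2l lam0) mulrDr mulrCA mulfV ?gt_eqF// mulr1.
have : ln (expR (- lam * E s0)) <= ln Z by rewrite ler_ln ?posrE ?expR_gt0.
rewrite expRK => h'; lra.
Qed.

End Gibbs.

Lemma ln_fact_le (R : realType) (N : nat) :
  ln (N`!%:R : R) <= N%:R * ln (N%:R : R).
Proof.
case: N => [|N]; first by rewrite fact0 ln1 mul0r.
have -> : N.+1%:R * ln N.+1%:R = ln ((N.+1 ^ N.+1)%N%:R : R).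
  by rewrite natrX lnXn ?ltr0n// mulr_natl.
rewrite ?mul1r ler_ln ?posrE ?ltr0n ?fact_gt0 ?expn_gt0// ler_nat.
suff h k : (k <= N.+1 -> k`! <= N.+1 ^ k)%N by exact: h.
elim: k => [//|k ih] kN; by rewrite factS expnS leq_mul// ih// ltnW.
Qed.

Section Matching.

Local Open Scope set_scope.
Context (N : nat) (C : finType).

(* A permutation with the largest number of matches cannot be improved by a
   transposition, so it exhausts every colour on one of the two sides. *)
Lemma matching_exists (f h : 'I_N -> C) : exists s : 'S_N,
  (#|[set j : 'I_N | f j != h (s j)]| <=
     \sum_c (#|[set j : 'I_N | f j == c]| - #|[set j : 'I_N | h j == c]|))%N.
Proof.
pose G (s : 'S_N) := [set j : 'I_N | f j == h (s j)].
pose s := [arg max_(s > (1%g : 'S_N)) #|G s|].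
have smax r : (#|G r| <= #|G s|)%N.
  by rewrite /s; case: arg_maxnP => //= i _; apply.
exists s.
rewrite -sum1_card (partition_big f xpredT)//=.
apply: leq_sum => c _.
have -> : #|[set j : 'I_N | h j == c]| = #|[set j : 'I_N | h (s j) == c]|.
  rewrite -[RHS](card_imset _ (@perm_inj _ s)); apply: eq_card => j.
  rewrite inE; apply/idP/imsetP => [hj|[i]]; last by rewrite inE => hi ->.
  by exists (s^-1%g j); rewrite ?inE permKV.
have [/existsP[i /andP[/eqP hi fi]]|] :=
    boolP [exists i, (h (s i) == c) && (f i != c)].
  rewrite big1 ?leq0n// => j; rewrite inE andbC => /andP[/eqP fj hj].
  exfalso.
  (* [r] gives [j] the image of [i]. Neither [i] nor [j] was matched under [s], so a match is gained
     and none is lost. *)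
  pose r := (tperm j i * s)%g.
  have ji : j != i by apply: contraNneq fi => <-; rewrite fj.
  have : (#|G s| < #|G r|)%N.
    apply: proper_card; apply/properP; split; last first.
      by exists j; rewrite !inE ?permM ?tpermL ?hi ?fj// -fj.
    apply/fintype.subsetP => k; rewrite !inE permM => Gk.
    have kj : k != j by apply: contraNneq hj => <-.
    have ki : k != i by apply: contraNneq fi => e; move: Gk; rewrite e hi.
    by rewrite tpermD// eq_sym.
  by rewrite ltnNge smax.
rewrite negb_exists => /forallP nex.
rewrite sum1_card.
(* Every position sent to colour [c] now has colour [c] itself, so the mismatches of this colour are
   counted by the difference. *)
have sub : [set j : 'I_N | h (s j) == c] \subset [set j : 'I_N | f j == c].
  apply/fintype.subsetP => j; rewrite !inE => hj; have := nex j.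
  by rewrite hj /= negbK.
rewrite -cardsDS//; apply: subset_leq_card; apply/fintype.subsetP => j.
rewrite !inE => /andP[fj /eqP fc]; rewrite fc eqxx andbT.
by move: fj; rewrite inE fc eq_sym.
Qed.

End Matching.

(** * Gamma laws *)

Lemma measurable_set_ltr d (T : measurableType d) (R : realType) (f g : T -> R) :
  measurable_fun setT f -> measurable_fun setT g ->
  measurable [set x | f x < g x].
Proof.
move=> mf mg; rewrite -[X in measurable X]setTI.
exact: (measurable_fun_ltr mf mg measurableT (Y := [set true])).
Qed.

Section GammaMoments.
Context (R : realType).
Local Notation mu := (@lebesgue_measure R).

Lemma cvgr_expX_expRN (k : nat) : x ^+ k * expR (- x) @[x --> +oo%R] --> (0 : R).
Proof.
apply/cvgrPdist_le => e e0; near=> x.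
have x0 : 0 < x by near: x; exact: nbhs_pinfty_gt.
have h : x ^+ k.+1 / k.+1`!%:R <= expR x.
  by rewrite (le_trans _ (expR_ge1Dxn k (ltW x0)))// lerDr.
rewrite sub0r normrN ger0_norm ?mulr_ge0 ?exprn_ge0 ?expR_ge0 ?(ltW x0)//.
rewrite expRN ler_pdivrMr ?expR_gt0//.
have fx : k.+1`!%:R <= e * x.
  rewrite -ler_pdivrMl// mulrC; near: x; apply: nbhs_pinfty_ge.
rewrite ler_pdivrMr ?ltr0n ?fact_gt0// in h.
rewrite -(ler_pM2l x0) -exprS (le_trans h)// mulrA [x * e]mulrC mulrC.
by rewrite [leRHS]mulrC ler_wpM2l ?expR_ge0// mulrC.
Unshelve. all: by end_near. Qed.

(** Repeated integration by parts, with the constant of integration that makes the primitive vanish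
    at [+oo]; its value at 0 is then minus a factorial. *)
Fixpoint expX_primitive (k : nat) (x : R) : R :=
  match k with
  | 0 => - expR (- x)
  | k.+1 => - (x ^+ k.+1 * expR (- x)) + k.+1%:R * expX_primitive k x
  end.

Lemma is_derive_expX k (x : R) :
  is_derive x 1 (fun y : R => y ^+ k * expR (- y))
    (k%:R * x ^+ k.-1 * expR (- x) - x ^+ k * expR (- x)).
Proof.
have h1 : is_derive x 1 (fun y : R => y ^+ k) (k%:R * x ^+ k.-1).
  have -> : (fun y : R => y ^+ k) = (id : R -> R) ^+ k by rewrite exprfctE.
  apply: is_derive_eq.
  by rewrite /GRing.scale/= mulr1.
have h2 : is_derive x 1 (fun y : R => expR (- y)) (- expR (- x)).
  by apply: is_derive_eq; rewrite mulrN1.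
apply: is_derive_eq.
rewrite /GRing.scale/=; ring.
Qed.

Lemma is_derive_expX_primitive k (x : R) :
  is_derive x 1 (expX_primitive k) (x ^+ k * expR (- x)).
Proof.
elim: k => [|k ih] /=.
  apply: is_derive_eq.
  by rewrite expr0 mul1r; ring.
have h : is_derive x 1 (fun y : R => y ^+ k.+1 * expR (- y))
    (k.+1%:R * x ^+ k * expR (- x) - x ^+ k.+1 * expR (- x)).
  exact: is_derive_expX.
have h2 : is_derive x 1 (fun y : R => k.+1%:R * expX_primitive k y)
   (k.+1%:R * (x ^+ k * expR (- x))).
  exact: is_deriveZ.
apply: is_derive_eq.
by ring.
Qed.

Lemma expX_primitive0 k : expX_primitive k 0 = - k`!%:R.
Proof.
elim: k => [|k ih]; first by rewrite /= oppr0 expR0.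
by rewrite /= ih expr0n/= mul0r oppr0 add0r mulrN -natrM factS.
Qed.

Lemma cvg_expX_primitive k : expX_primitive k x @[x --> +oo%R] --> (0 : R).
Proof.
elim: k => [|k ih] /=; first by rewrite -oppr0; apply: cvgN; exact: cvgr_expR.
rewrite -[X in _ --> X]addr0 -[X in _ --> X + _]oppr0 -(mulr0 k.+1%:R).
apply: cvgD; first by rewrite mulr0; apply: cvgN; exact: cvgr_expX_expRN.
by apply: cvgM => //; exact: cvg_cst.
Qed.

Lemma measurable_expX (D : set R) (k : nat) :
  measurable_fun D (fun x : R => (x ^+ k * expR (- x))%:E).
Proof.
apply/measurable_funTS/measurable_EFinP/measurable_funM.
  exact: measurable_funX.
by apply: measurableT_comp => //; exact: measurable_expR.
Qed.

Lemma integral_expX (k : nat) :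
  (\int[mu]_(x in `]0%R, +oo[) (x ^+ k * expR (- x))%:E)%E = k`!%:R%:E.
Proof.
have cE (x : R) : {for x, continuous (fun x : R => x ^+ k * expR (- x))}.
  apply/differentiable_continuous/derivable1_diffP.
  by have [] := is_derive_expX k x.
have cP (x : R) : {for x, continuous (expX_primitive k)}.
  apply/differentiable_continuous/derivable1_diffP.
  by have [] := is_derive_expX_primitive k x.
rewrite integral_itv_obnd_cbnd; last first.
  exact: measurable_expX.
rewrite (@ge0_continuous_FTC2y _ _ (expX_primitive k) _ 0).
- by rewrite expX_primitive0 sub0e EFinN oppeK.
- by move=> x x0; rewrite mulr_ge0 ?expR_ge0 ?exprn_ge0.
- by apply: continuous_subspaceT => x; exact: cE.
- exact: cvg_expX_primitive.
- by move=> x _; have [] := is_derive_expX_primitive k x.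
- by apply: cvg_at_right_filter; exact: cP.
- move=> x _; rewrite derive1E.
  by have [_ ->] := is_derive_expX_primitive k x.
Qed.

Lemma measurable_gamma_density (D : set R) (a : R) :
  measurable_fun D (fun x : R => x `^ (a - 1) * expR (- x)).
Proof.
apply/measurable_funTS/measurable_funM; first exact: measurable_powR.
by apply: measurableT_comp => //; exact: measurable_expR.
Qed.

(** Integer parameters serve the moment bounds, since the subordinators will be observed at the
    integer times [(k + 1) ^ 2]. *)
Lemma GammaS (k : nat) : Gamma (k.+1%:R : R) = k`!%:R.
Proof.
rewrite /Gamma /Rintegral; have -> : (k.+1%:R - 1 : R) = k%:R.
  by rewrite -natr1 addrK.
rewrite -[RHS]/(fine k`!%:R%:E) -integral_expX; congr fine.
apply: eq_integral => x; rewrite inE/= in_itv/= andbT => x0.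
by rewrite powR_mulrn// ltW.
Qed.

Lemma Gamma_gt0 (a : R) : 1 <= a -> 0 < Gamma a.
Proof.
move=> a1; rewrite /Gamma /Rintegral.
set f := fun x : R => (x `^ (a - 1) * expR (- x))%:E.
have f0 x : (0 <= f x)%E by rewrite lee_fin mulr_ge0 ?powR_ge0 ?expR_ge0.
have mf D : measurable_fun D f.
  by apply/measurable_EFinP; exact: measurable_gamma_density.
apply: fine_gt0; apply/andP; split.
  apply: (@lt_le_trans _ _ (expR (- 2))%:E); first by rewrite lte_fin expR_gt0.
  apply: (@le_trans _ _ (\int[mu]_(x in `[1%R, 2%R]) f x)%E); last first.
    apply: ge0_subset_integral => //=; first exact: mf.
    by move=> x /=; rewrite !in_itv/= andbT => /andP[x1 _]; rewrite (lt_le_trans _ x1).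
  apply: (@le_trans _ _ (\int[mu]_(x in `[1%R, 2%R]) (expR (- 2))%:E)%E).
    rewrite integral_cst//= lebesgue_measure_itv/= lte_fin ltr1n -EFinB.
    by rewrite -EFinM lee_fin -[leLHS]mulr1; apply: ler_wpM2l; rewrite ?expR_ge0//; lra.
  apply: ge0_le_integral => //=; first exact: mf.
  move=> x /=; rewrite in_itv/= => /andP[x1 x2].
  rewrite /f lee_fin -[leLHS]mul1r ler_pM ?expR_ge0//.
    by rewrite -{1}(powRr0 x) ler_powR// subr_ge0.
  by rewrite ler_expR lerN2.
pose k := Num.truncn a.
have ak : a - 1 <= k%:R.
  by rewrite lerBlDr natr1 ltW// truncnS_gt.
apply: (@le_lt_trans _ _ (\int[mu]_(x in `]0%R, +oo[)
    ((x ^+ 0 * expR (- x))%:E + (x ^+ k * expR (- x))%:E))%E).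
  apply: ge0_le_integral => //=.
  - by move=> x _; exact: f0.
  - exact: mf.
  - by apply: emeasurable_funD; exact: measurable_expX.
  move=> x /=; rewrite in_itv/= andbT => x0.
  rewrite /f -EFinD lee_fin -mulrDl ler_wpM2r ?expR_ge0//.
  have [x1|x1] := leP x 1.
    rewrite (@le_trans _ _ 1)//; last by rewrite expr0 lerDl exprn_ge0// ltW.
    by rewrite -[leRHS](powRr0 x) ger_powR ?x0// subr_ge0.
  rewrite (@le_trans _ _ (x ^+ k))//; last by rewrite expr0 lerDr.
  by rewrite -powR_mulrn ?(ltW x0)// ler_powR// ltW.
rewrite ge0_integralD//; last 4 first.
- by move=> x /=; rewrite in_itv/= andbT => x0; rewrite lee_fin mulr_ge0 ?exprn_ge0 ?expR_ge0// ltW.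
- exact: measurable_expX.
- by move=> x /=; rewrite in_itv/= andbT => x0; rewrite lee_fin mulr_ge0 ?exprn_ge0 ?expR_ge0// ltW.
- exact: measurable_expX.
by rewrite !integral_expX -EFinD ltry.
Qed.

(* Chebyshev's inequality: the law Gamma(a, 1) has mean and variance a. *)
Lemma gamma_law_tail (k : nat) (e : R) : 0 < e ->
  (gamma_law (k.+1%:R : R) [set x | (e * k.+1%:R < `|x - k.+1%:R|)%R] <=
   (e ^- 2 / k.+1%:R)%:E)%E.
Proof.
move=> e0; rewrite /gamma_law; set a : R := k.+1%:R; set A := [set x | _].
have a0 : 0 < a by rewrite ltr0n.
have fk0 : 0 < k`!%:R :> R by rewrite ltr0n fact_gt0.
have mA : measurable A.
  apply: (measurable_set_ltr (measurable_cst _)).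
  by apply: measurableT_comp => //; exact: measurable_funB.
have m0 (j : nat) x : `]0%R, +oo[%classic x -> (0 <= (x ^+ j * expR (- x))%:E)%E.
  by rewrite /= in_itv/= andbT => x0; rewrite lee_fin mulr_ge0 ?exprn_ge0 ?expR_ge0// ltW.
have m1 (c : R) (j : nat) x : (0 <= c)%R -> `]0%R, +oo[%classic x ->
     (0 <= c%:E * (x ^+ j * expR (- x))%:E)%E.
  by move=> c0 x0; rewrite mule_ge0// m0.
pose V := fun x : R => ((x - a) ^+ 2 * (x ^+ k * expR (- x)))%:E.
have V0 x : `]0%R, +oo[%classic x -> (0 <= V x)%E.
  by move=> x0; rewrite /V EFinM mule_ge0 ?m0// lee_fin sqr_ge0.
have mV : measurable_fun (`]0%R, +oo[%classic : set R) V.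
  apply/measurable_EFinP/measurable_funM.
    by apply: measurable_funX; exact: measurable_funB.
  by apply/measurable_EFinP; exact: measurable_expX.
have VE : (\int[mu]_(x in `]0%R, +oo[) V x)%E = (a * k`!%:R)%:E.
  (* The negative cross term of the square is moved to the other side, so that only integrals of
     nonnegative functions are added; finiteness of the integral of [V] then follows from the
     identity. *)
  have : (\int[mu]_(x in `]0%R, +oo[) (V x + (2 * a)%:E * (x ^+ k.+1 * expR (- x))%:E)
     = \int[mu]_(x in `]0%R, +oo[) ((x ^+ k.+2 * expR (- x))%:E +
        (a ^+ 2)%:E * (x ^+ k * expR (- x))%:E))%E.
    apply: eq_integral => x _; rewrite /V -!EFinM -!EFinD; congr EFin.
    by rewrite !exprS; ring.
  rewrite ge0_integralD//; last 2 first.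
  - by move=> x; apply: m1; rewrite mulr_ge0// ltW.
  - by apply: measurable_funeM; exact: measurable_expX.
  rewrite ge0_integralD//; last 4 first.
  - exact: m0.
  - exact: measurable_expX.
  - by move=> x; apply: m1; rewrite sqr_ge0.
  - by apply: measurable_funeM; exact: measurable_expX.
  rewrite !ge0_integralZl//; last 6 first.
  - exact: measurable_expX.
  - exact: m0.
  - by rewrite lee_fin sqr_ge0.
  - exact: measurable_expX.
  - exact: m0.
  - by rewrite lee_fin mulr_ge0// ltW.
  rewrite !integral_expX -!EFinM -EFinD => h.
  have Vf : (\int[mu]_(x in `]0%R, +oo[) V x)%E \is a fin_num.
    move: h; case: (\int[mu]_(x in `]0%R, +oo[) V x)%E => //=.
  move: h; rewrite -(fineK Vf) -EFinD => -[h]; congr EFin.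
  have {h} -> : fine (\int[mu]_(x in `]0%R, +oo[) V x) =
     (k.+2)`!%:R + a ^+ 2 * k`!%:R - 2 * a * (k.+1)`!%:R by rewrite -h addrK.
  by rewrite !factS !natrM /a -(natr1 k.+1) -(natr1 k); ring.
apply: (@le_trans _ _ (\int[mu]_(x in `]0%R, +oo[) ((e ^- 2 / a ^+ 2 / k`!%:R)%:E * V x))%E).
  apply: (@le_trans _ _ (\int[mu]_(x in A `&` `]0%R, +oo[)
      ((e ^- 2 / a ^+ 2 / k`!%:R)%:E * V x))%E).
    apply: ge0_le_integral => //=.
    - exact: measurableI.
    - by move=> x _; rewrite lee_fin mulr_ge0 ?invr_ge0 ?mulr_ge0 ?powR_ge0 ?expR_ge0 ?GammaS// ltW.
    - apply/measurable_EFinP/measurable_funM => //.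
      exact: measurable_gamma_density.
    - apply: measurable_funeM; apply: measurable_funS mV => //.
    - move=> x [Ax]; rewrite /= in_itv/= andbT => x0.
      rewrite /V -EFinM lee_fin.
      rewrite [a - 1](_ : _ = k%:R); last by rewrite /a -natr1 addrK.
      rewrite powR_mulrn ?(ltW x0)// /a GammaS -/a mulrC.
      rewrite -(mulrA (e ^- 2 / a ^+ 2)) mulrCA [leRHS]mulrCA [leLHS]mulrCA.
      rewrite ler_wpM2l ?invr_ge0 ?ler0n//.
      rewrite [leRHS]mulrA ler_peMl ?mulr_ge0 ?exprn_ge0 ?expR_ge0 ?(ltW x0)//.
      rewrite -invfM -exprMn mulrC ler_pdivlMr ?exprn_gt0 ?mulr_gt0// mul1r.
      rewrite -(@real_normK _ (x - a)) ?num_real// lerXn2r ?nnegrE ?mulr_ge0 ?(ltW e0) ?(ltW a0)//.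
      exact: ltW.
  apply: ge0_subset_integral => //=.
  - exact: measurableI.
  - exact: measurable_funeM.
  - move=> x x0; rewrite mule_ge0 ?V0// lee_fin.
    by rewrite !mulr_ge0 ?invr_ge0 ?exprn_ge0 ?(ltW e0) ?(ltW a0)// ler0n.
rewrite ge0_integralZl//; last first.
  by rewrite lee_fin !mulr_ge0 ?invr_ge0 ?exprn_ge0 ?(ltW e0) ?(ltW a0)// ler0n.
rewrite VE -EFinM lee_fin le_eqVlt; apply/orP; left; apply/eqP.
by field; rewrite !gt_eqF.
Qed.

End GammaMoments.

(** * A strong law of large numbers for events *)

Section LawOfLargeNumbers.
Context (R : realType).

Lemma nneseries_inv_sqr_lty (C : R) : 0 <= C ->
  (\sum_(0 <= k <oo) (C / k.+1%:R ^+ 2)%:E < +oo)%E.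
Proof.
move=> C0.
(* The bound is chosen to telescope: its increment is [C] times 2 / ((n + 1)(n + 2)), which is at
   least 1 / (n + 1)^2 times [C]. *)
have key n : (\sum_(0 <= k < n) (C / k.+1%:R ^+ 2) <= C * (2 - 2 / n.+1%:R) :> R).
  elim: n => [|n ih]; first by rewrite big_geq// divr1 subrr mulr0.
  rewrite big_nat_recr//= (le_trans (lerD ih (lexx _)))// -mulrDr.
  rewrite ler_wpM2l//.
  have a0 : 0 < n.+1%:R :> R by rewrite ltr0n.
  have -> : n.+2%:R = n.+1%:R + 1 :> R by rewrite -natr1.
  set a : R := n.+1%:R in a0 *.
  have a1 : 1 <= a by rewrite /a ler1n.
  have -> : 2 - 2 / (a + 1) = 2 - 2 / a + (2 / (a * (a + 1))).
    by field; rewrite !gt_eqF// ?addr_gt0.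
  rewrite lerD2l expr2 -[leLHS]mul1r ler_pdivrMr ?mulr_gt0//.
  rewrite mulrAC ler_pdivlMr ?mulr_gt0 ?addr_gt0//; nra.
apply: (@le_lt_trans _ _ (C * 2)%:E); last by rewrite ltry.
apply: lime_le.
  by apply: is_cvg_nneseries => k _ _; rewrite lee_fin divr_ge0// exprn_ge0.
apply: nearW => n; rewrite sumEFin lee_fin (le_trans (key n))//.
rewrite ler_wpM2l// gerBl divr_ge0//.
Qed.

(** The gap between consecutive squares near n is of order sqrt n. With increments bounded by 1 the
    sequence moves by that much at most, which is o(n). *)
Lemma cvg0_sqrn_interpolation (a : nat -> R) :
  a 0 = 0 -> (forall n, `|a n.+1 - a n| <= 1) ->
  (fun k => a (k.+1 ^ 2)%N / (k.+1 ^ 2)%N%:R) @ \oo --> (0 : R) ->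
  (fun n => a n / n%:R) @ \oo --> (0 : R).
Proof.
move=> a0 da ca.
have daD n k : `|a (n + k)%N - a n| <= k%:R.
  elim: k => [|k ih]; first by rewrite addn0 subrr normr0.
  rewrite addnS -(subrKA (a (n + k)%N)) (le_trans (ler_normD _ _))//.
  by rewrite -natr1 addrC lerD.
have sqr_ex n : (0 < n)%N -> exists k, (k.+1 ^ 2 <= n < k.+2 ^ 2)%N.
  elim: n => [//|[_ _|n /(_ isT)[k /andP[k1 k2]] _]]; first by exists 0.
  have [h|h] := ltnP n.+2 (k.+2 ^ 2)%N; first by exists k; rewrite h (leq_trans k1).
  exists k.+1; rewrite h/= (leq_ltn_trans k2)// ltn_exp2r//.
apply/cvgrPdist_le => e e0.
have e20 : 0 < e / 2 by rewrite divr_gt0.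
move/cvgrPdist_le : ca => /(_ _ e20)[K _ Ka].
have [L _ La] := near_infty_natSinv_lt (PosNum (divr_gt0 e20 (ltr0n R 3))).
exists ((maxn K L).+2 ^ 2)%N => // n /= nK.
have n0 : (0 < n)%N by rewrite (leq_trans _ nK)// expn_gt0.
have [k /andP[k1 k2]] := sqr_ex _ n0.
have Kk : (maxn K L <= k)%N.
  have := leq_ltn_trans nK k2; rewrite ltn_exp2r// !ltnS.
  by apply: leq_trans; rewrite leqnSn.
have n0' : 0 < n%:R :> R by rewrite ltr0n.
rewrite sub0r normrN normrM normfV (ger0_norm (ltW n0')) ler_pdivrMr//.
have h1 := daD (k.+1 ^ 2)%N (n - k.+1 ^ 2)%N; rewrite subnKC// in h1.
have h2 := Ka k (leq_trans (leq_maxl _ _) Kk).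
have h3 := La k (leq_trans (leq_maxr _ _) Kk).
rewrite /= in h3.
rewrite sub0r normrN normrM normfV normr_nat in h2.
set b : R := k.+1%:R in h3.
have b0 : 0 < b by rewrite ltr0n.
have bE : (k.+1 ^ 2)%N%:R = b ^+ 2 by rewrite natrX.
rewrite bE ler_pdivrMr ?exprn_gt0// in h2.
rewrite -div1r ltr_pdivrMr// in h3.
have h4 : (n - k.+1 ^ 2)%N%:R <= 3 * b.
  rewrite -[3 * b]natrM ler_nat leq_subLR; nia.
have h5 : b ^+ 2 <= n%:R by rewrite -bE ler_nat.
have h6 : `|a n| <= `|a (k.+1 ^ 2)%N| + 3 * b.
  rewrite -[a n](subrK (a (k.+1 ^ 2)%N)) (le_trans (ler_normD _ _))// addrC lerD2l.
  exact: le_trans h4.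
rewrite (le_trans h6)//.
apply: (@le_trans _ _ (e * b ^+ 2)); last by rewrite ler_wpM2l// ltW.
have h7 : 3 * b <= e / 2 * b ^+ 2.
  rewrite expr2 mulrA ler_wpM2r ?(ltW b0)//.
  have h8 : 3 * 1 <= 3 * (e / 2 / 3 * b) by rewrite ler_wpM2l// ltW.
  by move: h8; rewrite mulr1 => /le_trans; apply; lra.
lra.
Qed.

Context d (Omega : measurableType d) (Pr : probability Omega R).

(** The series of the [g k] has finite expectation, hence converges almost surely, and its terms
    tend to 0. *)
Lemma ae_cvg0_summable (g : nat -> Omega -> R) (C : R) :
  0 <= C ->
  (forall k, measurable_fun setT (g k)) -> (forall k w, 0 <= g k w) ->
  (forall k, (\int[Pr]_w (g k w)%:E <= (C / k.+1%:R ^+ 2)%:E)%E) ->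
  {ae Pr, forall w, (fun k => g k w) @ \oo --> (0 : R)}.
Proof.
move=> C0 mg g0 gC.
have S0 w : (0 <= \sum_(0 <= k <oo) (g k w)%:E)%E.
  by apply: nneseries_ge0 => k _ _; rewrite lee_fin.
have mS : measurable_fun setT (fun w => \sum_(0 <= k <oo) (g k w)%:E)%E.
  apply: ge0_emeasurable_sum => // k; first by move=> w _ _; rewrite lee_fin.
  by move=> _; exact/measurable_EFinP.
have : Pr.-integrable setT (fun w => \sum_(0 <= k <oo) (g k w)%:E)%E.
  apply/integrableP; split => //.
  under eq_integral do rewrite gee0_abs//.
  rewrite integral_nneseries//=; last 2 first.
  - by move=> k; exact/measurable_EFinP.
  - by move=> k w _; rewrite lee_fin.
  apply: le_lt_trans (nneseries_inv_sqr_lty C0).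
  apply: lee_nneseries => // k _.
  by move=> _; apply: integral_ge0 => w _; rewrite lee_fin.
move=> /(integrable_ae measurableT).
apply: filterS => w /(_ I) Sf.
have Soo : (\sum_(0 <= k <oo) (g k w)%:E < +oo)%E by rewrite ltey_eq Sf.
have := nneseries_tail_cvg Soo (fun k _ => (g0 k w : (0 <= (g k w)%:E)%E)).
move=> tail.
have /fine_cvgP[_] // : (fun k => (g k w)%:E) @ \oo --> (0%:E : \bar R).
apply: (@squeeze_cvge _ _ _ _ (cst 0%E) _
   (fun n => \sum_(n <= k <oo) (g k w)%:E)%E); [|exact: cvg_cst|exact: tail].
apply: nearW => n; rewrite lee_fin g0/=.
rewrite (@nneseries_split _ _ n 1)//; last by move=> *; rewrite lee_fin.
rewrite addn1 big_nat1 leeDl// nneseries_ge0// => k _ _.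
by rewrite lee_fin.
Qed.

Section Events.
Context (E : nat -> set Omega).
Hypothesis mE : forall j, measurable (E j).
Hypothesis indE : forall i j, i != j -> Pr (E i `&` E j) = (Pr (E i) * Pr (E j))%E.

Let p (j : nat) : R := fine (Pr (E j)).

Let pE j : Pr (E j) = (p j)%:E.
Proof. by rewrite /p fineK// fin_num_measure. Qed.

Let p01 j : 0 <= p j <= 1.
Proof. by rewrite -!lee_fin -pE measure_ge0/= probability_le1. Qed.

Let S N w : R := \sum_(j < N) \1_(E j) w.
Let m N : R := \sum_(j < N) p j.

Let mS N : measurable_fun setT (S N).
Proof. by apply: measurable_sum => j; exact: measurable_indic. Qed.

(** In the second moment the diagonal contributes [m N <= N], and by independence the off-diagonal
    terms contribute at most [m N ^+ 2], which the centering removes. *)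
Let variance_count_le N : (\int[Pr]_w ((S N w - m N) ^+ 2)%:E <= N%:R%:E)%E.
Proof.
have m0 : 0 <= m N by apply: sumr_ge0 => j _; have /andP[] := p01 j.
have S0 w : 0 <= S N w by apply: sumr_ge0.
have mi j : measurable_fun setT (fun w => (\1_(E j) w)%:E : \bar R).
  by apply/measurable_EFinP; exact: measurable_indic.
have IS : (\int[Pr]_w (S N w)%:E = (m N)%:E)%E.
  under eq_integral do rewrite /S -sumEFin.
  rewrite ge0_integral_sum//.
  rewrite /m -sumEFin; apply: eq_bigr => j _.
  by rewrite integral_indic// setIT; exact: pE.
have IS2 : (\int[Pr]_w (S N w ^+ 2)%:E =
    (m N + \sum_(i < N) \sum_(j < N | j != i) p i * p j)%:E)%E.
  transitivity (\int[Pr]_w \sum_(i < N) \sum_(j < N) (\1_(E i `&` E j) w)%:E)%E.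
    apply: eq_integral => w _; rewrite /S expr2 mulr_suml -sumEFin.
    apply: eq_bigr => i _; rewrite mulr_sumr -sumEFin; apply: eq_bigr => j _.
    by rewrite indicI.
  have mI i j : measurable_fun setT (fun w => (\1_(E i `&` E j) w)%:E : \bar R).
    by apply/measurable_EFinP; apply: measurable_indic; exact: measurableI.
  rewrite ge0_integral_sum//; last 2 first.
  - by move=> i; apply: emeasurable_sum => j.
  - by move=> i w _; apply: sume_ge0.
  rewrite /m -big_split/= -sumEFin; apply: eq_bigr => i _.
  rewrite ge0_integral_sum// (bigD1 i)//= setIid integral_indic// setIT EFinD.
  congr (_ + _)%E; [exact: pE|rewrite -sumEFin]; apply: eq_bigr => j ji.
  rewrite integral_indic//; last exact: measurableI.
  rewrite setIT EFinM; transitivity (Pr (E i) * Pr (E j))%E; last by rewrite !pE.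
  by apply: indE; rewrite eq_sym.
have mEF (f : Omega -> R) : measurable_fun setT f -> measurable_fun setT (fun w => (f w)%:E).
  by move=> ?; exact/measurable_EFinP.
have : (\int[Pr]_w (((S N w - m N) ^+ 2)%:E + (2 * m N)%:E * (S N w)%:E) =
   \int[Pr]_w ((S N w ^+ 2)%:E + (m N ^+ 2)%:E))%E.
  apply: eq_integral => w _; rewrite -EFinM -!EFinD; congr EFin; ring.
rewrite ge0_integralD//; last 4 first.
- by move=> w _; rewrite lee_fin sqr_ge0.
- by apply: mEF; apply: measurable_funX; exact: measurable_funB.
- by move=> w _; rewrite -EFinM lee_fin !mulr_ge0.
- by apply: measurable_funeM; exact: mEF.
rewrite ge0_integralD//; last 3 first.
- by move=> w _; rewrite lee_fin sqr_ge0.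
- by apply: mEF; exact: measurable_funX.
- by move=> w _; rewrite lee_fin sqr_ge0.
rewrite ge0_integralZl//; last 3 first.
- exact: mEF.
- by move=> w _; rewrite lee_fin.
- by rewrite lee_fin mulr_ge0.
have -> : (\int[Pr]_w (m N ^+ 2)%:E = (m N ^+ 2)%:E)%E.
  by rewrite integral_cst//= -[RHS]mule1; congr (_ * _)%E; exact: probability_setT.
rewrite IS IS2 -EFinM -EFinD.
case: (\int[Pr]_w ((S N w - m N) ^+ 2)%:E)%E => //= r.
rewrite -EFinD => -[h]; rewrite lee_fin.
have -> : r = m N + (\sum_(i < N) \sum_(j < N | j != i) p i * p j - m N ^+ 2).
  by move: h; rewrite -mulrA -expr2 => h; lra.
have h1 : \sum_(i < N) \sum_(j < N | j != i) p i * p j <= m N ^+ 2.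
  rewrite expr2 {1}/m mulr_suml; apply: ler_sum => i _.
  rewrite mulr_sumr [leRHS](bigD1 i)//= lerDr mulr_ge0//; by have /andP[] := p01 i.
have h2 : m N <= N%:R.
  rewrite -[N in leRHS]card_ord -sumr_const; apply: ler_sum => i _.
  by have /andP[] := p01 i.
lra.
Qed.

(** Along [N = (k + 1) ^ 2] the variance of the average is at most 1 / (k + 1)^2, a summable bound,
    so Chebyshev's method with pairwise independence applies; the values of [N] between two squares
    follow by interpolation. *)
Lemma slln_events : {ae Pr, forall w,
  (fun N : nat => (\sum_(j < N) (\1_(E j) w - fine (Pr (E j)))) / N%:R)
    @ \oo --> (0 : R)}.
Proof.
have SmE N w : \sum_(j < N) (\1_(E j) w - fine (Pr (E j))) = S N w - m N.
  by rewrite sumrB.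
have : {ae Pr, forall w, (fun k : nat =>
    ((S (k.+1 ^ 2)%N w - m (k.+1 ^ 2)%N) / (k.+1 ^ 2)%N%:R) ^+ 2) @ \oo --> (0 : R)}.
  apply: (@ae_cvg0_summable _ 1) => //.
  - move=> k; apply: measurable_funX; apply: measurable_funM => //.
    exact: measurable_funB.
  - by move=> k w; rewrite sqr_ge0.
  - move=> k; set n := (k.+1 ^ 2)%N.
    have n0 : 0 < n%:R :> R by rewrite ltr0n expn_gt0.
    under eq_integral do rewrite exprMn mulrC EFinM.
    rewrite ge0_integralZl//; last 2 first.
    + apply/measurable_EFinP; apply: measurable_funX; exact: measurable_funB.
    + by move=> w _; rewrite lee_fin sqr_ge0.
    apply: (@le_trans _ _ (((n%:R^-1) ^+ 2)%:E * n%:R%:E)%E).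
      by apply: lee_wpmul2l; [rewrite lee_fin sqr_ge0|exact: variance_count_le].
    rewrite -EFinM lee_fin expr2 -mulrA mulVf ?gt_eqF// mulr1 div1r.
    by rewrite /n natrX.
apply: filterS => w h.
under eq_fun do rewrite SmE.
apply: cvg0_sqrn_interpolation.
- by rewrite /S /m !big_ord0 subrr.
- move=> n; rewrite /S /m !big_ord_recr/=.
  rewrite (_ : _ - _ = \1_(E n) w - p n); last by ring.
  have /andP[p0 p1] := p01 n.
  by rewrite indicE; case: (_ \in _) => /=; rewrite ler_norml; lra.
- apply/cvgrPdist_le => e e0.
  have := h => /cvgrPdist_le/(_ (e ^+ 2)); rewrite exprn_gt0// => /(_ isT).
  apply: filterS => k; rewrite !sub0r !normrN normrX => hk.
  by rewrite -(@ler_pXn2r _ 2)// nnegrE ltW.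
Qed.

End Events.

End LawOfLargeNumbers.

(** * Grid cells and Borel sets of the simplex *)

Section Grid.
Context (R : realType) (m : nat).
Local Notation n := m.+2.
Local Notation V := 'rV[R]_n.

Lemma nbhs_rVP (x : V) (U : set V) : nbhs x U <->
  exists2 e : R, 0 < e & forall y : V, (forall i, `|x 0 i - y 0 i| < e) -> U y.
Proof.
split=> [/nbhs_ballP[e /= e0 eU]|[e e0 eU]].
  exists e => // y xy; apply: eU; split=> // i j; rewrite /ball/= ord1.
  exact: xy.
apply/nbhs_ballP; exists e => //= y [_ xy]; apply: eU => i.
exact: (xy 0 i).
Qed.

Lemma cvg_rVP {T : Type} (F : set_system T) {FF : Filter F} (f : T -> V) (l : V) :
  (forall i, f x 0 i @[x --> F] --> l 0 i) -> f x @[x --> F] --> l.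
Proof.
move=> fl; apply/cvg_ballP => e e0.
have : \forall x \near F, forall i, `|l 0 i - f x 0 i| < e.
  apply: filter_forall => i; have /cvgrPdist_lt := fl i; exact.
apply: filterS => x h; split => // i j; rewrite ord1; exact: h.
Qed.

(* The cell of x in the cubic grid of mesh 1 / l.+1, for points of [0, 1]^n. *)
Definition grid (l : nat) (x : V) : {ffun 'I_n * 'I_l.+2 -> bool} :=
  [ffun ik : 'I_n * 'I_l.+2 => (ik.2 : nat)%:R / l.+1%:R <= x 0 ik.1].

Lemma grid_close l (x y : V) i : 0 <= x 0 i <= 1 -> 0 <= y 0 i <= 1 ->
  grid l x = grid l y -> `|x 0 i - y 0 i| <= l.+1%:R^-1.
Proof.
have l0 : 0 < l.+1%:R :> R by rewrite ltr0n.
suff key (u v : V) : 0 <= u 0 i <= 1 -> 0 <= v 0 i <= 1 -> grid l u = grid l v ->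
    v 0 i - u 0 i <= l.+1%:R^-1.
  move=> x01 y01 xy; rewrite ler_norml lerNl opprB (key x y)//= (key y x)//.
move=> /andP[u0 u1] /andP[v0 v1] uv; rewrite leNgt; apply/negP => h.
(* [k / (l + 1)] is the last grid threshold below [v 0 i]. If the gap exceeded the mesh, this
   threshold would separate the two points. *)
pose k := Num.truncn (v 0 i * l.+1%:R).
have vl0 : 0 <= v 0 i * l.+1%:R by rewrite mulr_ge0// ltW.
have [k1 k2] : k%:R <= v 0 i * l.+1%:R /\ v 0 i * l.+1%:R < k.+1%:R.
  by have /andP[] := truncn_itv vl0.
have kl : (k < l.+2)%N.
  rewrite -(ltr_nat R) (le_lt_trans k1)// (@le_lt_trans _ _ l.+1%:R)//.
    by rewrite ler_piMl// ltW.
  by rewrite ltr_nat.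
have := congr1 (fun f : {ffun _} => f (i, Ordinal kl)) uv.
rewrite !ffunE/= !ler_pdivrMr// k1 => ku.
move: h; rewrite -(ltr_pM2r l0) mulVf ?gt_eqF// => h.
move: k2; rewrite -natr1 => k2; nra.
Qed.

Context d (T : measurableType d).

Lemma measurable_grid l (D : set T) (f : T -> V) c : measurable D ->
  (forall i, measurable_fun D (fun t => f t 0 i)) ->
  measurable (D `&` [set t | grid l (f t) = c]).
Proof.
move=> mD mf.
have -> : D `&` [set t | grid l (f t) = c] =
    \bigcap_(ik in [set: 'I_n * 'I_l.+2])
      (D `&` [set t | ((ik.2 : nat)%:R / l.+1%:R <= f t 0 ik.1) = c ik]).
  apply/seteqP; split=> [t [Dt /= <-] ik _|t h]; first by split=> //=; rewrite ffunE.
  split; first by have [] := h (ord0, ord0) I.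
  by apply/ffunP => ik; rewrite ffunE; have [] := h ik I.
apply: fin_bigcap_measurable => // ik _.
have := mf ik.1.
have mS : measurable (D `&` [set t | (ik.2 : nat)%:R / l.+1%:R <= f t 0 ik.1]).
  rewrite (_ : [set t | _] = (fun t => f t 0 ik.1) @^-1` `[(ik.2 : nat)%:R / l.+1%:R, +oo[).
    exact: mf.
  by apply/seteqP; split=> t /=; rewrite in_itv/= andbT.
case: (c ik) => _ //.
have -> : D `&` [set t | ((ik.2 : nat)%:R / l.+1%:R <= f t 0 ik.1) = false] =
    D `\` (D `&` [set t | (ik.2 : nat)%:R / l.+1%:R <= f t 0 ik.1]).
  apply/seteqP; split=> t [Dt] => [h|h]; split=> //.
    by move=> [_ /=]; rewrite h.
  by apply/negP => h'; apply: h.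
exact: measurableD.
Qed.

End Grid.

Section BorelSimplex.
Context (R : realType) (m : nat).
Local Notation n := m.+2.
Local Notation V := 'rV[R]_n.

Lemma simplex_itv (p : V) i : simplex p -> 0 <= p 0 i <= 1.
Proof. by move=> [/(_ i)/andP[p0 p1] _]; rewrite !ltW. Qed.

Lemma grid_simplex_close (e : R) : 0 < e -> exists l, forall x y : V,
  simplex x -> simplex y -> grid l x = grid l y ->
  forall i, `|x 0 i - y 0 i| < e.
Proof.
move=> e0; have [l _ le] := near_infty_natSinv_lt (PosNum e0).
exists l => x y sx sy xy i.
apply: (le_lt_trans (grid_close (simplex_itv i sx) (simplex_itv i sy) xy)).
exact: (le l (leqnn l)).
Qed.

Lemma measurable_coord (i : 'I_n) :
  measurable_fun [set: borel V] (fun x : borel V => (x : V) 0 i).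
Proof.
apply: (measurability (@RGenOpens.G R)); first exact: RGenOpens.measurableE.
move=> _ [_ [a [b ->] <-]]; rewrite setTI; apply: sub_sigma_algebra.
apply: open_comp; last exact: interval_open.
by move=> x _; exact: coord_continuous.
Qed.

Lemma measurable_simplex : measurable (simplex : set (borel V)).
Proof.
have -> : simplex = (\bigcap_(i in [set: 'I_n])
      ((fun x : borel V => (x : V) 0 i) @^-1` `]0, 1[)) `&`
    (fun x : borel V => \sum_i (x : V) 0 i) @^-1` [set 1] :> set (borel V).
  apply/seteqP; split=> [p [p01 p1]|p [p01 p1]]; split=> //.
    by move=> i _ /=; rewrite in_itv/=.
  by move=> i; have := p01 i I; rewrite /= in_itv.
apply: measurableI.
  apply: fin_bigcap_measurable => // i _; rewrite -[X in measurable X]setTI.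
  exact: measurable_coord.
rewrite -[X in measurable X]setTI.
apply: (@measurable_sum _ _ _ _ _ _ (fun i (x : borel V) => (x : V) 0 i)) => //.
by move=> i; exact: measurable_coord.
Qed.

(** Inside the simplex an open set is a countable union of grid cells, and cells are described by
    coordinates. This bridges the sigma-algebra generated by open sets and coordinatewise
    measurability. *)
Lemma measurable_into_simplex d (T : measurableType d) (D : set T)
    (f : T -> borel V) :
  (forall t, D t -> simplex (f t : V)) ->
  (forall i, measurable_fun D (fun t => (f t : V) 0 i)) -> measurable_fun D f.
Proof.
move=> fD mf mD.
apply: (@measurability _ _ _ (borel V) D f (@open V)) => //.
move=> _ [U oU <-].
pose P (l : nat) c := forall x : V, simplex x -> grid l x = c -> U x.
have -> : D `&` f @^-1` U =
    \bigcup_l \bigcup_(c in [set c | P l c]) (D `&` [set t | grid l (f t : V) = c]).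
  apply/seteqP; split=> [t [Dt Uft]|t [l _ [c Plc [Dt /= fc]]]]; last first.
    by split=> //; exact: Plc (fD _ Dt) fc.
  have /nbhs_rVP[e e0 eU] : nbhs (f t : V) U by exact: open_nbhs_nbhs.
  have [l hl] := grid_simplex_close e0.
  exists l => //; exists (grid l (f t : V)) => // x sx xt.
  by apply: eU => i; apply: hl => //; exact: fD.
apply: bigcup_measurable => l _; apply: fin_bigcup_measurable => // c _.
exact: measurable_grid.
Qed.

(* Relatively open subsets of the square of the simplex are product
   measurable: they are countable unions of products of grid cells. *)
Lemma measurable_open_simplex2 (A : set (V * V)) :
  A `<=` simplex `*` simplex ->
  (forall z, A z -> exists2 e : R, 0 < e & forall z' : V * V,
     simplex z'.1 -> simplex z'.2 -> (forall i, `|z.1 0 i - z'.1 0 i| < e) ->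
     (forall i, `|z.2 0 i - z'.2 0 i| < e) -> A z') ->
  measurable (A : set (borel V * borel V)).
Proof.
move=> As oA.
pose P (l : nat) (c : _ * _) := forall x y : V, simplex x -> simplex y ->
   grid l x = c.1 -> grid l y = c.2 -> A (x, y).
pose D := ((simplex : set (borel V)) `*` (simplex : set (borel V))).
have -> : A = \bigcup_l \bigcup_(c in [set c | P l c])
   ((D `&` [set t | grid l (t.1 : V) = c.1]) `&`
    (D `&` [set t | grid l (t.2 : V) = c.2])).
  apply/seteqP; split=> [z Az|z [l _ [c Plc [[[z1 z2] /= e1] [_ /= e2]]]]]; last first.
    by have := Plc _ _ z1 z2 e1 e2; rewrite -surjective_pairing.
  have [z1 z2] := As _ Az; have [e e0 eA] := oA _ Az.
  have [l hl] := grid_simplex_close e0.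
  exists l => //; exists (grid l z.1, grid l z.2) => // x y sx sy xz yz.
  by apply: eA => // i; apply: hl.
have mD : measurable D.
  by apply: measurableX; exact: measurable_simplex.
apply: bigcup_measurable => l _; apply: fin_bigcup_measurable => // c _.
apply: measurableI; apply: measurable_grid => // i; apply: measurable_funTS.
  exact: (measurableT_comp (measurable_coord i) measurable_fst).
exact: (measurableT_comp (measurable_coord i) measurable_snd).
Qed.

End BorelSimplex.

(** * Bridge paths *)

Section Paths.
Context (R : realType) (m : nat).
Local Notation n := m.+2.
Local Notation V := 'rV[R]_n.

Lemma cvg_sumr {T : Type} (F : set_system T) {FF : Filter F} (I : finType)
    (f : I -> T -> R) (l : I -> R) :
  (forall i, f i x @[x --> F] --> l i) ->
  \sum_i f i x @[x --> F] --> \sum_i l i.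
Proof.
move=> fl; apply: (@cvg_big _ _ _ _ _ _ _ _ _ _ _ FF) => //.
exact: add_continuous.
Qed.

Lemma rV_norm_le (x : V) (e : R) : 0 <= e -> (forall i, `|x 0 i| <= e) -> `|x| <= e.
Proof.
move=> e0 h; rewrite [leLHS]/Num.Def.normr/= mx_normrE.
by apply: bigmax_le => //= -[i j] _ /=; rewrite ord1.
Qed.

(** The identity time change is enough: the limit paths are continuous, and the approximations below
    are uniform in time. *)
Lemma skorokhod_dist_le (x y : skorokhod R m) (e : R) : 0 <= e ->
  (forall t, t \in `[0, 1] -> forall i, `|x t 0 i - y t 0 i| <= e) ->
  skorokhod_dist x y <= e.
Proof.
move=> e0 h; apply: ge_inf; first by exists 0 => z [].
split=> //; exists id => [|t t01].
  by split=> //; apply: continuous_subspaceT => u; exact: cvg_id.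
rewrite subrr normr0; split=> //; apply: rV_norm_le => // i.
by have := h t t01 i; rewrite !mxE.
Qed.

Lemma continuous_skorokhod (F : skorokhod R m -> R) (x : skorokhod R m) (eta : R) :
  continuous F -> 0 < eta -> exists2 e : R, 0 < e &
  forall y : skorokhod R m,
    (forall t, t \in `[0, 1] -> forall i, `|x t 0 i - y t 0 i| <= e) ->
    `|F x - F y| <= eta.
Proof.
move=> cF eta0; have /cvgrPdist_le/(_ _ eta0) h := cF x.
have : nbhs x [set y | `|F x - F y| <= eta] by exact: h.
rewrite nbhsE => -[U [oU Ux] UF].
have [e e0 eU] := (oU : skorokhod_open U) x Ux.
exists (e / 2) => [|y hy]; first by rewrite divr_gt0.
apply: UF; apply: eU; apply: (@le_lt_trans _ _ (e / 2)).
  by apply: skorokhod_dist_le => //; rewrite ltW// divr_gt0.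
by rewrite gtr_pMr// invf_lt1// ltr1n.
Qed.

Lemma ratio_simplex (a : 'I_n -> R) : (forall i, 0 < a i) ->
  simplex (\row_i (a i / \sum_k a k)).
Proof.
move=> a0.
have S0 : 0 < \sum_k a k.
  by rewrite (bigD1 ord0)//= ltr_pwDl// sumr_ge0// => k _; exact: ltW.
split=> [i|]; last first.
  by under eq_bigr do rewrite mxE; rewrite -mulr_suml mulfV// gt_eqF.
rewrite mxE divr_gt0//= ltr_pdivrMr// mul1r.
have [j ij] : exists j : 'I_n, j != i.
  have [->|] := eqVneq i ord0; first by exists ord_max.
  by exists ord0; rewrite eq_sym.
rewrite (bigD1 i)//= ltrDl (bigD1 j)//= ltr_pwDl// sumr_ge0// => k _; exact: ltW.
Qed.

(** With A and B the two sums, a/A - b/B = (a - b + (a/A)(B - A)) / B, and a/A is at most 1. So a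
    lower bound is asked of the sum of the reference values [b] only, and the factor n + 1 counts
    one error in the numerator and n in the denominator. *)
Lemma ratio_close (a b : 'I_n -> R) (delta beta : R) i :
  (forall i, 0 <= a i) -> 0 < \sum_k a k -> 0 < beta -> beta <= \sum_k b k ->
  (forall i, `|a i - b i| <= delta) ->
  `|a i / \sum_k a k - b i / \sum_k b k| <= n.+1%:R * delta / beta.
Proof.
move=> a0 A0 beta0 bB ab.
set A := \sum_k a k in A0 *; set B := \sum_k b k in bB *.
have B0 : 0 < B by rewrite (lt_le_trans beta0).
have aA : a i <= A by rewrite /A (bigD1 i)//= lerDl sumr_ge0.
have AB : `|B - A| <= n%:R * delta.
  rewrite /A /B -sumrB (le_trans (ler_norm_sum _ _ _))//.
  rewrite -[n in leRHS]card_ord mulr_natl -sumr_const ler_sum// => k _.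
  by rewrite distrC.
have d0 : 0 <= delta by rewrite (le_trans _ (ab i)).
have -> : a i / A - b i / B = (a i - b i + a i / A * (B - A)) / B.
  by field; rewrite !gt_eqF.
rewrite normrM normfV (ger0_norm (ltW B0)).
apply: (@le_trans _ _ (n.+1%:R * delta / B)); last first.
  by apply: ler_wpM2l; rewrite ?mulr_ge0// lef_pV2.
rewrite ler_wpM2r ?invr_ge0 ?(ltW B0)// (le_trans (ler_normD _ _))//.
rewrite -natr1 mulrDl mul1r addrC lerD// normrM.
rewrite (le_trans _ AB)// ler_piMl// ger0_norm ?divr_ge0// ?(ltW A0)//.
by rewrite ler_pdivrMr// mul1r.
Qed.

(** The unnormalized contribution of the subordinators at time 1. By [driftE] it is proportional to
    q, which is why the bridge ends at q. *)
Definition drift (p q : V) (i : 'I_n) : R := smul q (sinv p) 0 i * p 0 i.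

Lemma smul_sinv_simplex (p q : V) : simplex p -> simplex q ->
  simplex (smul q (sinv p)).
Proof.
move=> sp sq; apply: ratio_simplex => i.
have q0 : 0 < q 0 i by have [/(_ i)/andP[]] := sq.
rewrite mulr_gt0//.
suff [/(_ i)/andP[]] : simplex (sinv p) by [].
by apply: ratio_simplex => j; rewrite invr_gt0; have [/(_ j)/andP[]] := sp.
Qed.

Lemma drift_gt0 (p q : V) i : simplex p -> simplex q -> 0 < drift p q i.
Proof.
move=> sp sq; rewrite mulr_gt0//; last by have [/(_ i)/andP[]] := sp.
by have [/(_ i)/andP[]] := smul_sinv_simplex sp sq.
Qed.

Lemma drift_le1 (p q : V) i : simplex p -> simplex q -> drift p q i <= 1.
Proof.
move=> sp sq; have [/(_ i)/andP[c0 c1] _] := smul_sinv_simplex sp sq.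
have [/(_ i)/andP[p0 p1] _] := sp.
by rewrite -[leRHS]mulr1 ler_pM// ltW.
Qed.

Lemma driftE (p q : V) i : simplex p -> simplex q ->
  drift p q i = q 0 i / \sum_k q 0 k / p 0 k.
Proof.
move=> sp sq.
have p0 j : 0 < p 0 j by have [/(_ j)/andP[]] := sp.
have q0 j : 0 < q 0 j by have [/(_ j)/andP[]] := sq.
have S0 (f : 'I_n -> R) : (forall j, 0 < f j) -> 0 < \sum_k f k.
  move=> f0; rewrite (bigD1 ord0)//= ltr_pwDl// sumr_ge0// => k _; exact: ltW.
rewrite /drift /smul mxE.
under [in X in X * _]eq_bigr do rewrite mxE mulrA.
rewrite -mulr_suml mxE.
have h1 : 0 < \sum_k q 0 k / p 0 k by apply: S0 => k; rewrite divr_gt0.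
have h2 : 0 < \sum_j (p 0 j)^-1 by apply: S0 => k; rewrite invr_gt0.
by field; rewrite !gt_eqF.
Qed.

Lemma drift_near (p0 q0 : V) (e : R) : simplex p0 -> simplex q0 -> 0 < e ->
  exists2 r : R, 0 < r & forall p q : V, simplex p -> simplex q ->
    (forall i, `|p0 0 i - p 0 i| < r) -> (forall i, `|q0 0 i - q 0 i| < r) ->
    forall i, `|drift p0 q0 i - drift p q i| <= e.
Proof.
move=> sp sq e0.
have p00 j : 0 < p0 0 j by have [/(_ j)/andP[]] := sp.
have q00 j : 0 < q0 0 j by have [/(_ j)/andP[]] := sq.
pose w (z : V * V) i := z.2 0 i / \sum_k z.2 0 k / z.1 0 k.
have cw i : w z i @[z --> (p0, q0)] --> w (p0, q0) i.
  have c1 j : (z : V * V).1 0 j @[z --> (p0, q0)] --> p0 0 j.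
    apply: (@cvg_comp _ _ _ _ (fun x : V => x 0 j) _ (nbhs p0)).
      exact: cvg_fst.
    exact: coord_continuous.
  have c2 j : (z : V * V).2 0 j @[z --> (p0, q0)] --> q0 0 j.
    apply: (@cvg_comp _ _ _ _ (fun x : V => x 0 j) _ (nbhs q0)).
      exact: cvg_snd.
    exact: coord_continuous.
  apply: cvgM => //; apply: cvgV.
    rewrite gt_eqF// (bigD1 ord0)//= ltr_pwDl ?divr_gt0// sumr_ge0// => k _.
    by rewrite divr_ge0// ltW.
  apply: cvg_sumr => j; apply: cvgM => //; apply: cvgV => //.
  by rewrite gt_eqF.
have : \forall z \near (p0, q0), forall i, `|w (p0, q0) i - w z i| <= e.
  apply: (@filter_forall _ _ (fun i z => `|w (p0, q0) i - w z i| <= e) (nbhs (p0, q0))).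
  by move=> i; have /cvgrPdist_le := cw i; exact.
move=> [[A B]] /= [/nbhs_rVP[e1 e10 eA] /nbhs_rVP[e2 e20 eB]] AB.
exists (Num.min e1 e2); first by rewrite lt_min e10.
move=> p q sp' sq' hp hq i; rewrite !driftE//.
apply: (AB (p, q)); split=> /=.
  by apply: eA => j; rewrite (lt_le_trans (hp j))// ge_min lexx.
by apply: eB => j; rewrite (lt_le_trans (hq j))// ge_min lexx orbT.
Qed.

(** A common form for both kinds of paths: the driving values [h i = t] give the displacement path,
    the gamma ratios give the gamma bridge. Closeness of paths is thereby reduced to closeness of
    [p], [q] and [h]. *)
Definition bridge (t : R) (p q : V) (h : 'I_n -> R) : V :=
  \row_i (((1 - t) * p 0 i / n%:R + h i * drift p q i) /
          \sum_k ((1 - t) * p 0 k / n%:R + h k * drift p q k)).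

Lemma gamma_bridgeE (lambda : R) (g : 'I_n -> R -> R) (p q : V) (t : R) :
  gamma_bridge lambda g p q t =
  bridge t p q (fun i => g i (t * lambda) / g i lambda).
Proof.
have E i : (1 - t) * p 0 i / n%:R + g i (t * lambda) / g i lambda *
     smul q (sinv p) 0 i * p 0 i =
    (1 - t) * p 0 i / n%:R + g i (t * lambda) / g i lambda * drift p q i.
  by rewrite /drift; ring.
by apply/rowP => i; rewrite [LHS]mxE [RHS]mxE E; under eq_bigr do rewrite E.
Qed.

Lemma displacement_bridgeE (p q : V) (t : R) :
  smul p ((1 - t) *: bary + t *: smul q (sinv p)) = bridge t p q (fun=> t).
Proof.
have E i : p 0 i * ((1 - t) *: bary + t *: smul q (sinv p)) 0 i =
    (1 - t) * p 0 i / n%:R + t * drift p q i.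
  by rewrite /drift !mxE; ring.
by apply/rowP => i; rewrite [LHS]mxE [RHS]mxE E; under eq_bigr do rewrite E.
Qed.

(** For t < 1 the first summand is positive. At t = 1 it vanishes, and it is [t - r <= h i] with
    [r < 1] that keeps the second one positive. *)
Lemma bridge_num_gt0 (t : R) (p q : V) (h : 'I_n -> R) (r : R) i :
  simplex p -> simplex q -> 0 <= t <= 1 -> r < 1 -> 0 <= h i -> t - r <= h i ->
  0 < (1 - t) * p 0 i / n%:R + h i * drift p q i.
Proof.
move=> sp sq /andP[t0 t1] r1 h0 tr.
have w0 := drift_gt0 i sp sq.
have p0 : 0 < p 0 i by have [/(_ i)/andP[]] := sp.
have [t1'|t1'] := ltP t 1.
  apply: ltr_pwDl; first by rewrite divr_gt0// mulr_gt0// subr_gt0.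
  by rewrite mulr_ge0// ltW.
rewrite ltr_wpDl// ?divr_ge0 ?mulr_ge0 ?subr_ge0 ?(ltW p0)// mulr_gt0//.
by rewrite (lt_le_trans _ tr)//; lra.
Qed.

Lemma bridge_close (p0 q0 : V) (e : R) : simplex p0 -> simplex q0 -> 0 < e ->
  exists2 r : R, 0 < r < 1 & forall p q : V, simplex p -> simplex q ->
    (forall i, `|p0 0 i - p 0 i| < r) -> (forall i, `|q0 0 i - q 0 i| < r) ->
    forall t (h : 'I_n -> R), 0 <= t <= 1 ->
    (forall i, 0 <= h i) -> (forall i, `|h i - t| <= r) ->
    forall i, `|bridge t p0 q0 (fun=> t) 0 i - bridge t p q h 0 i| <= e.
Proof.
move=> sp sq e0.
pose W := \sum_k drift p0 q0 k.
have W0 : 0 < W.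
  by rewrite /W (bigD1 ord0)//= ltr_pwDl ?drift_gt0// sumr_ge0// => k _; exact/ltW/drift_gt0.
(* The denominator of the reference path at time t is (1 - t) / n + t W, a convex combination, hence
   at least [beta] for all t. The value of [delta] makes the bound of [ratio_close] equal to [e]. *)
pose beta := Num.min n%:R^-1 W.
have beta0 : 0 < beta by rewrite lt_min invr_gt0 ltr0n.
pose delta := e * beta / n.+1%:R.
have delta0 : 0 < delta by rewrite divr_gt0// mulr_gt0.
have d40 : 0 < delta / 4 by rewrite divr_gt0.
have [r1 r10 hr1] := drift_near sp sq d40.
pose r := Num.min r1 (Num.min (delta / 4) 2^-1).
have r0 : 0 < r by rewrite !lt_min r10 d40/= invr_gt0.
have rr1 : r <= r1 by rewrite ge_min lexx.
have rd : r <= delta / 4 by rewrite !ge_min lexx orbT.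
have r12 : r <= 2^-1 by rewrite !ge_min lexx !orbT.
exists r; first by rewrite r0 (le_lt_trans r12)// invf_lt1// ltr1n.
move=> p q sp' sq' hp hq t h t01 h0 ht i.
have [t0 t1] := andP t01.
have dri k : `|drift p0 q0 k - drift p q k| <= delta / 4.
  by apply: hr1 => // j; rewrite (lt_le_trans _ rr1).
have num0 k : 0 < (1 - t) * p 0 k / n%:R + h k * drift p q k.
  apply: (@bridge_num_gt0 _ _ _ _ r) => //; first by rewrite (le_lt_trans r12)// invf_lt1// ltr1n.
  by have := ht k; rewrite ler_norml => /andP[+ _]; lra.
rewrite distrC !mxE.
apply: (@le_trans _ _ (n.+1%:R * delta / beta)); last first.
  by rewrite /delta le_eqVlt; apply/orP; left; apply/eqP; field; rewrite !gt_eqF.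
apply: ratio_close => //.
- by move=> k; exact: ltW.
- by rewrite (bigD1 ord0)//= ltr_pwDl// sumr_ge0// => k _; exact: ltW.
- rewrite big_split/= -mulr_sumr -/W -mulr_suml -mulr_sumr.
  have [_ ->] := sp; rewrite mulr1.
  have b1 : beta <= n%:R^-1 by rewrite ge_min lexx.
  have b2 : beta <= W by rewrite ge_min lexx orbT.
  have -> : beta = (1 - t) * beta + t * beta by ring.
  by rewrite lerD// ler_wpM2l// subr_ge0.
- move=> k.
  (* The errors due to the starting point, to the drift (where [|h k| <= 2]) and to the driving
     value are bounded by delta/4, delta/2 and delta/4. *)
  have -> : (1 - t) * p 0 k / n%:R + h k * drift p q k -
      ((1 - t) * p0 0 k / n%:R + t * drift p0 q0 k) =
     (1 - t) / n%:R * (p 0 k - p0 0 k) + h k * (drift p q k - drift p0 q0 k) +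
     (h k - t) * drift p0 q0 k by field; rewrite gt_eqF// ltr0n.
  have h2 : `|h k| <= 2.
    rewrite -[h k](subrK t) (le_trans (ler_normD _ _))// (ger0_norm t0).
    by have := ht k; lra.
  have w0 := drift_gt0 k sp sq; have w1 := drift_le1 k sp sq.
  have hn : 0 <= (1 - t) / n%:R <= 1.
    rewrite divr_ge0 ?subr_ge0//= ler_pdivrMr ?ltr0n// mul1r.
    by rewrite (@le_trans _ _ 1)//; [lra|rewrite ler1n].
  have A1 : `|(1 - t) / n%:R * (p 0 k - p0 0 k)| <= delta / 4.
    rewrite normrM distrC (ger0_norm (andP hn).1) -[leRHS]mul1r ler_pM//; first by case/andP : hn.
      by case/andP : hn.
    by rewrite (le_trans (ltW (hp k))).
  have A2 : `|h k * (drift p q k - drift p0 q0 k)| <= 2 * (delta / 4).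
    by rewrite normrM distrC ler_pM.
  have A3 : `|(h k - t) * drift p0 q0 k| <= delta / 4.
    rewrite normrM (ger0_norm (ltW w0)) -[leRHS]mulr1 ler_pM// ?(ltW w0)//.
    by rewrite (le_trans (ht k)).
  rewrite (le_trans (ler_normD _ _))// (le_trans (lerD (ler_normD _ _) (lexx _)))//.
  lra.
Qed.

Definition clamp (t : R) : R := Num.max 0 (Num.min 1 t).

Lemma clamp_itv t : 0 <= clamp t <= 1.
Proof. by rewrite /clamp le_max lexx/= ge_max ler01/= ge_min lexx. Qed.

Lemma clamp_id t : 0 <= t <= 1 -> clamp t = t.
Proof. by rewrite /clamp; case: (ltP 1 t) => ?; case: (ltP 0) => //= ?; lra. Qed.

Lemma clamp_le0 t : t <= 0 -> clamp t = 0.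
Proof. by rewrite /clamp; case: (ltP 1 t) => ?; case: (ltP 0) => //= ?; lra. Qed.

Lemma clamp_ge1 t : 1 <= t -> clamp t = 1.
Proof. by rewrite /clamp; case: (ltP 1 t) => ?; case: (ltP 0) => //= ?; lra. Qed.

Lemma clamp_continuous : continuous clamp.
Proof.
move=> t; apply: continuous_max; first exact: cvg_cst.
by apply: continuous_min; [exact: cvg_cst|exact: cvg_id].
Qed.

Lemma clamp_homo : {homo clamp : s t / s <= t}.
Proof.
move=> s t st; rewrite /clamp.
by case: (ltP 1 t) => ?; case: (ltP 1 s) => ?; do ?case: (ltP 0) => //= ?; lra.
Qed.

(** Monotonicity of the driving functions gives left limits. The bounds by [r < 1] pass to these
    limits and keep the left limit of the bridge in the open simplex, as [cadlag] demands. *)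
Lemma cadlag_bridge (p q : V) (H : 'I_n -> R -> R) (r : R) :
  simplex p -> simplex q -> r < 1 ->
  (forall i, {homo H i : s t / s <= t}) -> (forall i t, 0 <= H i t) ->
  (forall i t, `|H i t - clamp t| <= r) ->
  (forall i t, (t <= 0 -> H i t = H i 0) /\ (1 <= t -> H i t = H i 1)) ->
  (forall i t, H i s @[s --> t^'+] --> H i t) ->
  cadlag (fun t => bridge (clamp t) p q (H ^~ t)).
Proof.
move=> sp sq r1 ndH H0 Hr Hc Hright.
have tr i t : clamp t - r <= H i t.
  by have := Hr i t; rewrite ler_norml => /andP[+ _]; lra.
have cvg_bridge (F : set_system R) (FF : Filter F) t h :
    clamp s @[s --> F] --> clamp t -> (forall i, H i s @[s --> F] --> h i) ->
    (forall i, 0 <= h i) -> (forall i, clamp t - r <= h i) ->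
    bridge (clamp s) p q (H ^~ s) @[s --> F] --> bridge (clamp t) p q h.
  move=> cl Hl h0 hr; apply: cvg_rVP => i.
  have N j : (1 - clamp s) * p 0 j / n%:R + H j s * drift p q j @[s --> F] -->
      (1 - clamp t) * p 0 j / n%:R + h j * drift p q j.
    apply: cvgD; last by apply: cvgM => //; exact: cvg_cst.
    apply: cvgM; last exact: cvg_cst.
    apply: cvgM; last exact: cvg_cst.
    by apply: cvgB => //; exact: cvg_cst.
  under eq_fun do rewrite mxE.
  rewrite mxE; apply: cvgM => //; apply: cvgV; last exact: cvg_sumr.
  have num0 k : 0 < (1 - clamp t) * p 0 k / n%:R + h k * drift p q k.
    by apply: (@bridge_num_gt0 _ _ _ _ r) => //; exact: clamp_itv.
  by rewrite gt_eqF// (bigD1 ord0)//= ltr_pwDl// sumr_ge0// => k _; exact: ltW.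
split.
- move=> t; apply: ratio_simplex => i.
  by apply: (@bridge_num_gt0 _ _ _ (H ^~ t) r) => //; exact: clamp_itv.
- move=> t; split=> ht.
    rewrite !clamp_le0//; congr (bridge 0 p q _).
    by apply/funext => i; have [->] := Hc i t.
  rewrite !clamp_ge1//; congr (bridge 1 p q _).
  by apply/funext => i; have [_ ->] := Hc i t.
- move=> t; apply: cvg_bridge => //.
  by apply: cvg_at_right_filter; exact: clamp_continuous.
- move=> t.
  have Hcv i : cvg (H i s @[s --> t^'-]).
    apply: nondecreasing_at_left_is_cvgr.
      by apply: nearW => x u v _ _; exact: ndH.
    apply: nearW => x; exists (H i t) => _ [y + <-].
    by rewrite /= in_itv/= => /andP[_ yt]; apply: ndH; exact: ltW.
  pose h i := lim (H i s @[s --> t^'-]).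
  have h0 i : 0 <= h i by apply: limr_ge => //; exact: nearW.
  have cl : clamp s @[s --> t^'-] --> clamp t.
    by apply: cvg_at_left_filter; exact: clamp_continuous.
  have hr i : clamp t - r <= h i.
    have c1 : clamp s - r @[s --> t^'-] --> clamp t - r.
      by apply: cvgB => //; exact: cvg_cst.
    rewrite -(cvg_lim _ c1)//; apply: ler_lim => //.
      by apply/cvg_ex; exists (clamp t - r).
    exact: nearW.
  exists (bridge (clamp t) p q h).
    apply: ratio_simplex => i.
    by apply: (@bridge_num_gt0 _ _ _ _ r) => //; exact: clamp_itv.
  exact: cvg_bridge.
Qed.

Lemma cadlag_displacement (p q : V) : simplex p -> simplex q ->
  cadlag (fun t => bridge (clamp t) p q (fun=> clamp t)).
Proof.
move=> sp sq; apply: (@cadlag_bridge p q (fun=> clamp) 0) => //.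
- by move=> _; exact: clamp_homo.
- by move=> _ t; case/andP : (clamp_itv t).
- by move=> _ t; rewrite subrr normr0.
- move=> _ t; split=> ht; first by rewrite !clamp_le0.
  by rewrite !clamp_ge1.
- by move=> _ t; apply: cvg_at_right_filter; exact: clamp_continuous.
Qed.

Lemma path_ofE (f : R -> V) t : cadlag (fun t => f (clamp t)) -> 0 <= t <= 1 ->
  path_of f t = f t.
Proof.
move=> cf t01; rewrite /path_of; case: pselect => // h /=.
by rewrite -/(clamp t) clamp_id.
Qed.

Lemma displacementE (z : V * V) (t : R) :
  simplex z.1 -> simplex z.2 -> 0 <= t <= 1 ->
  displacement z t = bridge t z.1 z.2 (fun=> t).
Proof.
move=> s1 s2 t01; rewrite /displacement path_ofE//; first exact: displacement_bridgeE.
by under eq_fun do rewrite displacement_bridgeE; exact: cadlag_displacement.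
Qed.

(* The functional F is nearly constant along all bridges whose endpoints are
   close to those of z and whose driving increments are close to linear. *)
Lemma continuous_functional_bridge (F : skorokhod R m -> R) (z : V * V) (eta : R) :
  continuous F -> 0 < eta -> simplex z.1 -> simplex z.2 ->
  exists2 r : R, 0 < r < 1 & forall p q : V, simplex p -> simplex q ->
    (forall i, `|z.1 0 i - p 0 i| < r) -> (forall i, `|z.2 0 i - q 0 i| < r) ->
    `|F (displacement z) - F (displacement (p, q))| <= eta /\
    forall (lambda : R) (g : 'I_n -> R -> R),
      cadlag (fun t => gamma_bridge lambda g p q (clamp t)) ->
      (forall i t, 0 <= t <= 1 -> 0 <= g i (t * lambda) / g i lambda) ->
      (forall i t, 0 <= t <= 1 -> `|g i (t * lambda) / g i lambda - t| <= r) ->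
      `|F (displacement z) - F (path_of (gamma_bridge lambda g p q))| <= eta.
Proof.
move=> cF eta0 s1 s2.
have [e e0 he] := continuous_skorokhod (displacement z) cF eta0.
have [r r01 hr] := bridge_close s1 s2 e0.
exists r => // p q sp sq hp hq; split=> [|lambda g cg g0 gr].
  apply: he => t; rewrite in_itv/= => t01 i; rewrite !displacementE//=.
  apply: hr => // j; first by case/andP : t01.
  by rewrite subrr normr0; case/andP : r01 => /ltW.
apply: he => t; rewrite in_itv/= => t01 i; rewrite displacementE// path_ofE// gamma_bridgeE.
by apply: hr => // j; [exact: g0|exact: gr].
Qed.

End Paths.

(** * Subordinators *)

Section GammaPaths.
Context (R : realType) (m : nat).
Local Notation n := m.+2.
Local Notation V := 'rV[R]_n.

Definition subordinator_path (g : R -> R) :=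
  [/\ g 0 = 0, forall s t, 0 <= s <= t -> g s <= g t &
      forall t, 0 <= t -> g s @[s --> t^'+] --> g t].

Lemma subordinator_path_ge0 (g : R -> R) t : subordinator_path g -> 0 <= t -> 0 <= g t.
Proof. by move=> [g0 gnd _] t0; rewrite -g0 gnd// lexx. Qed.

(** Consecutive squares have ratio close to 1, so a nondecreasing function that is nearly linear at
    the squares is nearly linear everywhere beyond. The threshold [S0] depends on [e] and [K] but
    not on the path. *)
Lemma subordinator_linear_tail (e : R) (K : nat) : 0 < e <= 1 ->
  exists2 S0 : R, 0 < S0 & forall g : R -> R, subordinator_path g ->
    (forall k, (K <= k)%N -> `|g (k.+1 ^ 2)%N%:R - (k.+1 ^ 2)%N%:R| <= e * (k.+1 ^ 2)%N%:R) ->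
    forall s, S0 <= s -> `|g s - s| <= 3 * e * s.
Proof.
move=> /andP[e0 e1].
have [L _ /(_ L (leqnn L)) Le] := near_infty_natSinv_lt (PosNum (divr_gt0 e0 (ltr0n R 3))).
rewrite /= in Le.
pose M := maxn K L.
exists (M.+1 ^ 2)%N%:R; first by rewrite ltr0n expn_gt0.
move=> g gP gK s sM.
have [_ gnd _] := gP.
have sqr_ex j : (M.+1 ^ 2 <= j)%N -> exists2 k, (M <= k)%N & (k.+1 ^ 2 <= j < k.+2 ^ 2)%N.
  elim: j => [|j ih]; first by rewrite leqn0 expn_eq0.
  rewrite leq_eqVlt => /orP[/eqP <-|].
    by exists M => //; apply/andP; split=> //; rewrite ltn_exp2r.
  rewrite ltnS => /ih [k Mk /andP[k1 k2]].
  have [h|h] := ltnP j.+1 (k.+2 ^ 2)%N; first by exists k => //; rewrite h leqW.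
  exists k.+1; first exact: leqW.
  by rewrite h/= (leq_ltn_trans k2)// ltn_exp2r.
have s0 : 0 <= s by rewrite (le_trans _ sM)// ler0n.
have /andP[ts1 ts2] := truncn_itv s0.
have [|k Mk /andP[k1 k2]] := sqr_ex (Num.truncn s).
  by rewrite -ltnS -(ltr_nat R) (le_lt_trans sM).
have h1 : (k.+1 ^ 2)%N%:R <= s by rewrite (le_trans _ ts1)// ler_nat.
have h2 : s < (k.+2 ^ 2)%N%:R by rewrite (lt_le_trans ts2)// ler_nat.
have Kk : (K <= k)%N by rewrite (leq_trans _ Mk)// leq_maxl.
have Lk : (L <= k)%N by rewrite (leq_trans _ Mk)// leq_maxr.
have g1 := gK k Kk; have g2 := gK k.+1 (leqW Kk).
have m1 : g (k.+1 ^ 2)%N%:R <= g s by rewrite gnd// h1 ler0n.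
have m2 : g s <= g (k.+2 ^ 2)%N%:R by rewrite gnd// s0 ltW.
move: g1 g2 h1 h2 m1 m2; rewrite !natrX -(natr1 k.+1).
set b : R := k.+1%:R.
have b0 : 0 < b by rewrite ltr0n.
have be : 3 <= e * b.
  have : e / 3 * L.+1%:R <= e / 3 * b.
    by apply: ler_wpM2l; [rewrite divr_ge0// ltW|rewrite ler_nat ltnS].
  move: Le; rewrite -div1r ltr_pdivrMr ?ltr0n// => h h'; lra.
have be2 : 3 * b <= e * b ^+ 2 by rewrite expr2 mulrA ler_wpM2r// ltW.
rewrite !ler_norml => /andP[g1 g1'] /andP[g2 g2'] h1 h2 m1 m2.
have b1 : 1 <= b by rewrite ler1n.
(* Consequently g s is at most (1 + e)^2 b^2, and (1 + e)^2 <= 1 + 3 e: this is the origin of the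
   factor 3. *)
have sb : (b + 1) ^+ 2 <= (1 + e) * b ^+ 2 by rewrite sqrrD1; nra.
have eb : 0 <= e * b ^+ 2 by rewrite mulr_ge0 ?sqr_ge0// ltW.
have es : e * b ^+ 2 <= e * s by rewrite ler_wpM2l// ltW.
have es0 : 0 <= e * s by rewrite (le_trans eb).
have ee : e * (e * b ^+ 2) <= e * b ^+ 2 by rewrite ler_piMl.
apply/andP; split; first by lra.
have m3 : (1 + e) * (b + 1) ^+ 2 <= (1 + e) * ((1 + e) * b ^+ 2).
  by rewrite ler_wpM2l// addr_ge0// ltW.
lra.
Qed.

(** The order of the quantifiers matters: the precision [e] depends on [r] alone, [K] is chosen
    afterwards so that few subordinators are bad at this precision, and [L] is common to all paths
    that are good from [K] on. *)
Lemma subordinator_bridge_close (r : R) : 0 < r < 1 ->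
  exists2 e : R, 0 < e & forall K : nat, exists2 L : R, 0 < L &
  forall g : R -> R, subordinator_path g ->
    (forall k, (K <= k)%N -> `|g (k.+1 ^ 2)%N%:R - (k.+1 ^ 2)%N%:R| <= e * (k.+1 ^ 2)%N%:R) ->
    forall lambda, L <= lambda -> 0 < g lambda /\
      forall t, 0 <= t <= 1 -> `|g (t * lambda) / g lambda - t| <= r.
Proof.
(* The total error will be 6 e la + 5 S0. The choices r / 24 and 20 S0 / r make each of the two
   terms at most r la / 4, and g la >= la / 2 absorbs the sum. *)
move=> /andP[r0 r1]; pose e := r / 24.
have e0 : 0 < e by rewrite divr_gt0.
have e01 : 0 < e <= 1 by rewrite e0/= /e; lra.
exists e => // K.
have [S0 S00 hS] := subordinator_linear_tail K e01.
pose L := Num.max S0 (20 * S0 / r).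
exists L; first by rewrite lt_max S00.
move=> g gP gK la; rewrite ge_max => /andP[laS laL].
have {}hS := hS g gP gK.
have [_ gnd _] := gP.
have la0 : 0 < la by rewrite (lt_le_trans S00).
have laL' : 20 * S0 <= r * la by rewrite -ler_pdivrMl// mulrC.
have gla := hS la laS.
have gla2 : la / 2 <= g la.
  by move: gla; rewrite ler_norml => /andP[+ _]; rewrite /e; nra.
have gla0 : 0 < g la by rewrite (lt_le_trans _ gla2)// divr_gt0.
split=> // t /andP[t0 t1].
have tla0 : 0 <= t * la by rewrite mulr_ge0// ltW.
have tla : t * la <= la by rewrite ler_piMl// ltW.
(* Times with t la < S0 escape the tail estimate; there monotonicity bounds both quantities by
   multiples of S0, which is negligible against la. *)
have A : `|g (t * la) - t * la| <= 3 * e * la + 5 * S0.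
  have [h|h] := leP S0 (t * la).
    rewrite (le_trans (hS _ h))// (@le_trans _ _ (3 * e * la))//; last by lra.
    by rewrite ler_wpM2l// mulr_ge0// ltW.
  have gS0 := hS S0 (lexx _).
  have : g (t * la) <= g S0 by rewrite gnd// tla0 ltW.
  have := subordinator_path_ge0 gP tla0.
  move: gS0; rewrite !ler_norml => /andP[_ gS0] ? ?.
  have : 3 * e * S0 <= 3 * S0 by rewrite ler_wpM2r ?(ltW S00)//; lra.
  have : 0 <= 3 * e * la by rewrite !mulr_ge0// ltW.
  by move=> ? ?; apply/andP; split; lra.
have -> : g (t * la) / g la - t =
    ((g (t * la) - t * la) + t * (la - g la)) / g la by field; rewrite gt_eqF.
rewrite normrM normfV (ger0_norm (ltW gla0)) ler_pdivrMr//.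
rewrite (le_trans (ler_normD _ _))//.
have B : `|t * (la - g la)| <= 3 * e * la.
  by rewrite normrM (ger0_norm t0) distrC -[leRHS]mul1r ler_pM.
apply: (@le_trans _ _ (r * (la / 2))); last by rewrite ler_wpM2l// ltW.
rewrite (le_trans (lerD A B))// /e; lra.
Qed.

Lemma cadlag_gamma_bridge (lambda r : R) (g : 'I_n -> R -> R) (p q : V) :
  simplex p -> simplex q -> 0 < lambda -> r < 1 ->
  (forall i, subordinator_path (g i)) -> (forall i, 0 < g i lambda) ->
  (forall i t, 0 <= t <= 1 -> `|g i (t * lambda) / g i lambda - t| <= r) ->
  cadlag (fun t => gamma_bridge lambda g p q (clamp t)).
Proof.
move=> sp sq l0 r1 gP gl0 gr.
under eq_fun do rewrite gamma_bridgeE.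
apply: (@cadlag_bridge _ _ p q (fun i t => g i (clamp t * lambda) / g i lambda) r) => //.
- move=> i s t st; rewrite ler_wpM2r ?invr_ge0 ?(ltW (gl0 i))//.
  have [_ gnd _] := gP i; apply: gnd.
  have /andP[c0 _] := clamp_itv s.
  by rewrite mulr_ge0 ?(ltW l0)//= ler_wpM2r ?(ltW l0)// clamp_homo.
- move=> i t; rewrite divr_ge0 ?(ltW (gl0 i))//.
  apply: (subordinator_path_ge0 (gP i)); rewrite mulr_ge0 ?(ltW l0)//.
  by case/andP : (clamp_itv t).
- by move=> i t; apply: gr; exact: clamp_itv.
- move=> i t; split=> ht; first by rewrite !(clamp_le0 ht) clamp_le0.
  by rewrite !(clamp_ge1 ht) clamp_ge1.
- move=> i t; apply: cvgM; last exact: cvg_cst.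
  have [_ _ gc] := gP i.
  (* For t < 0 and for t >= 1 the clamped clock is constant just to the right of t; in between,
     right-continuity of the subordinator is transported by scaling time with lambda. *)
  have [t0|t0] := ltP t 0.
    rewrite (clamp_le0 (ltW t0)); apply: cvg_near_cst.
    near=> s; have s0 : s < 0 by near: s; exact: nbhs_right_lt.
    by rewrite clamp_le0// ltW.
  have [t1|t1] := leP 1 t.
    rewrite (clamp_ge1 t1); apply: cvg_near_cst.
    near=> s; have ts : t < s by near: s; exact: nbhs_right_gt.
    by rewrite clamp_ge1// (le_trans t1)// ltW.
  rewrite clamp_id ?t0 ?(ltW t1)//.
  apply/cvgrPdist_le => e e0.
  have tl0 : 0 <= t * lambda by rewrite mulr_ge0// ltW.
  have := gc _ tl0 => /cvgrPdist_le/(_ _ e0) [/= d d0 hd].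
  have dl0 : 0 < d / lambda by rewrite divr_gt0.
  near=> s.
  have ts : t < s by near: s; exact: nbhs_right_gt.
  have s1 : s < 1 by near: s; exact: nbhs_right_lt.
  have sd : s < t + d / lambda by near: s; apply: nbhs_right_lt; rewrite ltrDl.
  rewrite clamp_id ?(ltW s1) ?(le_trans t0 (ltW ts))//.
  apply: hd => /=; last by rewrite ltr_pM2r.
  rewrite -mulrBl normrM (ger0_norm (ltW l0)) -ltr_pdivlMr// distrC ger0_norm; lra.
Unshelve. all: by end_near. Qed.

End GammaPaths.

Section GammaProcesses.
Context (R : realType) (n : nat) d (Omega : measurableType d).
Context (Pr : probability Omega R) (g : nat -> 'I_n -> R -> Omega -> R).
Hypothesis g_iid : iid_gamma_vectors Pr g.

Let sq (k : nat) : R := (k.+1 ^ 2)%N%:R.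

Let sq_ge0 k : 0 <= sq k. Proof. exact: ler0n. Qed.

Definition gamma_deviation (e : R) (j k : nat) (i : 'I_n) : set Omega :=
  [set w | e * (k.+1 ^ 2)%N%:R <
           `|g j i (k.+1 ^ 2)%N%:R w - (k.+1 ^ 2)%N%:R|].

(** The event does not mention lambda: a single event for each vector controls all large values of
    lambda at once, as is needed when lambda varies with N. *)
Definition gamma_bad (e : R) (K j : nat) : set Omega :=
  \bigcup_(k in [set k | (K <= k)%N]) \bigcup_(i in [set: 'I_n])
    gamma_deviation e j k i.

Let dev_set e k : set R := [set x | e * sq k < `|x - sq k|].

Let measurable_dev_set e k : measurable (dev_set e k).
Proof.
apply: (measurable_set_ltr (measurable_cst _)).
by apply: measurableT_comp => //; exact: measurable_funB.
Qed.

Let gamma_deviationE e j k i :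
  gamma_deviation e j k i = g j i (sq k) @^-1` dev_set e k.
Proof. by []. Qed.

Lemma gamma_subordinator_path_ae :
  {ae Pr, forall w, forall j i, subordinator_path (fun t => g j i t w)}.
Proof.
have [gs _ _] := g_iid.
apply/ae_foralln => j.
apply: (@filter_forall _ _ (fun i w => subordinator_path (fun t => g j i t w))
  (almost_everywhere Pr)) => i.
by have [_ + _] := gs j i; apply: filterS => w [].
Qed.

Let measurable_deviation e j k i : measurable (gamma_deviation e j k i).
Proof.
have [/(_ j i)[[mg _ _] _ _] _ _] := g_iid.
rewrite gamma_deviationE -[X in measurable X]setTI.
exact: mg.
Qed.

Lemma measurable_gamma_bad e K j : measurable (gamma_bad e K j).
Proof.
by apply: bigcup_measurable => k _; apply: fin_bigcup_measurable.
Qed.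

(** Chebyshev's bound at time (k + 1)^2 is of order 1 / (k + 1)^2. Sampling at squares makes it
    summable, so the tail from [K] on is small uniformly in [j]. *)
Lemma gamma_bad_le e K j : 0 < e ->
  (Pr (gamma_bad e K j) <=
   \sum_(K <= k <oo) ((n%:R * e ^- 2) / k.+1%:R ^+ 2)%:E)%E.
Proof.
move=> e0.
have mU k : measurable (\bigcup_(i in [set: 'I_n]) gamma_deviation e j k i).
  by apply: fin_bigcup_measurable => // i _; exact: measurable_deviation.
apply: (@le_trans _ _ (\sum_(K <= k <oo)
    Pr (\bigcup_(i in [set: 'I_n]) gamma_deviation e j k i))%E).
  apply: measure_sigma_subadditive_tail => //; first exact: measurable_gamma_bad.
  move=> w [k /= Kk [i _ h]]; exists k; last by exists i.
  by rewrite /= ltnNge Kk.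
apply: lee_nneseries => // k _.
have -> : \bigcup_(i in [set: 'I_n]) gamma_deviation e j k i =
    \big[setU/set0]_(i < n) gamma_deviation e j k i.
  by rewrite -bigcup_seq; apply: eq_bigcupl; split=> // i _ /=; rewrite mem_index_enum.
apply: (@le_trans _ _ (\sum_(i < n) Pr (gamma_deviation e j k i))%E).
  suff [] : measurable (\big[setU/set0]_(i < n) gamma_deviation e j k i) /\
     (Pr (\big[setU/set0]_(i < n) gamma_deviation e j k i) <=
     \sum_(i < n) Pr (gamma_deviation e j k i))%E by [].
  elim/big_rec2: _ => [|i y X _ [mX Xy]]; first by split=> //; rewrite measure0.
  split; first by apply: measurableU.
  by rewrite (le_trans (measureU2 _ _ _))// leeD.
apply: (@le_trans _ _ (\sum_(i < n) (e ^- 2 / k.+1%:R ^+ 2)%:E)%E); last first.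
  rewrite sumEFin lee_fin sumr_const card_ord.
  move: (e ^- 2) (k.+1%:R ^+ 2) => a b.
  by rewrite -(mulr_natl (a / b)) mulrA.
apply: lee_sum => i _.
have [/(_ j i)[_ _ law] _ _] := g_iid.
rewrite gamma_deviationE law ?ltr0n ?expn_gt0//.
have := @gamma_law_tail R (k.+1 ^ 2).-1 e e0; rewrite prednK ?expn_gt0// => h.
apply: (le_trans h); rewrite lee_fin natrX; exact: lexx.
Qed.

Lemma gamma_bad_indep e K j j' : j != j' ->
  Pr (gamma_bad e K j `&` gamma_bad e K j') =
  (Pr (gamma_bad e K j) * Pr (gamma_bad e K j'))%E.
Proof.
move=> jj'; have [_ _ ind] := g_iid.
have sig i : sigma_of [set it : 'I_n * R | 0 <= it.2]
    (fun it => g i it.1 it.2) (gamma_bad e K i).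
  rewrite /sigma_of; set G := (X in <<s X >>).
  apply: (@bigcup_measurable _ (g_sigma_algebraType G)) => k _.
  apply: (@fin_bigcup_measurable _ (g_sigma_algebraType G)) => // l _.
  apply: sub_sigma_algebra; exists (l, sq k); first exact: sq_ge0.
  exists (dev_set e k); first exact: measurable_dev_set.
  by rewrite setTI.
have := ind [:: j; j'] (gamma_bad e K).
rewrite !big_cons big_nil mule1 /= inE jj' => /(_ isT)/(_ (fun i _ => sig i)) <-.
congr (Pr _); apply/seteqP; split=> [w [wj wj'] i /=|w h].
  by rewrite !inE => /orP[/eqP ->|/eqP ->].
by split; apply: h; rewrite /= !inE eqxx ?orbT.
Qed.

(** One null set must serve all real [e]: the law of large numbers is invoked for the countably many
    precisions 1 / (l + 1), and [e] is replaced by a smaller one of these, which enlarges the bad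
    event. Half of [delta] covers the mean, half the fluctuation. *)
Lemma gamma_bad_frequency_ae : {ae Pr, forall w, forall e delta : R,
  0 < e -> 0 < delta -> exists K, \forall N \near \oo,
    \sum_(j < N) \1_(gamma_bad e K j) w <= delta * N%:R}.
Proof.
have : {ae Pr, forall w, forall l K, (fun N : nat =>
    (\sum_(j < N) (\1_(gamma_bad l.+1%:R^-1 K j) w -
        fine (Pr (gamma_bad l.+1%:R^-1 K j)))) / N%:R) @ \oo --> (0 : R)}.
  apply/ae_foralln => l; apply/ae_foralln => K.
  apply: slln_events; first by move=> j; exact: measurable_gamma_bad.
  by move=> i j; exact: gamma_bad_indep.
apply: filterS => w h e delta e0 delta0.
have [l _ /(_ l (leqnn l)) le] := near_infty_natSinv_lt (PosNum e0).
rewrite /= in le; set e' : R := l.+1%:R^-1 in le.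
have e'0 : 0 < e' by rewrite invr_gt0 ltr0n.
have d20 : 0 < delta / 2 by rewrite divr_gt0.
have C0 : 0 <= n%:R * e' ^- 2 by rewrite mulr_ge0 ?ler0n// invr_ge0 sqr_ge0.
have [K KE] : exists K, (\sum_(K <= k <oo) ((n%:R * e' ^- 2) / k.+1%:R ^+ 2)%:E <
    (delta / 2)%:E)%E.
  have /fine_cvgP[fin /cvgrPdist_lt/(_ _ d20) cv] :=
    nneseries_tail_cvg (nneseries_inv_sqr_lty C0)
      (fun k _ => divr_ge0 C0 (sqr_ge0 (k.+1%:R : R))).
  have [K _ /(_ K (leqnn K))/= KE] := filterI fin cv.
  exists K; have [fK] := KE; rewrite sub0r normrN => h'.
  by rewrite -(fineK fK) lte_fin (le_lt_trans (ler_norm _)).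
exists K.
have := h l K => /cvgrPdist_le/(_ _ d20); apply: filterS => N.
rewrite sub0r normrN.
have [->|N0] := posnP N; first by rewrite !big_ord0 mulr0.
have N0' : 0 < N%:R :> R by rewrite ltr0n.
rewrite normrM normfV (ger0_norm (ltW N0')) ler_pdivrMr// => hN.
have sub j : \1_(gamma_bad e K j) w <= \1_(gamma_bad e' K j) w :> R.
  rewrite !indicE ler_nat; case: (boolP (w \in gamma_bad e K j)) => //.
  rewrite inE => -[k Kk [i _ hk]]; rewrite mem_set//.
  exists k => //; exists i => //; rewrite /gamma_deviation/= in hk *.
  by rewrite (le_lt_trans _ hk)// ler_wpM2r// ltW.
have pb j : fine (Pr (gamma_bad e' K j)) <= delta / 2.
  rewrite -lee_fin fineK ?fin_num_measure//; last exact: measurable_gamma_bad.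
  by rewrite (le_trans (gamma_bad_le K j e'0))// ltW.
have := le_trans (ler_norm _) hN; rewrite -/e' sumrB lerBlDr => hN'.
have s1 : \sum_(j < N) \1_(gamma_bad e K j) w <=
    \sum_(j < N) \1_(gamma_bad e' K j) w :> R by apply: ler_sum => j _; exact: sub.
have s2 : \sum_(j < N) fine (Pr (gamma_bad e' K j)) <= delta / 2 * N%:R.
  have -> : delta / 2 * N%:R = \sum_(j < N) delta / 2.
    by rewrite sumr_const card_ord mulr_natr.
  by apply: ler_sum => j _; exact: pb.
apply: (le_trans s1); apply: (le_trans hN').
by rewrite [leRHS](splitr (delta * N%:R)) mulrAC lerD// mulrAC.
Qed.

End GammaProcesses.

(** * Portfolio geometry *)

Section Portfolio.
Context (R : realType) (m : nat).
Local Notation n := m.+2.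
Local Notation V := 'rV[R]_n.

Lemma pos_simplex (x : V) : (forall i, 0 < x 0 i) -> \sum_i x 0 i = 1 -> simplex x.
Proof.
move=> x0 x1; have := @ratio_simplex R m (x 0) x0.
rewrite x1; congr simplex; apply/rowP => i; by rewrite mxE divr1.
Qed.

Lemma sumr_gt0 (a : 'I_n -> R) : (forall i, 0 < a i) -> 0 < \sum_i a i.
Proof.
move=> a0; rewrite (bigD1 ord0)//= ltr_pwDl// sumr_ge0// => k _; exact: ltW.
Qed.

Lemma simplex_gt0 (x : V) i : simplex x -> 0 < x 0 i.
Proof. by move=> [/(_ i)/andP[]]. Qed.

Lemma sinv_simplex (x : V) : simplex x -> simplex (sinv x).
Proof. by move=> sx; apply: ratio_simplex => i; rewrite invr_gt0 simplex_gt0. Qed.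

Lemma sinvK (x : V) : simplex x -> sinv (sinv x) = x.
Proof.
move=> sx; apply/rowP => i.
have S0 : 0 < \sum_j (x 0 j)^-1 by apply: sumr_gt0 => j; rewrite invr_gt0 simplex_gt0.
rewrite mxE; under [X in _ / X]eq_bigr do rewrite mxE invfM !invrK.
rewrite -mulr_suml (proj2 sx) mul1r mxE invfM !invrK mulfK// gt_eqF//.
Qed.

Lemma simplex_line (p v : V) : simplex p -> tangent v ->
  exists2 e : R, 0 < e & forall h, `|h| < e -> simplex (p + h *: v).
Proof.
move=> sp tv.
have : \forall h \near (0 : R), forall i, 0 < p 0 i + h * v 0 i.
  apply: (@filter_forall _ _ (fun i (h : R) => 0 < p 0 i + h * v 0 i) (nbhs (0 : R))) => i.
  have c : (p 0 i + h * v 0 i) @[h --> (0 : R)] --> p 0 i + 0 * v 0 i.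
    by apply: cvgD; [exact: cvg_cst|apply: cvgM; [exact: cvg_id|exact: cvg_cst]].
  rewrite mul0r addr0 in c.
  move/cvgrPdist_lt : c => /(_ _ (simplex_gt0 i sp)); apply: filterS => h.
  by rewrite ltr_norml => /andP[_]; lra.
move=> /nbhs_ballP[e /= e0 he]; exists e => // h hh.
apply: pos_simplex => [i|].
  by rewrite !mxE; apply: he; rewrite /ball/= sub0r normrN.
under eq_bigr do rewrite !mxE.
by rewrite big_split/= -mulr_sumr (proj2 sp) (tv : \sum_i v 0 i = 0) mulr0 addr0.
Qed.

Lemma derivable_dirP (f : V -> R) (p v : V) (e : R) : derivable f p v -> 0 < e ->
  exists2 d : R, 0 < d & forall h, h != 0 -> `|h| < d ->
    `|'D_v f p - (f (p + h *: v) - f p) / h| <= e.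
Proof.
move=> df e0; have : h^-1 *: (f (h *: v + p) - f p) @[h --> 0^'] --> 'D_v f p.
  exact: df.
move=> /cvgrPdist_le/(_ _ e0)[/= d d0 hd]; exists d => // h h0 hh.
have := hd h; rewrite /= sub0r normrN => /(_ hh h0).
by rewrite (addrC (h *: v)) -[h^-1 *: _]/(h^-1 * _) mulrC.
Qed.

(** [C2_on_simplex] gives derivatives along separate tangent directions, so their linearity in the
    direction has to be derived: homogeneity here, by comparing difference quotients, and additivity
    below, by concavity. *)
Lemma derive_dirZ (f : V -> R) (p v : V) (c : R) :
  derivable f p v -> derivable f p (c *: v) -> 'D_(c *: v) f p = c * 'D_v f p.
Proof.
move=> dv dcv.
have [->|c0] := eqVneq c 0.
  by rewrite scale0r mul0r; have [_ ->] := is_derive0 f p.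
apply/eqP; rewrite -subr_eq0 -normr_le0; apply/ler_addgt0Pl => e e0.
rewrite addr0.
have e20 : 0 < e / 2 by rewrite divr_gt0.
have ec0 : 0 < e / 2 / `|c| by rewrite divr_gt0// normr_gt0.
have [d1 d10 h1] := derivable_dirP dcv e20.
have [d2 d20 h2] := derivable_dirP dv ec0.
pose h := Num.min (d1 / 2) (d2 / `|c| / 2).
have nc0 : 0 < `|c| by rewrite normr_gt0.
have h0 : 0 < h by rewrite lt_min !divr_gt0.
have hd1 : `|h| < d1.
  by rewrite (ger0_norm (ltW h0)) gt_min; apply/orP; left; lra.
have hd2 : `|h * c| < d2.
  rewrite normrM (ger0_norm (ltW h0)) -ltr_pdivlMr// gt_min; apply/orP; right.
  by rewrite gtr_pMr ?divr_gt0// invf_lt1// ltr1n.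
have H1 := h1 h (lt0r_neq0 h0) hd1.
have H2 := h2 (h * c) (mulf_neq0 (lt0r_neq0 h0) c0) hd2.
rewrite -scalerA in H2.
set X := f (p + h *: (c *: v)) - f p in H1.
have {}H2 : `|c * 'D_v f p - X / h| <= e / 2.
  have -> : c * 'D_v f p - X / h = c * ('D_v f p - X / (h * c)).
    by field; rewrite c0 gt_eqF.
  by rewrite normrM mulrC -ler_pdivlMr.
have -> : 'D_(c *: v) f p - c * 'D_v f p =
   ('D_(c *: v) f p - X / h) - (c * 'D_v f p - X / h) by ring.
by rewrite (le_trans (ler_normB _ _))//; lra.
Qed.

Context (phi : V -> R).
Hypothesis conc : exp_concave phi.
Hypothesis der : forall v, tangent v -> forall p, simplex p -> derivable phi p v.

(** Concavity of exp(phi) implies that of phi by the inequality between arithmetic and geometric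
    means. Halving the exponents turns it into the nonnegativity of a square. *)
Lemma exp_concave_midpoint (p q : V) : simplex p -> simplex q ->
  phi p + phi q <= 2 * phi (2^-1 *: p + 2^-1 *: q).
Proof.
move=> sp sq; have := conc sp sq (t := 2^-1).
have -> : 1 - 2^-1 = 2^-1 :> R by lra.
move=> /(_ _) h; have {}h : 2^-1 * expR (phi p) + 2^-1 * expR (phi q) <=
    expR (phi (2^-1 *: p + 2^-1 *: q)) by apply: h; lra.
suff : expR ((phi p + phi q) / 2) <= expR (phi (2^-1 *: p + 2^-1 *: q)).
  by rewrite ler_expR; lra.
apply: le_trans h.
have -> : phi p = phi p / 2 + phi p / 2 by lra.
have -> : phi q = phi q / 2 + phi q / 2 by lra.
set x := phi p / 2; set y := phi q / 2.
have -> : (x + x + (y + y)) / 2 = x + y by lra.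
rewrite !expRD; have := sqr_ge0 (expR x - expR y); rewrite sqrrB; lra.
Qed.

Lemma tangentZ c (v : V) : tangent v -> tangent (c *: v).
Proof.
by move=> tv; rewrite /tangent/=; under eq_bigr do rewrite mxE;
  rewrite -mulr_sumr (tv : _ = 0) mulr0.
Qed.

Lemma tangentD (v w : V) : tangent v -> tangent w -> tangent (v + w).
Proof.
by move=> tv tw; rewrite /tangent/=; under eq_bigr do rewrite mxE;
  rewrite big_split/= (tv : _ = 0) (tw : _ = 0) addr0.
Qed.

(** The points p + 2hv and p + 2hw have midpoint p + h(v + w), so midpoint concavity compares the
    three difference quotients. *)
Lemma derive_dir_superadditive (p v w : V) : simplex p -> tangent v -> tangent w ->
  'D_v phi p + 'D_w phi p <= 'D_(v + w) phi p.
Proof.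
move=> sp tv tw; apply/ler_addgt0Pr => e e0.
have e30 : 0 < e / 3 by rewrite divr_gt0.
have [d1 d10 h1] := derivable_dirP (der tv sp) e30.
have [d2 d20 h2] := derivable_dirP (der tw sp) e30.
have [d3 d30 h3] := derivable_dirP (der (tangentD tv tw) sp) e30.
have [d4 d40 h4] := simplex_line sp tv.
have [d5 d50 h5] := simplex_line sp tw.
pose D := Num.min (Num.min d1 d2) (Num.min d3 (Num.min d4 d5)).
have D0 : 0 < D by rewrite !lt_min d10 d20 d30 d40 d50.
have [D1 D2 D3 D4 D5] : [/\ D <= d1, D <= d2, D <= d3, D <= d4 & D <= d5].
  by split; rewrite !ge_min lexx ?orbT.
pose h := D / 3.
have hp : 0 < h by rewrite divr_gt0.
have n1 : `|h| < D by rewrite ger0_norm ?(ltW hp)// /h; lra.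
have n2 : `|2 * h| < D by rewrite ger0_norm ?mulr_ge0 ?(ltW hp)// /h; lra.
have h20 : 2 * h != 0 by rewrite gt_eqF// mulr_gt0.
have := h1 _ h20 (lt_le_trans n2 D1).
have := h2 _ h20 (lt_le_trans n2 D2).
have := h3 _ (lt0r_neq0 hp) (lt_le_trans n1 D3).
have := exp_concave_midpoint (h4 _ (lt_le_trans n2 D4)) (h5 _ (lt_le_trans n2 D5)).
have -> : 2^-1 *: (p + (2 * h) *: v) + 2^-1 *: (p + (2 * h) *: w) = p + h *: (v + w).
  by apply/rowP => i; rewrite !mxE; field.
set A := phi (p + (2 * h) *: v); set B := phi (p + (2 * h) *: w).
set C := phi (p + h *: (v + w)); set P := phi p => mid.
rewrite !ler_norml => /andP[_ H3] /andP[_ H2] /andP[_ H1].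
have : (A - P) / (2 * h) + (B - P) / (2 * h) <= (C - P) / h.
  have -> : (A - P) / (2 * h) + (B - P) / (2 * h) = ((A + B) / 2 - P) / h.
    by field; rewrite gt_eqF.
  by rewrite ler_pM2r ?invr_gt0//; lra.
have : (C - P) / h <= 'D_(v + w) phi p + e / 3.
  have := h3 _ (lt0r_neq0 hp) (lt_le_trans n1 D3).
  by rewrite -/C -/P ler_norml => /andP[]; lra.
lra.
Qed.

(** Superadditivity applied to -v and -w is the reverse inequality. *)
Lemma derive_dirD (p v w : V) : simplex p -> tangent v -> tangent w ->
  'D_(v + w) phi p = 'D_v phi p + 'D_w phi p.
Proof.
move=> sp tv tw; apply/eqP; rewrite eq_le derive_dir_superadditive// andbT.
have N u : tangent u -> 'D_(- u) phi p = - 'D_u phi p.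
  move=> tu; rewrite -scaleN1r derive_dirZ ?mulN1r//; first exact: der.
  by apply: der => //; exact: tangentZ.
have tN (u : V) : tangent u -> tangent (- u).
  move=> tu; have -> : - u = (-1) *: u by rewrite scaleN1r.
  exact: tangentZ.
have := derive_dir_superadditive sp (tN _ tv) (tN _ tw).
by rewrite -opprD !N//; [lra|exact: tangentD].
Qed.

(** The ratio of the portfolio weight at y to the coordinate [y 0 i]. *)
Definition price_ratio (y : V) (i : 'I_n) : R := 1 + 'D_(delta_mx 0 i - y) phi y.

Lemma tangent_vertex (y : V) i : simplex y -> tangent (delta_mx 0 i - y : V).
Proof.
move=> [_ y1]; rewrite /tangent/=; under eq_bigr do rewrite !mxE eqxx/=.
rewrite big_split/= sumrN y1 (bigD1 i)//= eqxx big1 ?addr0 ?subrr// => j ji.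
by rewrite (negbTE ji).
Qed.

(** Since q - y is the combination of the e_i - y with weights q_i, additivity of the derivative
    applies. The right-hand side is the argument of the logarithm in [L_div]. *)
Lemma sum_price_ratio (y q : V) : simplex y -> simplex q ->
  \sum_i q 0 i * price_ratio y i = 1 + 'D_(q - y) phi y.
Proof.
move=> sy sq; rewrite /price_ratio; under eq_bigr do rewrite mulrDr mulr1.
rewrite big_split/= (proj2 sq); congr (1 + _).
have -> : q - y = \sum_i q 0 i *: (delta_mx 0 i - y).
  under eq_bigr do rewrite scalerBr.
  by rewrite sumrB -scaler_suml (proj2 sq) scale1r {1}(row_sum_delta q).
suff [] : tangent (\sum_i q 0 i *: (delta_mx 0 i - y) : V) /\
  \sum_i q 0 i * 'D_(delta_mx 0 i - y) phi y =
  'D_(\sum_i q 0 i *: (delta_mx 0 i - y)) phi y by [].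
elim/big_rec2: _ => [|i w x _ [tw ->]].
  split; first by rewrite /tangent/=; under eq_bigr do rewrite mxE; rewrite big1.
  by have [_ ->] := is_derive0 phi y.
have ti : tangent (q 0 i *: (delta_mx 0 i - y) : V) by apply/tangentZ/tangent_vertex.
split; first exact: tangentD.
rewrite (derive_dirD sy ti tw) derive_dirZ//; last exact: der.
by apply: der => //; exact: tangent_vertex.
Qed.

(* The transport y^-1 |-> p^-1 generated by phi matches p = matched_price y to y. *)
Definition matched_price (y : V) : V := sinv (portfolio_transport phi (sinv y)).

(** A zero portfolio weight would send the transported point to the boundary. Such endpoints are set
    aside; they are P1-null because the transport pushes forward to a law carried by the open
    simplex. *)
Definition good_endpoint : set V :=
  [set y | simplex y /\ simplex (portfolio_transport phi (sinv y))].

Lemma portfolio_transportE (y : V) i : simplex y ->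
  portfolio_transport phi (sinv y) 0 i = price_ratio y i / \sum_k price_ratio y k.
Proof.
move=> sy; rewrite /portfolio_transport sinvK//.
pose S := \sum_j (y 0 j)^-1.
have S0 : 0 < S by apply: sumr_gt0 => j; rewrite invr_gt0 simplex_gt0.
have E k : sinv y 0 k * portfolio phi y 0 k = price_ratio y k / S.
  rewrite !mxE -/(price_ratio y k) -/S.
  by field; rewrite !gt_eqF// simplex_gt0.
rewrite mxE E; under eq_bigr do rewrite E.
by rewrite -mulr_suml invfM invrK mulrACA mulVf ?mulr1// gt_eqF.
Qed.

(** Each price ratio divided by their sum is positive, so all have the sign of the sum; their
    average with weights y is 1, which leaves the positive sign. *)
Lemma price_ratio_gt0 (y : V) i : good_endpoint y -> 0 < price_ratio y i.
Proof.
move=> [sy st].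
have pos k : 0 < price_ratio y k / \sum_k price_ratio y k.
  by rewrite -portfolio_transportE// simplex_gt0.
have h1 : \sum_i y 0 i * price_ratio y i = 1.
  rewrite sum_price_ratio// subrr.
  by have [_ ->] := is_derive0 phi y; rewrite addr0.
set A := \sum_k _ in pos.
have [A0|A0|A0] := ltgtP A 0.
- have neg k : price_ratio y k < 0.
    by have := pos k; rewrite -(nmulr_llt0 _ (_ : A < 0))//  divfK ?lt_eqF.
  have : \sum_i y 0 i * price_ratio y i <= 0.
    by apply: sumr_le0 => k _; rewrite mulr_ge0_le0 ?ltW// ?simplex_gt0.
  by rewrite h1 ler10.
- by have := pos i; rewrite -(pmulr_lgt0 _ A0) divfK ?gt_eqF.
- by have := pos i; rewrite A0 invr0 mulr0 ltxx.
Qed.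

Lemma matched_price_simplex (y : V) : good_endpoint y -> simplex (matched_price y).
Proof. by move=> [_]; exact: sinv_simplex. Qed.

Lemma matched_priceE (y : V) i : good_endpoint y ->
  matched_price y 0 i = (price_ratio y i)^-1 / \sum_k (price_ratio y k)^-1.
Proof.
move=> gy; have sy := gy.1.
have A0 : 0 < \sum_k price_ratio y k by apply: sumr_gt0 => k; exact: price_ratio_gt0.
have E k : (portfolio_transport phi (sinv y) 0 k)^-1 =
    (price_ratio y k)^-1 * \sum_k price_ratio y k.
  by rewrite portfolio_transportE// invfM invrK.
have S : \sum_k (portfolio_transport phi (sinv y) 0 k)^-1 =
    (\sum_k (price_ratio y k)^-1) * \sum_k price_ratio y k.
  by rewrite mulr_suml; apply: eq_bigr => k _; exact: E.
have -> : matched_price y 0 i = (portfolio_transport phi (sinv y) 0 i)^-1 /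
    \sum_k (portfolio_transport phi (sinv y) 0 k)^-1 by rewrite mxE.
by rewrite E S invfM mulrACA mulfV ?mulr1// gt_eqF.
Qed.

Lemma L_divE (y q : V) : good_endpoint y -> simplex q ->
  0 < \sum_i q 0 i * price_ratio y i /\
  ln (\sum_i q 0 i * price_ratio y i) = L_div phi q y + phi q - phi y.
Proof.
move=> gy sq; have sy := gy.1; split.
  by apply: sumr_gt0 => k; rewrite mulr_gt0 ?simplex_gt0// price_ratio_gt0.
by rewrite sum_price_ratio// /L_div -addrA subrK.
Qed.

Definition endpoint_potential (q : V) : R := phi q - n%:R^-1 * \sum_i ln (q 0 i).

(* The identity that turns the transport problem into a matching problem: up
   to separable terms, the cost is the L-divergence to the matched endpoint. *)
Lemma cost_matched_price (y : V) : good_endpoint y -> exists v : R,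
  forall q, simplex q ->
    cost (matched_price y) q = L_div phi q y + endpoint_potential q + v.
Proof.
move=> gy; pose B := \sum_k (price_ratio y k)^-1.
have B0 : 0 < B by apply: sumr_gt0 => k; rewrite invr_gt0 price_ratio_gt0.
exists (ln (n%:R^-1 * B) - phi y + n%:R^-1 * \sum_i ln (matched_price y 0 i)) => q sq.
have sp := matched_price_simplex gy.
have [X0 lnX] := L_divE gy sq.
rewrite /cost /endpoint_potential.
have -> : \sum_i q 0 i / matched_price y 0 i = B * \sum_i q 0 i * price_ratio y i.
  rewrite mulr_sumr; apply: eq_bigr => i _; rewrite matched_priceE// -/B.
  by rewrite invfM !invrK; ring.
rewrite mulrA lnM ?posrE ?mulr_gt0 ?invr_gt0 ?ltr0n// lnX.
under eq_bigr do rewrite ln_div ?posrE ?simplex_gt0//.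
by rewrite sumrB; ring.
Qed.

Lemma enorm_sqr (v : V) : enorm v ^+ 2 = \sum_i v 0 i ^+ 2.
Proof. by rewrite /enorm sqr_sqrtr// sumr_ge0// => i _; exact: sqr_ge0. Qed.

Lemma enorm_sqr_simplex_le (p q : V) : simplex p -> simplex q ->
  enorm (p - q) ^+ 2 <= n%:R.
Proof.
move=> sp sq; rewrite enorm_sqr -[n in leRHS]card_ord -sumr_const ler_sum// => i _.
rewrite !mxE -real_normK ?num_real// exprn_ile1//.
have /andP[p0 p1] := simplex_itv i sp; have /andP[q0 q1] := simplex_itv i sq.
by rewrite ler_norml; lra.
Qed.

Lemma L_div_refl (y : V) : L_div phi y y = 0.
Proof.
by rewrite /L_div subrr; have [_ ->] := is_derive0 phi y; rewrite addr0 ln1 !subrr.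
Qed.

(** phi q - phi y is the logarithm of an average of price ratios at y minus an L-divergence. The
    average lies between 1/B and A, and the divergence is at most alpha' n. The bound is what makes
    the endpoint potential integrable. *)
Lemma exp_concave_bounded (alpha alpha' : R) (y : V) : 0 <= alpha -> 0 <= alpha' ->
  good_endpoint y ->
  (forall q, simplex q ->
     alpha * enorm (q - y) ^+ 2 <= L_div phi q y <= alpha' * enorm (q - y) ^+ 2) ->
  exists M : R, forall q, simplex q -> `|phi q| <= M.
Proof.
move=> a0 a'0 gy hL.
pose B := \sum_k (price_ratio y k)^-1; pose A := \sum_k price_ratio y k.
have pr0 k : 0 < price_ratio y k by exact: price_ratio_gt0.
have B0 : 0 < B by apply: sumr_gt0 => k; rewrite invr_gt0.
have A0 : 0 < A by apply: sumr_gt0.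
exists (`|phi y| + (`|ln B| + `|ln A|) + alpha' * n%:R) => q sq.
have [X0 lnX] := L_divE gy sq.
set X := \sum_i _ in X0 lnX.
have XA : X <= A.
  apply: ler_sum => i _; rewrite ler_piMl ?(ltW (pr0 i))//.
  by case/andP : (simplex_itv i sq).
have XB : B^-1 <= X.
  rewrite -[B^-1]mul1r -(proj2 sq) mulr_suml; apply: ler_sum => i _.
  rewrite ler_wpM2l ?(ltW (simplex_gt0 i sq))//.
  rewrite -[leRHS]invrK lef_pV2 ?posrE ?invr_gt0//.
  by rewrite /B (bigD1 i)//= lerDl sumr_ge0// => k _; rewrite invr_ge0 ltW.
have lnXA : ln X <= ln A by rewrite ler_ln.
have lnXB : - ln B <= ln X by rewrite -lnV ?posrE// ler_ln// posrE invr_gt0.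
have /andP[L0 L1] := hL q sq.
have L0' : 0 <= L_div phi q y by rewrite (le_trans _ L0)// mulr_ge0 ?sqr_ge0.
have L1' : L_div phi q y <= alpha' * n%:R.
  by rewrite (le_trans L1)// ler_wpM2l// enorm_sqr_simplex_le//; exact: gy.1.
have := ler_norm (ln A); have := ler_norm (ln B).
have := ler_norm (phi y); have := ler_norm (- phi y); rewrite normrN.
have := normr_ge0 (ln A); have := normr_ge0 (ln B).
by rewrite ler_norml; lra.
Qed.

(** The exponent is the cost itself, the factor n^(-lambda) coming from the mean in the cost against
    the sum in the density. *)
Lemma f_densityE (lambda : R) (p q : V) : simplex p -> simplex q ->
  f_density lambda q p =
  Gamma lambda / Gamma (lambda / n%:R) ^+ n * expR (- lambda * ln n%:R) *
  (\prod_i q 0 i)^-1 * expR (- lambda * cost p q).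
Proof.
move=> sp sq; rewrite /f_density /cost.
have r0 i : 0 < q 0 i / p 0 i by rewrite divr_gt0 ?simplex_gt0.
have S0 : 0 < \sum_i q 0 i / p 0 i by exact: sumr_gt0.
have -> : \prod_i (q 0 i / p 0 i) `^ (lambda / n%:R) =
    expR (lambda / n%:R * \sum_i ln (q 0 i / p 0 i)).
  rewrite mulr_sumr expR_sum; apply: eq_bigr => i _.
  by rewrite /powR gt_eqF.
have -> : (\sum_i q 0 i / p 0 i) `^ (- lambda) =
    expR (- lambda * ln (\sum_i q 0 i / p 0 i)) by rewrite /powR gt_eqF.
rewrite lnM ?posrE ?invr_gt0 ?ltr0n// lnV ?posrE ?ltr0n//.
set c := _ / _ ^+ _; set P := (\prod_i _)^-1.
rewrite -[LHS]mulrA -expRD -[c * _ * P]mulrA -[expR _ * P]mulrC [c * (P * _)]mulrA.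
rewrite -[RHS]mulrA -expRD; congr (_ * expR _).
by field.
Qed.

End Portfolio.

(** * The optimal map *)

Lemma measurable_fun_inv_pos d (T : measurableType d) (R : realType) (D : set T)
    (f : T -> R) : (forall t, D t -> 0 < f t) -> measurable_fun D f ->
  measurable_fun D (fun t => (f t)^-1).
Proof.
move=> f0 mf; apply: (eq_measurable_fun (fun t => f t `^ (-1))).
  by move=> t /[!inE] Dt; rewrite powR_inv1// ltW// f0.
exact: (@measurableT_comp _ _ _ _ _ _ (fun x : R => x `^ (-1))).
Qed.

Lemma measurable_fun_extend d d' (T : measurableType d) (U : measurableType d')
    (D : set T) (f : T -> U) (c : U) : measurable D -> measurable_fun D f ->
  measurable_fun setT (fun t => if t \in D then f t else c).
Proof.
move=> mD mf _ B mB; rewrite setTI.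
have -> : (fun t => if t \in D then f t else c) @^-1` B =
    (D `&` f @^-1` B) `|` (~` D `&` [set t | B c]).
  apply/seteqP; split=> t /=.
    by case: ifPn => [/[!inE] ? ?|/negP/[!inE] ? ?]; [left|right].
  by case=> [[Dt Bt]|[Dt Bc]]; [rewrite mem_set|rewrite memNset].
apply: measurableU; first exact: mf.
have [Bc|Bc] := pselect (B c).
  rewrite (_ : [set t | B c] = setT); first by rewrite setIT; exact: measurableC.
  by apply/seteqP; split.
rewrite (_ : [set t | B c] = set0); first by rewrite setI0; exact: measurable0.
by apply/seteqP; split.
Qed.

Section Cost.
Context (R : realType) (m : nat).
Local Notation n := m.+2.
Local Notation V := 'rV[R]_n.

Lemma cost_ge0 (p q : V) : simplex p -> simplex q -> 0 <= cost p q.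
Proof.
move=> sp sq; rewrite /cost; set r := fun i => q 0 i / p 0 i.
have r0 i : 0 < r i by rewrite divr_gt0 ?simplex_gt0.
have n0 : 0 < n%:R :> R by rewrite ltr0n.
set A := n%:R^-1 * \sum_i _.
have A0 : 0 < A by rewrite mulr_gt0 ?invr_gt0//; exact: sumr_gt0.
(* Jensen's inequality, through the tangent line of [ln] at the mean [A]. *)
have h i : ln (r i) <= ln A + (r i / A - 1).
  rewrite -lerBlDl -ln_div ?posrE// -{1}[r i / A](subrK 1) addrC.
  by apply: le_ln1Dx; rewrite ltrBrDr addNr divr_gt0.
rewrite subr_ge0 mulrC ler_pdivrMr//.
rewrite (le_trans (ler_sum _ (fun i _ => h i)))// big_split/= sumrB -mulr_suml.
rewrite !sumr_const card_ord -(mulr_natr (ln A)) -(mulr_natr 1) mul1r.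
have -> : \sum_i r i = n%:R * A by rewrite /A mulrA mulfV ?mul1r// gt_eqF.
by rewrite mulfK ?subrr ?addr0// gt_eqF.
Qed.

(** Each q_i / p_i is at most 1 / p_i, hence at most the exponential of the first sum. With the
    log-moments of [class_La] this makes the compared costs finite. *)
Lemma cost_le (p q : V) : simplex p -> simplex q ->
  cost p q <= \sum_i `|ln (p 0 i)| + \sum_i `|ln (q 0 i)|.
Proof.
move=> sp sq; rewrite /cost.
have n0 : 0 < n%:R :> R by rewrite ltr0n.
have lp i : ln (p 0 i) <= 0 by rewrite ln_le0//; case/andP : (simplex_itv i sp).
apply: lerD.
  rewrite -ler_expR lnK; last first.
    rewrite posrE mulr_gt0 ?invr_gt0//; apply: sumr_gt0 => i.
    by rewrite divr_gt0 ?simplex_gt0.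
  rewrite mulrC ler_pdivrMr//.
  have -> : expR (\sum_i `|ln (p 0 i)|) * n%:R =
      \sum_(i < n) expR (\sum_i `|ln (p 0 i)|).
    by rewrite sumr_const card_ord mulr_natr.
  apply: ler_sum => i _.
  apply: (@le_trans _ _ (p 0 i)^-1).
    rewrite ler_piMl ?invr_ge0 ?(ltW (simplex_gt0 i sp))//.
    by case/andP : (simplex_itv i sq).
  rewrite -[(p 0 i)^-1]lnK ?posrE ?invr_gt0 ?simplex_gt0// ler_expR.
  rewrite lnV ?posrE ?simplex_gt0// -(ler0_norm (lp i)).
  by rewrite (bigD1 i)//= lerDl sumr_ge0.
rewrite -mulrN -sumrN mulrC ler_pdivrMr//.
apply: (@le_trans _ _ (\sum_i `|ln (q 0 i)|)); last first.
  by rewrite ler_peMr ?sumr_ge0// ler1n.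
apply: ler_sum => i _; rewrite ln_div ?posrE ?simplex_gt0//.
by have := lp i; have := ler_norm (- ln (q 0 i)); rewrite normrN; lra.
Qed.

Lemma measurable_sinv : measurable_fun (simplex : set (borel V)) (@sinv R m : borel V -> borel V).
Proof.
apply: measurable_into_simplex => [x sx|i]; first exact: sinv_simplex.
have mi j : measurable_fun (simplex : set (borel V)) (fun x : borel V => ((x : V) 0 j)^-1).
  apply: measurable_fun_inv_pos => [x sx|]; first exact: simplex_gt0.
  by apply: measurable_funTS; exact: measurable_coord.
under eq_fun do rewrite mxE.
apply: measurable_funM => //; apply: measurable_fun_inv_pos => [x sx|].
  by apply: sumr_gt0 => j; rewrite invr_gt0 simplex_gt0.
exact: measurable_sum.
Qed.

Lemma measurable_cost :
  measurable_fun (simplex `*` simplex : set (borel V * borel V))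
    (fun z : borel V * borel V => cost (z.1 : V) (z.2 : V)).
Proof.
pose D := simplex `*` simplex : set (borel V * borel V).
have m1 i : measurable_fun D (fun z : borel V * borel V => (z.1 : V) 0 i).
  apply: measurable_funTS.
  exact: (measurableT_comp (measurable_coord i) measurable_fst).
have m2 i : measurable_fun D (fun z : borel V * borel V => (z.2 : V) 0 i).
  apply: measurable_funTS.
  exact: (measurableT_comp (measurable_coord i) measurable_snd).
have mr i : measurable_fun D
    (fun z : borel V * borel V => (z.2 : V) 0 i / (z.1 : V) 0 i).
  apply: measurable_funM => //; apply: measurable_fun_inv_pos => // z [z1 _].
  exact: simplex_gt0.
apply: measurable_funB.
  apply: measurableT_comp; first exact: measurable_ln.
  by apply: measurable_funM => //; exact: measurable_sum.
apply: measurable_funM => //; apply: measurable_sum => i.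
by apply: measurableT_comp; first exact: measurable_ln.
Qed.

End Cost.

Section FullMeasure.
Context d (T : measurableType d) (R : realType) (P : probability T R) (D : set T).
Hypotheses (mD : measurable D) (PD : P D = 1%E).

Let PC : P (~` D) = 0%E.
Proof. by rewrite probability_setC// PD subee. Qed.

Lemma probability_setI_full (A : set T) : measurable A -> P (D `&` A) = P A.
Proof.
move=> mA; apply/eqP; rewrite eq_le; apply/andP; split.
  by apply: le_measure; rewrite ?inE//; exact: measurableI.
rewrite -[leRHS]adde0 -PC.
apply: le_trans (measureU2 _ _ _).
- apply: le_measure; rewrite ?inE//.
    by apply: measurableU; [exact: measurableI|exact: measurableC].
  by move=> x Ax; have [sx|sx] := pselect (D x); [left|right].
- exact: measurableI.
- exact: measurableC.
Qed.

Lemma ge0_integral_full (A : set T) (f : T -> \bar R) : measurable A ->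
  D `<=` A -> measurable_fun A f -> (forall x, A x -> (0 <= f x)%E) ->
  (\int[P]_(x in A) f x = \int[P]_(x in D) f x)%E.
Proof.
move=> mA DA mf f0.
rewrite (@ge0_negligible_integral _ _ _ _ A (~` D))//; last exact: measurableC.
by rewrite setDE setCK setIidr.
Qed.

End FullMeasure.

Section OptimalMap.
Context (R : realType) (m : nat).
Local Notation n := m.+2.
Local Notation V := 'rV[R]_n.
Local Notation S := (simplex : set (borel V)).

Context (P0 P1 : probability (borel V) R).
Hypotheses (hP0 : class_La P0) (hP1 : class_La P1).
Context (phi : V -> R).
Hypotheses (phi_conc : exp_concave phi) (phi_opt : generates_optimal_map P0 P1 phi).
Hypothesis phi_C2 : C2_on_simplex phi.
Context (alpha alpha' : R).
Hypotheses (alpha_gt0 : 0 < alpha) (alpha'_gt0 : 0 < alpha').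
Hypothesis phi_div : forall q q' : V, simplex q -> simplex q' ->
     alpha * enorm (q' - q) ^+ 2 <= L_div phi q' q <=
       alpha' * enorm (q' - q) ^+ 2.

Lemma phi_derivable : forall v, tangent v -> forall p, simplex p -> derivable phi p v.
Proof. by move=> v tv p sp; have [_ /(_ v tv)[+ _ _]] := phi_C2; apply. Qed.

Let good : set (borel V) := good_endpoint phi.

Let measurable_portfolio_transport :
  measurable_fun S (portfolio_transport phi : borel V -> borel V).
Proof. by have [J' [_ []]] := phi_opt. Qed.

Let mS : measurable S. Proof. exact: measurable_simplex. Qed.

Let mPTs : measurable_fun S
  (fun y : borel V => portfolio_transport phi (sinv (y : V)) : borel V).
Proof.
apply: (measurable_comp (F := S)) => //.
- by move=> _ [y sy <-]; exact: sinv_simplex.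
- exact: measurable_sinv.
Qed.

Let measurable_good_endpoint : measurable good.
Proof. exact: (mPTs mS mS). Qed.

(** The second marginal of the known coupling, read back through the inversion of the simplex.
    Intersecting with [S] in [B] is what forces the endpoint to be good; total mass then gives
    [good_endpoint_full]. *)
Let matched_price_law (A : set (borel V)) : measurable A ->
  P1 (good `&` (matched_price phi : borel V -> borel V) @^-1` A) = P0 A.
Proof.
move=> mA; have [J' [[cJ' _] [mT indJ']]] := phi_opt.
pose B := S `&` (@sinv R m : borel V -> borel V) @^-1` A.
have mB : measurable B by exact: measurable_sinv.
have [_ h] := cJ' B mB.
rewrite indJ' in h; last by apply: measurableX.
rewrite /image_on in h.
rewrite -(@probability_setI_full _ _ _ P0 S)//; last by have [] := hP0.
transitivity (P0 (simplex `&` (@sinv R m) @^-1` B)); last first.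
  congr (P0 _); apply/seteqP; split=> p [sp].
    by move=> [/= _]; rewrite sinvK.
  by move=> Ap; split=> //; split; [exact: sinv_simplex|rewrite /= sinvK].
rewrite -h; congr (P1 _); apply/seteqP; split=> y.
  move=> [[sy st] /= Ay]; split=> //; split; first exact: sinv_simplex.
  by split=> //; split.
by move=> [sy [_ [_ [st Ay]]]]; split.
Qed.

Let good_endpoint_full : P1 good = 1%E.
Proof.
have := matched_price_law (@measurableT _ (borel V)).
by rewrite preimage_setT setIT probability_setT.
Qed.

Let pm (y : borel V) : borel V := if y \in good then matched_price phi y else bary.

Let pm_simplex y : simplex (pm y : V).
Proof.
rewrite /pm; case: ifPn => [/[!inE]|_]; last exact: bary_simplex.
by move=> /matched_price_simplex.
Qed.

Let mpm : measurable_fun setT pm.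
Proof.
apply: measurable_fun_extend; first exact: measurable_good_endpoint.
apply: (measurable_comp (F := S)) => //.
- by move=> _ [y [_ st] <-].
- exact: measurable_sinv.
- by apply: measurable_funS mPTs => // y [].
Qed.

Let pm_law (A : set (borel V)) : measurable A -> P1 (pm @^-1` A) = P0 A.
Proof.
move=> mA; rewrite -matched_price_law// -(probability_setI_full measurable_good_endpoint).
- by congr (P1 _); apply/seteqP; split=> y [gy] /=; rewrite /pm mem_set.
- exact: good_endpoint_full.
- by rewrite -[X in measurable X]setTI; exact: mpm.
Qed.

Context (J : probability (borel V * borel V)%type R).
Hypotheses (J_opt : optimal_coupling P0 P1 J).
Context (T : borel V -> borel V).
Hypothesis J_ind : induced_by P0 T J.

Let T' (p : borel V) : borel V := if p \in S then T p else bary.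

Let mT' : measurable_fun setT T'.
Proof. by apply: measurable_fun_extend => //; have [] := J_ind. Qed.

(** Both couplings are realized on one probability space, y ~ P1: the known pairs are (pm y, y),
    while [J] is the law of (pm y, qm y), where [qm y] is the endpoint that [T] assigns to the point
    matched to y. The costs can thus be compared pointwise in y. *)
Let qm (y : borel V) : borel V := T' (pm y).

Let mqm : measurable_fun setT qm.
Proof. exact: measurableT_comp. Qed.

Let J_law (C : set (borel V * borel V)) : measurable C ->
  J C = P1 ((fun y => (pm y, qm y)) @^-1` C).
Proof.
move=> mC; have [_ ->//] := J_ind.
have mp : measurable_fun setT (fun p : borel V => (p, T' p)).
  by apply: measurable_fun_pair => //; exact: measurable_id.
have mC' : measurable ((fun p : borel V => (p, T' p)) @^-1` C).
  by rewrite -[X in measurable X]setTI; exact: mp.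
rewrite (_ : _ @^-1` C = pm @^-1` ((fun p => (p, T' p)) @^-1` C))// pm_law//.
rewrite -(@probability_setI_full _ _ _ P0 S mS)//; last by have [] := hP0.
by congr (P0 _); apply/seteqP; split=> p [sp] /=; rewrite /T' mem_set.
Qed.

(** Because [qm] preserves P1, a separable term has the same integral at y and at [qm y], so it
    drops out of the comparison. *)
Let qm_law (A : set (borel V)) : measurable A -> P1 (qm @^-1` A) = P1 A.
Proof.
move=> mA; have [/(_ A mA)[_ <-] _] := J_opt.
rewrite J_law; last exact: measurableX.
by congr (P1 _); apply/seteqP; split=> y // [].
Qed.

Let mpy : measurable_fun setT (fun y : borel V => (pm y, y)).
Proof. by apply: measurable_fun_pair => //; exact: measurable_id. Qed.

Let mpq : measurable_fun setT (fun y : borel V => (pm y, qm y)).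
Proof. exact: measurable_fun_pair. Qed.

Let J0_fun : {RV P1 >-> (borel V * borel V)%type} :=
  mfun_Sub (mem_set mpy : _ \in mfun).

Let J0 : probability (borel V * borel V)%type R := distribution P1 J0_fun.

Let J0_coupling : coupling P0 P1 J0.
Proof.
move=> A mA; split.
  rewrite -pm_law//; rewrite /J0/= /distribution /pushforward/=.
  by congr (P1 _); apply/seteqP; split=> y // [].
rewrite /J0/= /distribution /pushforward/=.
by congr (P1 _); apply/seteqP; split=> y // [].
Qed.

Let mphi : measurable_fun S (phi : borel V -> R).
Proof.
move=> _; have [/continuousP cphi _] := phi_C2.
apply: (measurability _ (RGenOpens.measurableE R)) => //.
move=> _ [_ [a [b ->] <-]].
have oI : open (`]a, b[%classic : set R) by exact: interval_open.
have /open_subspaceP[W oW WE] := cphi _ oI.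
rewrite setIC -WE; apply: measurableI => //; exact: sub_sigma_algebra.
Qed.

Let D : set (borel V) := good `&` qm @^-1` S.

Let mqmS : measurable (qm @^-1` S).
Proof. by rewrite -[X in measurable X]setTI; exact: mqm. Qed.

Let mD : measurable D.
Proof. by apply: measurableI => //; exact: measurable_good_endpoint. Qed.

Let PD : P1 D = 1%E.
Proof.
rewrite /D (probability_setI_full measurable_good_endpoint good_endpoint_full)//.
by rewrite qm_law//; have [] := hP1.
Qed.

Let DS : D `<=` S. Proof. by move=> y [[]]. Qed.

Let expected_cost_pull (K : probability (borel V * borel V)%type R)
    (h : borel V -> (borel V * borel V)%type) : measurable_fun setT h ->
  (forall C, measurable C -> K C = P1 (h @^-1` C)) ->
  (forall y, D y -> S (h y).1 /\ S (h y).2) ->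
  expected_cost K = (\int[P1]_(y in D) (cost ((h y).1 : V) ((h y).2 : V))%:E)%E.
Proof.
move=> mh Kh Dh; rewrite /expected_cost.
have mSS : measurable (S `*` S) by exact: measurableX.
rewrite (@eq_measure_integral _ _ _ _ (pushforward P1 h))//; last first.
  by move=> C mC _; exact: Kh.
have mc : measurable_fun (S `*` S)
    (fun z : borel V * borel V => (cost (z.1 : V) (z.2 : V))%:E).
  by apply/measurable_EFinP; exact: measurable_cost.
rewrite ge0_integral_pushforward//; last first.
  by move=> z /[!inE] -[s1 s2]; rewrite lee_fin cost_ge0.
apply: (ge0_integral_full mD PD).
- by rewrite -[X in measurable X]setTI; exact: mh.
- by move=> y /Dh.
- apply: (measurable_comp (F := S `*` S)) => //; first by move=> _ [y hy <-].
  exact: measurable_funS mh.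
- by move=> y [s1 s2]; rewrite lee_fin cost_ge0.
Qed.

Let sum_log (x : borel V) : R := \sum_i `|ln ((x : V) 0 i)|.

Let mlog i : measurable_fun setT (fun x : borel V => ln ((x : V) 0 i)).
Proof.
by apply: measurableT_comp; [exact: measurable_ln|exact: measurable_coord].
Qed.

Let msum_log : measurable_fun setT sum_log.
Proof. by apply: measurable_sum => i; exact: (measurableT_comp _ (mlog i)). Qed.

Let sum_log_ge0 x : 0 <= sum_log x.
Proof. exact: sumr_ge0. Qed.

Let sum_log_lty (P : probability (borel V) R) : class_La P ->
  (\int[P]_(x in S) (sum_log x)%:E < +oo)%E.
Proof.
move=> [_ h _]; under eq_integral do rewrite /sum_log -sumEFin.
rewrite ge0_integral_sum//.
by move=> i; apply/measurable_EFinP/measurable_funTS; exact: (measurableT_comp _ (mlog i)).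
Qed.

Let exists_good : exists y, good y.
Proof.
apply/not_existsP => h; have := good_endpoint_full.
rewrite (_ : good = set0) ?measure0 => [/esym/eqP|].
  by rewrite onee_eq0.
by apply/seteqP; split=> // y /h.
Qed.

(* Comparing J with the coupling of the matched pairs (pm y, y): the cost gap
   is at least alpha times the mean square distance between y and qm y. *)
Let matched_endpoint_ae : {ae P1, forall y, D y -> qm y = y}.
Proof.
have [y0 gy0] := exists_good.
have [M hM] : exists M : R, forall q : V, simplex q -> `|phi q| <= M.
  apply: (@exp_concave_bounded _ _ phi phi_conc phi_derivable alpha alpha' y0) => //.
  - exact: ltW.
  - exact: ltW.
  - by move=> q sq; apply: phi_div => //; exact: gy0.1.
(* Adding the bound [M] of phi makes the potential nonnegative, since the logarithms of coordinates
   are at most 0. *)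
pose U (q : borel V) : R := endpoint_potential phi (q : V) + M.
have U0 q : S q -> 0 <= U q.
  move=> sq; rewrite /U /endpoint_potential.
  have := hM q sq; rewrite ler_norml => /andP[h _].
  have : n%:R^-1 * \sum_i ln ((q : V) 0 i) <= 0.
    rewrite mulr_ge0_le0 ?invr_ge0 ?ler0n// sumr_le0// => i _.
    by rewrite ln_le0//; case/andP : (simplex_itv i sq).
  move=> h2; rewrite addrAC addr_ge0 ?oppr_ge0//.
  by rewrite -lerBlDr sub0r.
have mU : measurable_fun S U.
  apply: measurable_funD => //; apply: measurable_funB => //.
  apply: measurable_funM => //; apply: measurable_sum => i.
  by apply: measurable_funTS; exact: mlog.
have sl0 y : (0 <= (sum_log y)%:E :> \bar R)%E by rewrite lee_fin.
have msl (A : set (borel V)) : measurable_fun A (fun y => (sum_log y)%:E : \bar R).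
  by apply/measurable_EFinP/measurable_funTS.
have mUe : measurable_fun S (fun y => (U y)%:E : \bar R) by exact/measurable_EFinP.
have U0e y : S y -> (0 <= (U y)%:E :> \bar R)%E by move=> sy; rewrite lee_fin U0.
have IUS : (\int[P1]_(y in S) (U y)%:E < +oo)%E.
  have M0 : (0 <= (2 * `|M|)%:E :> \bar R)%E by rewrite lee_fin mulr_ge0.
  have le1 y : S y -> ((U y)%:E <= (2 * `|M|)%:E + (sum_log y)%:E :> \bar R)%E.
    move=> sy; rewrite -EFinD lee_fin /U /endpoint_potential.
    have := hM y sy; rewrite ler_norml => /andP[_ h].
    have h2 : - (n%:R^-1 * \sum_i ln ((y : V) 0 i)) <= sum_log y.
      rewrite -mulrN -sumrN mulrC ler_pdivrMr ?ltr0n//.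
      apply: (@le_trans _ _ (sum_log y)); last by rewrite ler_peMr// ler1n.
      by apply: ler_sum => i _; rewrite -normrN ler_norm.
    have h3 : M <= `|M| by exact: ler_norm.
    by rewrite mulr_natl mulr2n addrAC lerD// (le_trans (lerD h (lexx M)))// lerD.
  have mc : measurable_fun S (cst (2 * `|M|)%:E : borel V -> \bar R) by exact: measurable_cst.
  have mr : measurable_fun S (fun y : borel V => ((2 * `|M|)%:E + (sum_log y)%:E)%E).
    exact: emeasurable_funD mc (msl S).
  apply: (le_lt_trans (ge0_le_integral P1 mS U0e mUe mr le1)).
  rewrite (ge0_integralD P1 mS (fun y _ => M0) mc (fun y _ => sl0 y) (msl S)).
  rewrite lte_add_pinfty//; last exact: sum_log_lty.
  rewrite integral_cst//; apply: lte_mul_pinfty => //.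
  by apply: (le_lt_trans (probability_le1 P1 mS)); exact: ltry.
have IU : (\int[P1]_(y in S) (U y)%:E = \int[P1]_(y in D) (U y)%:E)%E.
  exact: (ge0_integral_full mD PD mS DS mUe U0e).
have mqmD (A : set (borel V)) : measurable_fun A qm by exact: measurable_funS mqm.
have IUq : (\int[P1]_(y in S) (U y)%:E = \int[P1]_(y in D) (U (qm y))%:E)%E.
  rewrite (@eq_measure_integral _ _ _ _ (pushforward P1 qm)); last first.
    by move=> C mC _; apply/esym; exact: qm_law.
  rewrite (ge0_integral_pushforward mqm P1 mS mUe); last first.
    by move=> y /[!inE] sy; exact: U0e.
  apply: (ge0_integral_full mD PD mqmS).
  - by move=> y [].
  - apply: (measurable_comp mS _ mUe (mqmD _)); first by move=> _ [y hy <-].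
  - by move=> y sy; exact: U0e.
have I0E : expected_cost J0 = (\int[P1]_(y in D) (cost (pm y : V) (y : V))%:E)%E.
  apply: (expected_cost_pull mpy) => [C mC|y Dy]; first by [].
  by split; [exact: pm_simplex|exact: DS].
have I1E : expected_cost J = (\int[P1]_(y in D) (cost (pm y : V) (qm y : V))%:E)%E.
  apply: (expected_cost_pull mpq) => [C mC|y [_ sq]]; first exact: J_law.
  by split; [exact: pm_simplex|].
have I10 : (expected_cost J <= expected_cost J0)%E.
  by have [_] := J_opt; apply; exact: J0_coupling.
have mce : measurable_fun (S `*` S)
    (fun z : borel V * borel V => (cost (z.1 : V) (z.2 : V))%:E : \bar R).
  by apply/measurable_EFinP; exact: measurable_cost.
have mSS : measurable (S `*` S) by exact: measurableX.
have mc0 : measurable_fun D (fun y => (cost (pm y : V) (y : V))%:E : \bar R).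
  apply: (measurable_comp mSS _ mce (measurable_funS measurableT (@subsetT _ _) mpy)).
  by move=> _ [y Dy <-]; split; [exact: pm_simplex|exact: DS].
have mc1 : measurable_fun D (fun y => (cost (pm y : V) (qm y : V))%:E : \bar R).
  apply: (measurable_comp mSS _ mce (measurable_funS measurableT (@subsetT _ _) mpq)).
  by move=> _ [y [_ sq] <-]; split; [exact: pm_simplex|].
have c00 y : D y -> (0 <= (cost (pm y : V) (y : V))%:E :> \bar R)%E.
  by move=> Dy; rewrite lee_fin cost_ge0//; exact: DS.
have c10 y : D y -> (0 <= (cost (pm y : V) (qm y : V))%:E :> \bar R)%E.
  by move=> [_ sq]; rewrite lee_fin cost_ge0.
have mpl (A : set (borel V)) : measurable_fun A (fun y => (sum_log (pm y))%:E : \bar R).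
  by apply/measurable_EFinP/measurable_funTS; exact: (measurableT_comp msum_log mpm).
have I0fin : (expected_cost J0 < +oo)%E.
  have le2 y : D y -> ((cost (pm y : V) (y : V))%:E <=
      (sum_log (pm y))%:E + (sum_log y)%:E :> \bar R)%E.
    by move=> Dy; rewrite -EFinD lee_fin cost_le//; exact: DS.
  rewrite I0E.
  apply: (le_lt_trans (ge0_le_integral P1 mD c00 mc0
    (emeasurable_funD (mpl D) (msl D)) le2)).
  rewrite (ge0_integralD P1 mD (fun y _ => sl0 (pm y)) (mpl D) (fun y _ => sl0 y) (msl D)).
  rewrite lte_add_pinfty//.
    have := sum_log_lty hP0.
    rewrite (@eq_measure_integral _ _ _ _ (pushforward P1 pm)); last first.
      by move=> C mC _; apply/esym; exact: pm_law.
    rewrite (ge0_integral_pushforward mpm P1 mS (msl S)); last by move=> y _; exact: sl0.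
    have mpS : measurable (pm @^-1` S) by rewrite -[X in measurable X]setTI; exact: mpm.
    rewrite (ge0_integral_full mD PD mpS)//.
    - by move=> y _; exact: pm_simplex.
    - by move=> y _; exact: sl0.
  have := sum_log_lty hP1.
  by rewrite (ge0_integral_full mD PD mS DS (msl S)).
pose e2 (y : borel V) : R := alpha * enorm ((qm y : V) - (y : V)) ^+ 2.
have e20 y : 0 <= e2 y by rewrite mulr_ge0 ?sqr_ge0// ltW.
have me2 : measurable_fun setT e2.
  apply: measurable_funM => //; under eq_fun do rewrite enorm_sqr.
  apply: measurable_sum => i; under eq_fun do rewrite !mxE.
  apply: measurable_funX; apply: measurable_funB; last exact: measurable_coord.
  exact: (measurableT_comp (measurable_coord i) mqm).
(* The cost identity at y and at [qm y] has the same additive constant [v], so the gap of costs is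
   the divergence from [qm y] to y up to the potential; [L_div_refl] is the value at y. *)
have key y : D y -> cost (pm y : V) (y : V) + (e2 y + U (qm y)) <=
    cost (pm y : V) (qm y : V) + U y.
  move=> [gy sq]; have sy : simplex (y : V) by exact: gy.1.
  have -> : pm y = matched_price phi y by rewrite /pm mem_set.
  have [v hv] := cost_matched_price phi_conc phi_derivable gy.
  rewrite (hv _ sy) (hv _ sq) L_div_refl.
  have /andP[h _] := phi_div sy sq.
  rewrite /e2 /U; move: h; set a := alpha * _; set L := L_div _ _ _.
  set u1 := endpoint_potential _ _; set u2 := endpoint_potential _ _ => h.
  rewrite (_ : _ + _ + (a + _) = a + (u1 + v + (u2 + M))); last by ring.
  by rewrite (_ : L + _ + _ + _ = L + (u1 + v + (u2 + M))) ?lerD//; ring.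
have mUD : measurable_fun D (fun y => (U y)%:E : \bar R) by exact: measurable_funS DS mUe.
have mUqD : measurable_fun D (fun y => (U (qm y))%:E : \bar R).
  by apply: (measurable_comp mS _ mUe (mqmD _)) => _ [y [_ sq] <-].
have me2D : measurable_fun D (fun y => (e2 y)%:E : \bar R).
  exact/measurable_EFinP/measurable_funTS.
have e2e y : D y -> (0 <= (e2 y)%:E :> \bar R)%E by move=> _; rewrite lee_fin.
have UD0 y : D y -> (0 <= (U y)%:E :> \bar R)%E by move=> Dy; apply: U0e; exact: DS.
have Uq0 y : D y -> (0 <= (U (qm y))%:E :> \bar R)%E by move=> [_ sq]; exact: U0e.
have I20 : (\int[P1]_(y in D) (e2 y)%:E = 0)%E.
  have eU0 y : D y -> (0 <= (e2 y)%:E + (U (qm y))%:E :> \bar R)%E.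
    by move=> Dy; rewrite adde_ge0 ?e2e ?Uq0.
  have meU := emeasurable_funD me2D mUqD.
  have ceU0 y : D y -> (0 <= (cost (pm y : V) (y : V))%:E +
      ((e2 y)%:E + (U (qm y))%:E) :> \bar R)%E.
    by move=> Dy; apply: adde_ge0; [exact: c00|exact: eU0].
  have keye y : D y -> ((cost (pm y : V) (y : V))%:E + ((e2 y)%:E + (U (qm y))%:E) <=
    (cost (pm y : V) (qm y : V))%:E + (U y)%:E :> \bar R)%E.
    by move=> Dy; rewrite -!EFinD lee_fin; exact: key.
  have := ge0_le_integral P1 mD ceU0 (emeasurable_funD mc0 meU) 
     (emeasurable_funD mc1 mUD) keye.
  rewrite (ge0_integralD P1 mD c00 mc0 eU0 meU).
  rewrite (ge0_integralD P1 mD e2e me2D Uq0 mUqD).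
  rewrite (ge0_integralD P1 mD c10 mc1 UD0 mUD).
  (* The cost of [J] is at most that of [J0]; both this cost and the integral of [U] are finite and
     cancel, leaving a nonpositive integral of [e2]. *)
  rewrite -IUq -IU -I0E -I1E => h.
  have {}h := le_trans h (leeD I10 (lexx _)).
  have h1 : (0 <= \int[P1]_(y in D) (e2 y)%:E)%E by exact: integral_ge0.
  have h2 : (0 <= expected_cost J0)%E by rewrite I0E; exact: integral_ge0.
  have h3 : (0 <= \int[P1]_(y in S) (U y)%:E)%E by exact: integral_ge0.
  move: h IUS I0fin h1 h2 h3.
  case: (\int[P1]_(y in D) (e2 y)%:E)%E => [x||]; case: (\int[P1]_(y in S) (U y)%:E)%E => [a||];
    case: (expected_cost J0) => [b||] //.
  rewrite -!EFinD !lee_fin => h _ _ x0 _ _; congr EFin; apply/eqP.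
  by rewrite eq_le x0 andbT; lra.
have I20' : (\int[P1]_(y in D) `|(e2 y)%:E| = 0)%E.
  by rewrite -[RHS]I20; apply: eq_integral => y _; rewrite gee0_abs// lee_fin.
have := (ae_eq_integral_abs P1 mD me2D).1 I20'.
apply: filterS => y h Dy; have := h Dy => -[/eqP].
rewrite mulf_eq0 gt_eqF//= enorm_sqr psumr_eq0 => [/allP h'|i _]; last exact: sqr_ge0.
apply/rowP => i; have := h' i; rewrite mem_index_enum => /(_ isT).
by rewrite !mxE sqrf_eq0 subr_eq0 => /eqP.
Qed.

(** The comparison of couplings ran over y ~ P1, whereas the sample p(j) is drawn from P0; this set
    states the matching on the side of P0. *)
Definition matched_start : set (borel V) :=
  [set p | [/\ simplex (p : V), good_endpoint phi (T p : V) &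
     matched_price phi (T p : V) = p]].

Lemma matched_start_full : measurable matched_start /\ P0 matched_start = 1%E.
Proof.
have E : matched_start = S `&` [set p | good (T' p) /\ pm (T' p) = p].
  have T'E p : S p -> T' p = T p by move=> sp; rewrite /T' mem_set.
  have pmE y : good y -> pm y = matched_price phi y by move=> gy; rewrite /pm mem_set.
  apply/seteqP; split=> p.
    move=> [sp gT e]; split; first exact: sp.
    by rewrite /= (T'E _ sp); split; [exact: gT|rewrite (pmE _ gT)].
  move=> [sp]; rewrite /= (T'E _ sp) => -[gT]; rewrite (pmE _ gT) => e.
  by split.
have mE : measurable matched_start.
  rewrite E (_ : [set p | _] = T' @^-1` good `&`
     \bigcap_(i in [set: 'I_n]) [set p : borel V | (pm (T' p) : V) 0 i = (p : V) 0 i]).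
    apply: measurableI => //; apply: measurableI.
      by rewrite -[X in measurable X]setTI; exact: mT' measurable_good_endpoint.
    apply: fin_bigcap_measurable => // i _.
    rewrite -[X in measurable X]setTI.
    have := @measurable_fun_eqr _ _ R setT
      (fun p : borel V => (pm (T' p) : V) 0 i) (fun p : borel V => (p : V) 0 i)
      (measurableT_comp (measurable_coord i) (measurableT_comp mpm mT'))
      (measurable_coord i) measurableT [set true] I.
    by congr measurable; apply/seteqP; split=> p [_ /= /eqP].
  apply/seteqP; split=> p [gT].
    by move=> e; split=> // i _; rewrite /= e.
  by move=> h; split=> //; apply/rowP => i; exact: h.
(* The map [pm] carries P1 to P0, and for almost every y one has T (pm y) = y, so that [pm y]
   belongs to the set. *)
split=> //; rewrite -pm_law//.
have mpE : measurable (pm @^-1` matched_start).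
  by rewrite -[X in measurable X]setTI; exact: mpm.
apply/eqP; rewrite eq_le probability_le1//=.
rewrite -PD; have [N [mN N0 DN]] := matched_endpoint_ae.
apply: (@le_trans _ _ (P1 (pm @^-1` matched_start `|` N))).
  apply: le_measure; rewrite ?inE//; first exact: measurableU.
  move=> y Dy; have [Ny|Ny] := pselect (N y); [by right|left].
  have qy : qm y = y.
    by apply: contrapT => h; apply: Ny; apply: DN => /(_ Dy).
  rewrite /preimage/= E; split; first exact: pm_simplex.
  by rewrite /= -/(qm y) qy; split=> //; exact: Dy.1.
apply: (@le_trans _ _ (P1 (pm @^-1` matched_start) + P1 N)%E).
  exact: measureU2.
by rewrite (N0 : P1 N = 0%E) adde0.
Qed.

End OptimalMap.

(** * The Gibbs form of the matching weights *)

Section GibbsMatching.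
Context (R : realType) (m : nat).
Local Notation n := m.+2.
Local Notation V := 'rV[R]_n.

(** Matched points share a grid cell and cost at most n / (l + 1)^2; each of the others costs at
    most n, and [matching_exists] counts them through the cell counts. *)
Lemma matching_cost (N l : nat) (y q : nat -> V) :
  (forall j, simplex (y j)) -> (forall j, simplex (q j)) ->
  exists s : 'S_N,
  \sum_(j < N) enorm (q (s j) - y j) ^+ 2 <=
  N%:R * (n%:R / l.+1%:R ^+ 2) +
  n%:R * \sum_c `|\sum_(j < N) ((grid l (y j) == c)%:R : R) -
                  \sum_(j < N) ((grid l (q j) == c)%:R : R)|.
Proof.
move=> sy sq.
have [s hs] := matching_exists (fun j : 'I_N => grid l (y j)) (fun j : 'I_N => grid l (q j)).
exists s.
have b j : enorm (q (s j) - y j) ^+ 2 <=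
    n%:R / l.+1%:R ^+ 2 + n%:R * (grid l (y j) != grid l (q (s j)))%:R.
  have [e|e] := eqVneq (grid l (y j)) (grid l (q (s j))); last first.
    rewrite mulr1 (le_trans (enorm_sqr_simplex_le (sq _) (sy _)))// lerDr.
    by rewrite divr_ge0 ?sqr_ge0.
  rewrite mulr0 addr0 enorm_sqr.
  have -> : n%:R / l.+1%:R ^+ 2 = \sum_(i < n) (l.+1%:R^-1 : R) ^+ 2.
    by rewrite sumr_const card_ord exprVn mulr_natl.
  apply: ler_sum => i _; rewrite !mxE -real_normK ?num_real//.
  rewrite lerXn2r ?nnegrE ?invr_ge0//.
  exact: (grid_close (simplex_itv i (sq _)) (simplex_itv i (sy _)) (esym e)).
rewrite (le_trans (ler_sum _ (fun j _ => b j)))// big_split/= sumr_const card_ord.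
rewrite -(mulr_natl (n%:R / l.+1%:R ^+ 2) N) lerD2l -mulr_sumr ler_wpM2l//.
have -> : \sum_(j < N) (grid l (y j) != grid l (q (s j)))%:R =
    #|[set j : 'I_N | grid l (y j) != grid l (q (s j))]%SET|%:R :> R.
  rewrite -sum1_card natr_sum [RHS]big_mkcond/=; apply: eq_bigr => j _.
  by rewrite inE; case: (_ != _).
apply: (@le_trans _ _ (\sum_c ((#|[set j : 'I_N | grid l (y j) == c]%SET| -
    #|[set j : 'I_N | grid l (q j) == c]%SET|)%N%:R : R))).
  by rewrite -natr_sum ler_nat.
apply: ler_sum => c _.
have E (x : nat -> V) : \sum_(j < N) ((grid l (x j) == c)%:R : R) =
    #|[set j : 'I_N | grid l (x j) == c]%SET|%:R.
  rewrite -sum1_card natr_sum [RHS]big_mkcond/=; apply: eq_bigr => j _.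
  by rewrite inE; case: (_ == _).
rewrite !E; set a := #|_|; set a' := #|_|.
have [aa'|aa'] := leqP a a'; first by rewrite (eqP (aa' : (a - a' == 0)%N)) normr_ge0.
by rewrite natrB ?(ltnW aa')// ler_norm.
Qed.

Lemma matching_cost_eventually (y q : nat -> V) (e : R) :
  (forall j, simplex (y j)) -> (forall j, simplex (q j)) -> 0 < e ->
  (forall l c, exists a : R,
    (fun N : nat => (\sum_(j < N) ((grid l (y j) == c)%:R : R)) / N%:R) @ \oo --> a /\
    (fun N : nat => (\sum_(j < N) ((grid l (q j) == c)%:R : R)) / N%:R) @ \oo --> a) ->
  \forall N \near \oo, exists s : 'S_N,
    \sum_(j < N) enorm (q (s j) - y j) ^+ 2 <= e * N%:R.
Proof.
move=> sy sq e0 hf.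
have n0 : 0 < n%:R :> R by rewrite ltr0n.
have e20 : 0 < e / 2 / n%:R by rewrite !divr_gt0.
have [l _ /(_ l (leqnn l))/= le2] := near_infty_natSinv_lt (PosNum e20).
pose C := {ffun 'I_n * 'I_l.+2 -> bool}.
have c0 : (fun N : nat => \sum_(c : C) `|(\sum_(j < N) ((grid l (y j) == c)%:R : R)) / N%:R -
    (\sum_(j < N) ((grid l (q j) == c)%:R : R)) / N%:R|) @ \oo --> \sum_(c : C) (0 : R).
  apply: cvg_sumr => c; have [a [ya qa]] := hf l c.
  by have := cvg_norm (cvgB ya qa); rewrite subrr normr0; apply.
rewrite big1// in c0.
have := c0 => /cvgrPdist_le/(_ _ e20); apply: filterS => N.
have [->|N0] := posnP N.
  by move=> _; exists 1%g; rewrite big_ord0 mulr0.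
have N0' : 0 < N%:R :> R by rewrite ltr0n.
rewrite sub0r normrN ger0_norm ?sumr_ge0// => hN.
have [s hs] := matching_cost N l sy sq; exists s.
apply: (le_trans hs).
have -> : e * N%:R = N%:R * (e / 2) + e / 2 * N%:R by lra.
apply: lerD.
  rewrite ler_wpM2l// -ler_pdivlMl// mulrC.
  have l0 : 0 < l.+1%:R^-1 :> R by rewrite invr_gt0.
  have l1 : l.+1%:R^-1 <= 1 :> R by rewrite invf_le1// ler1n.
  rewrite -exprVn; apply: le_trans (ltW le2).
  by rewrite expr2 ler_piMl// ltW.
rewrite -ler_pdivlMl// [leRHS](_ : _ = (e / 2 / n%:R) * N%:R); last first.
  by field; rewrite gt_eqF.
rewrite -ler_pdivrMr// mulr_suml.
apply: le_trans hN; apply: ler_sum => c _.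
by rewrite -mulrBl normrM normfV (ger0_norm (ltW N0')).
Qed.

Context (phi : V -> R).
Hypothesis conc : exp_concave phi.
Hypothesis der : forall v, tangent v -> forall p, simplex p -> derivable phi p v.

Lemma nu_weight_gibbs (lambda : R) (N : nat) (p q y : nat -> V) (s : 'S_N) :
  0 < Gamma lambda -> 0 < Gamma (lambda / n%:R) ->
  (forall j, good_endpoint phi (y j)) -> (forall j, p j = matched_price phi (y j)) ->
  (forall j, simplex (q j)) ->
  nu_weight lambda p q s =
  expR (- lambda * \sum_(j < N) L_div phi (q (s j)) (y j)) /
  \sum_(r : 'S_N) expR (- lambda * \sum_(j < N) L_div phi (q (r j)) (y j)).
Proof.
move=> G1 G2 gy py sq.
have /choice[v hv] : forall j : nat, exists a : R, forall x, simplex x ->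
    cost (p j) x = L_div phi x (y j) + endpoint_potential phi x + a.
  by move=> j; rewrite py; exact: cost_matched_price.
have sp j : simplex (p j) by rewrite py; exact: matched_price_simplex.
pose K := Gamma lambda / Gamma (lambda / n%:R) ^+ n * expR (- lambda * ln n%:R).
have K0 : 0 < K by rewrite mulr_gt0 ?expR_gt0// divr_gt0// exprn_gt0.
pose h (x : V) := (\prod_i x 0 i)^-1 * expR (- lambda * endpoint_potential phi x).
(* The factors that involve p(j) alone or q alone; the product of the [h (q j)] is invariant under
   reindexing by a permutation. *)
pose C := (\prod_(j < N) (K * expR (- lambda * v j))) * \prod_(j < N) h (q j).
have C0 : C != 0.
  rewrite mulf_neq0//; apply/prodf_neq0 => j _; rewrite mulf_neq0 ?gt_eqF ?expR_gt0//.
  by rewrite invr_gt0 prodr_gt0// => i _; exact: simplex_gt0.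
have E (r : 'S_N) : \prod_(j < N) f_density lambda (q (r j)) (p j) =
    C * expR (- lambda * \sum_(j < N) L_div phi (q (r j)) (y j)).
  have hr : \prod_(j < N) h (q j) = \prod_(j < N) h (q (r j)).
    by rewrite [LHS](reindex_inj (@perm_inj _ r)).
  rewrite mulr_sumr expR_sum /C hr -!big_split/=; apply: eq_bigr => j _.
  rewrite f_densityE// hv// /h -/K.
  have -> : - lambda * (L_div phi (q (r j)) (y j) + endpoint_potential phi (q (r j)) + v j) =
    - lambda * v j + - lambda * endpoint_potential phi (q (r j)) +
    - lambda * L_div phi (q (r j)) (y j) by ring.
  by rewrite !expRD; ring.
rewrite /nu_weight E; under [X in _ / X]eq_bigr do rewrite E.
by rewrite -mulr_sumr invfM mulrACA mulfV// mul1r.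
Qed.

Lemma nu_weight_distribution (lambda : R) (N : nat) (p q y : nat -> V) :
  0 < Gamma lambda -> 0 < Gamma (lambda / n%:R) ->
  (forall j, good_endpoint phi (y j)) -> (forall j, p j = matched_price phi (y j)) ->
  (forall j, simplex (q j)) ->
  (forall s : 'S_N, 0 <= nu_weight lambda p q s) /\
  \sum_(s : 'S_N) nu_weight lambda p q s = 1.
Proof.
move=> G1 G2 gy py sq.
have E (s : 'S_N) := nu_weight_gibbs s G1 G2 gy py sq.
split=> [s|]; first by rewrite E divr_ge0 ?expR_ge0// sumr_ge0// => r _; exact: expR_ge0.
under eq_bigr do rewrite E; rewrite -mulr_suml mulfV// gt_eqF//.
by rewrite (bigD1 (1%g : 'S_N))//= ltr_pwDl ?expR_gt0// sumr_ge0// => r _; exact: expR_ge0.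
Qed.

(** The lower constant alpha converts mean energy into mean square distance, the upper constant
    alpha' bounds the energy of the reference matching [s0], and ln(N!) <= N ln N bounds the
    entropy. *)
Lemma nu_weight_mean_square (alpha alpha' lambda : R) (N : nat) (p q y : nat -> V)
    (s0 : 'S_N) :
  0 < alpha -> 0 <= alpha' -> 0 < lambda ->
  0 < Gamma lambda -> 0 < Gamma (lambda / n%:R) ->
  (forall x x' : V, simplex x -> simplex x' ->
     alpha * enorm (x' - x) ^+ 2 <= L_div phi x' x <= alpha' * enorm (x' - x) ^+ 2) ->
  (forall j, good_endpoint phi (y j)) -> (forall j, p j = matched_price phi (y j)) ->
  (forall j, simplex (q j)) ->
  \sum_(s : 'S_N) nu_weight lambda p q s *
     \sum_(j < N) enorm (q (s j) - y j) ^+ 2 <=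
  alpha^-1 * (alpha' * \sum_(j < N) enorm (q (s0 j) - y j) ^+ 2 +
    N%:R * ln N%:R / lambda).
Proof.
move=> a0 a'0 l0 G1 G2 hL gy py sq.
have sy j : simplex (y j) by exact: (gy j).1.
pose E (s : 'S_N) := \sum_(j < N) L_div phi (q (s j)) (y j).
have nuE (s : 'S_N) := nu_weight_gibbs s G1 G2 gy py sq.
have := gibbs_average_le s0 l0 nuE; rewrite -/(E s0) => gibbs.
have [nu0 _] := nu_weight_distribution N G1 G2 gy py sq.
rewrite -ler_pdivrMl ?invr_gt0// invrK mulr_sumr.
apply: (@le_trans _ _ (\sum_(s : 'S_N) nu_weight lambda p q s * E s)).
  apply: ler_sum => s _; rewrite mulrCA ler_wpM2l// mulr_sumr ler_sum// => j _.
  by have /andP[] := hL _ _ (sy j) (sq (s j)).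
apply: (le_trans gibbs); apply: lerD.
  rewrite mulr_sumr; apply: ler_sum => j _.
  by have /andP[] := hL _ _ (sy j) (sq (s0 j)).
rewrite ler_wpM2r ?invr_ge0 ?(ltW l0)//.
by have := ln_fact_le R N; rewrite -card_Sn.
Qed.

End GibbsMatching.

(** * Weak convergence *)

Section Colours.
Context d (T : measurableType d) (R : realType) (P : probability T R).
Context (D : set T) (C : finType) (col : T -> C).
Hypotheses (mD : measurable D)
  (mcol : forall c, measurable (D `&` [set z | col z = c])).

Lemma measurable_colour (A : pred C) : measurable (D `&` [set z | A (col z)]).
Proof.
rewrite (_ : _ `&` _ = \bigcup_(c in [set c | A c]) (D `&` [set z | col z = c])).
  exact: fin_bigcup_measurable.
by apply/seteqP; split=> [z [Dz Az]|z [c Ac [Dz /= zc]]]; [exists (col z)|rewrite /= zc].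
Qed.

Lemma integrable_colour (v : C -> R) : P.-integrable D (EFin \o (v \o col)).
Proof.
apply: measurable_bounded_integrable => //.
- by rewrite ltey_eq fin_num_measure.
- move=> _ B mB; have := measurable_colour [pred c | v c \in B].
  by congr measurable; apply/seteqP; split=> z [Dz] /=; rewrite ?inE.
- exists (\sum_c `|v c|); split; first exact: num_real.
  move=> M hM z _; apply: (le_trans _ (ltW hM)).
  by rewrite /= (bigD1 (col z))//= lerDl sumr_ge0.
Qed.

Lemma Rintegral_colour (v : C -> R) :
  (\int[P]_(z in D) v (col z))%R =
  \sum_c v c * fine (P (D `&` [set z | col z = c])).
Proof.
rewrite /Rintegral (@eq_integral _ _ _ _ _
   (fun z => (\sum_c (v c * \1_(D `&` [set z | col z = c]) z)%:E)%E)); last first.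
  move=> z /[!inE] Dz; rewrite sumEFin (bigD1 (col z))//= big1 => [|c cz].
    by rewrite indicE mem_set// mulr1 addr0.
  by rewrite indicE memNset ?mulr0// => -[_ /= e]; rewrite e eqxx in cz.
have ic c : P.-integrable D (fun z => (\1_(D `&` [set z | col z = c]) z : R)%:E).
  by apply: integrableS (integrable_indic P (mcol c)).
rewrite integral_sum//; last first.
  move=> c; rewrite (_ : (fun _ => _) = (fun z => (v c)%:E *
     (\1_(D `&` [set z | col z = c]) z)%:E)%E); first exact: integrableZl.
  by apply/funext => z; rewrite EFinM.
have I c : (\int[P]_(z in D) (v c * \1_(D `&` [set z | col z = c]) z)%:E =
    (v c * fine (P (D `&` [set z | col z = c])))%:E)%E.
  under eq_integral do rewrite EFinM.
  rewrite integralZl// integral_indic// setIAC setIid EFinM fineK//.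
  by rewrite fin_num_measure.
by rewrite (eq_bigr _ (fun c _ => I c)) sumEFin.
Qed.

Lemma colour_mass (A : pred C) :
  \sum_c (A c)%:R * fine (P (D `&` [set z | col z = c])) =
  fine (P (D `&` [set z | A (col z)])).
Proof.
rewrite -Rintegral_colour /Rintegral.
rewrite (@eq_integral _ _ _ _ _ (fun z => (\1_(D `&` [set z | A (col z)]) z)%:E)).
  rewrite integral_indic//; last exact: measurable_colour.
  by rewrite setIAC setIid.
move=> z /[!inE] Dz; rewrite indicE; case Az : (A (col z)).
  by rewrite mem_set.
by rewrite memNset// => -[_ /=]; rewrite Az.
Qed.

(** The approximation is expressed by cell masses alone, which are the limits of empirical
    frequencies. *)
Lemma Rintegral_colour_close (G : T -> R) (v k : C -> R) :
  P.-integrable D (EFin \o G) ->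
  (forall z, D z -> `|G z - v (col z)| <= k (col z)) ->
  `|(\int[P]_(z in D) G z)%R - \sum_c v c * fine (P (D `&` [set z | col z = c]))| <=
  \sum_c k c * fine (P (D `&` [set z | col z = c])).
Proof.
move=> iG Gv; rewrite -!Rintegral_colour -RintegralB//; last exact: integrable_colour.
have iB : P.-integrable D (EFin \o (fun z => G z - v (col z))).
  rewrite (_ : _ \o _ = (EFin \o G) \- (EFin \o (v \o col)))%E.
    by apply: integrableB => //; exact: integrable_colour.
  by apply/funext => z /=; rewrite EFinB.
apply: (le_trans (le_normr_Rintegral mD iB)).
apply: le_Rintegral => //; first exact: integrable_norm.
exact: (integrable_colour k).
Qed.

End Colours.

(** The integrand's measure is a bare set function, so it is first identified with an [msum] of
    scaled Dirac masses, indexed through [enum I]. A signed [F] is then split into its positive and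
    negative parts. *)
Lemma integral_sum_dirac d (T : measurableType d) (R : realType) (I : finType)
    (w : I -> R) (x : I -> T) (F : T -> R) :
  (0 < #|I|)%N -> (forall i, 0 <= w i) -> measurable_fun setT F ->
  (\int[fun A => \sum_i (w i)%:E * \d_(x i) A]_y (F y)%:E = (\sum_i w i * F (x i))%:E)%E.
Proof.
move=> I0 w0 mF.
have [i0 _] := card_gt0P I0.
pose m_ k := mscale (NngNum (w0 (nth i0 (enum I) k))) \d_(x (nth i0 (enum I) k)).
have E (h : I -> \bar R) : (\sum_i h i = \sum_(k < size (enum I)) h (nth i0 (enum I) k))%E.
  by rewrite -big_enum/= (big_nth i0) big_mkord.
rewrite (_ : (fun A => _) = msum m_ (size (enum I))); last first.
  by apply/funext => A; rewrite E /msum; apply: eq_bigr => k _.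
have ge0_int (f : T -> \bar R) : measurable_fun setT f -> (forall y, (0 <= f y)%E) ->
    (\int[msum m_ (size (enum I))]_y f y = \sum_i (w i)%:E * f (x i))%E.
  move=> mf f0; rewrite ge0_integral_measure_sum// E; apply: eq_bigr => k _.
  by rewrite ge0_integral_mscale// integral_dirac// diracT mul1e.
have mE : measurable_fun setT (EFin \o F) by exact/measurable_EFinP.
rewrite integralE !ge0_int//; [|exact: measurable_funeneg|exact: measurable_funepos].
have P (i : I) : ((EFin \o F)^\+ (x i) = (Num.max (F (x i)) 0)%:E)%E
  by rewrite funeposE /= EFin_max.
have N (i : I) : ((EFin \o F)^\- (x i) = (Num.max (- F (x i)) 0)%:E)%E
  by rewrite funenegE /= EFin_max.
under eq_bigr do rewrite P -EFinM.
under [X in (_ - X)%E]eq_bigr do rewrite N -EFinM.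
rewrite !sumEFin -EFinB -sumrB; congr EFin; apply: eq_bigr => i _.
rewrite -mulrBr; congr (_ * _); case: (leP (F (x i)) 0) => h.
  by rewrite max_l ?oppr_ge0// sub0r opprK.
by rewrite max_r ?subr0// oppr_le0 ltW.
Qed.

(** [f] is meaningful on [D] only; it is extended by the value at a point of [D], which turns the
    set function into an honest pushforward. *)
Lemma integral_image_on d d' (T : measurableType d) (U : measurableType d')
    (R : realType) (P : probability T R) (D : set T) (f : T -> U) (F : U -> R) :
  measurable D -> P D = 1%E -> measurable_fun D f -> measurable_fun setT F ->
  (exists M, forall y, `|F y| <= M) ->
  (\int[image_on D P f]_y (F y)%:E = \int[P]_(z in D) (F (f z))%:E)%E.
Proof.
move=> mD PD mf mF [M FM].
have [z0 Dz0] : D !=set0.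
  by apply/set0P/eqP => D0; have := PD; rewrite D0 measure0 => /esym/eqP; rewrite onee_eq0.
pose f' t := if t \in D then f t else f z0.
have mf' : measurable_fun setT f' by exact: measurable_fun_extend.
have f'E t : D t -> f' t = f t by move=> Dt; rewrite /f' mem_set.
have QE : (\int[image_on D P f]_y (F y)%:E = \int[pushforward (mrestr P mD) f']_y (F y)%:E)%E.
  congr (integral _ _ _); apply/funext => A; rewrite /pushforward /mrestr /image_on setIC.
  by congr (P _); apply/seteqP; split=> z [Az Dz]; split=> //; move: Az; rewrite /preimage /= f'E.
rewrite QE (@eq_measure_integral _ _ _ _ (pushforward P f'))//; last first.
  move=> A mA _; rewrite /= /pushforward /mrestr setIC.
  apply: probability_setI_full => //.
  by rewrite -[X in measurable X]setTI; exact: mf'.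
have mE : measurable_fun setT (EFin \o F) by exact/measurable_EFinP.
have iF : P.-integrable setT ((EFin \o F) \o f').
  apply: measurable_bounded_integrable => //.
  - by rewrite ltey_eq fin_num_measure.
  - exact: measurableT_comp.
  - exists M; split; first exact: num_real.
    by move=> x Mx z _; exact: (le_trans (FM _) (ltW Mx)).
rewrite (integral_pushforward mf' mE iF measurableT) preimage_setT.
rewrite (negligible_integral (measurableC mD) measurableT iF); last first.
  by have := probability_setC P mD; rewrite PD subee.
rewrite setTD setCK; apply: eq_integral => z /[!inE] Dz /=.
by rewrite f'E.
Qed.

Section PathIntegrals.
Context (R : realType) (m : nat).
Local Notation n := m.+2.
Local Notation V := 'rV[R]_n.
Local Notation D := (skorokhod R m).

Lemma measurable_continuous_functional (F : D -> R) : continuous F ->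
  measurable_fun setT (F : borel D -> R).
Proof.
move=> /continuousP cF _.
apply: (measurability _ (RGenOpens.measurableE R)) => //.
move=> _ [_ [a [b ->] <-]]; rewrite setTI; apply: sub_sigma_algebra.
by apply: cF; exact: interval_open.
Qed.

(** By [bridge_close] the displacement path depends continuously on its endpoints, so preimages of
    open sets are relatively open, hence product measurable. *)
Lemma measurable_displacement :
  measurable_fun (simplex `*` simplex : set (borel V * borel V))
    (@displacement R m : borel V * borel V -> borel D).
Proof.
move=> mD; apply: (@measurability _ _ _ (borel D) _ _ (@open D)) => //.
move=> _ [U oU <-]; apply: measurable_open_simplex2; first by move=> z [].
move=> z [[s1 s2] Uz].
have [e e0 eU] := (oU : skorokhod_open U) _ Uz.
have [r /andP[r0 r1] hr] := bridge_close s1 s2 (divr_gt0 e0 (ltr0n R 2)).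
exists r => // z' s1' s2' h1 h2; split; first by split.
apply: eU; apply: (@le_lt_trans _ _ (e / 2)); last by rewrite ltr_pdivrMr// ltr_pMr// ltr1n.
apply: skorokhod_dist_le; first by rewrite ltW// divr_gt0.
move=> t; rewrite in_itv/= => t01 i; rewrite !displacementE//.
apply: hr => // j; first by case/andP: t01.
by rewrite subrr normr0 ltW.
Qed.

Lemma integral_M_random (lambda : R) (N : nat) (p q : nat -> V)
    (g : nat -> 'I_n -> R -> R) (F : D -> R) :
  (0 < N)%N -> (forall s : 'S_N, 0 <= nu_weight lambda p q s) -> continuous F ->
  (\int[M_random lambda N p q g]_(x in [set: borel D]) (F x)%:E)%E =
  (\sum_(s : 'S_N) nu_weight lambda p q s *
     ((\sum_(j < N) F (path_of (gamma_bridge lambda (g j) (p j) (q (s j))))) / N%:R))%:E.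
Proof.
move=> N0 nu0 cF.
pose w (sj : 'S_N * 'I_N) := nu_weight lambda p q sj.1 * N%:R^-1.
pose x (sj : 'S_N * 'I_N) : borel D :=
  path_of (gamma_bridge lambda (g sj.2) (p sj.2) (q (sj.1 sj.2))).
have -> : M_random lambda N p q g = (fun A => \sum_sj (w sj)%:E * \d_(x sj) A)%E.
  apply/funext => A; rewrite /M_random.
  rewrite -(pair_bigA _ (fun s j => (w (s, j))%:E * \d_(x (s, j)) A)%E)/=.
  apply: eq_bigr => s _; rewrite /M_perm muleA -EFinM ge0_sume_distrr//.
rewrite integral_sum_dirac//.
- congr EFin; rewrite -(pair_bigA _ (fun s j => w (s, j) * F (x (s, j))))/=.
  apply: eq_bigr => s _; rewrite mulr_suml mulr_sumr; apply: eq_bigr => j _.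
  by rewrite /w /x/= -mulrA; congr (_ * _); rewrite mulrC.
- by apply/card_gt0P; exists (1%g, Ordinal N0).
- by move=> sj; rewrite mulr_ge0.
- exact: measurable_continuous_functional.
Qed.

End PathIntegrals.

(** * Path averages for a fixed outcome, by discretizing the endpoints *)

Section Cells.
Context (R : realType) (m : nat).
Local Notation n := m.+2.
Local Notation V := 'rV[R]_n.
Local Notation D := (skorokhod R m).
Context (F : D -> R).
Hypothesis cF : continuous F.

Local Notation colour l :=
  ({ffun 'I_n * 'I_l.+2 -> bool} * {ffun 'I_n * 'I_l.+2 -> bool})%type.

Definition grid2 l (z : V * V) : colour l := (grid l z.1, grid l z.2).

(* F is within eta of v along every admissible path whose starting point p and
   unperturbed endpoint y lie in the cells c. *)
Definition cell_value (eta : R) l (c : colour l) (v : R) :=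
  forall p y q : V, simplex p -> simplex y -> simplex q -> grid2 l (p, y) = c ->
    (forall i, `|y 0 i - q 0 i| < l.+1%:R^-1) ->
    `|F (displacement (p, y)) - v| <= eta /\
    forall (lambda : R) (g : 'I_n -> R -> R),
      cadlag (fun t => gamma_bridge lambda g p q (clamp t)) ->
      (forall i t, 0 <= t <= 1 -> 0 <= g i (t * lambda) / g i lambda) ->
      (forall i t, 0 <= t <= 1 -> `|g i (t * lambda) / g i lambda - t| <= l.+2%:R^-1) ->
      `|F (path_of (gamma_bridge lambda g p q)) - v| <= eta.

(** The level from which this holds depends on [z], as [F] is only pointwise continuous. Half of the
    radius is spent inside the cell, half on the distance from y to q. *)
Lemma cell_value_eventually (eta : R) (z : V * V) :
  0 < eta -> simplex z.1 -> simplex z.2 ->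
  \forall l \near \oo, cell_value eta (grid2 l z) (F (displacement z)).
Proof.
move=> eta0 s1 s2.
have [r /andP[r0 r1] hr] := continuous_functional_bridge cF eta0 s1 s2.
have r20 : 0 < r / 2 by rewrite divr_gt0.
have := near_infty_natSinv_lt (PosNum r20); apply: filterS => l /= lr p y q sp sy sq [gp gy] yq.
have close x x' : simplex x -> simplex x' -> grid l x = grid l x' ->
    forall i, `|x' 0 i - x 0 i| < r / 2.
  move=> sx sx' xx' i; rewrite distrC; apply: le_lt_trans lr.
  exact: (grid_close (simplex_itv i sx) (simplex_itv i sx')).
have rr : r / 2 < r by rewrite ltr_pdivrMr// ltr_pMr// ltr1n.
have lr2 : l.+2%:R^-1 <= r.
  apply: le_trans (ltW rr); apply: le_trans (ltW lr).
  by rewrite lef_pV2 ?posrE ?ltr0n// ler_nat.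
have hp i : `|z.1 0 i - p 0 i| < r by apply: lt_trans rr; exact: close.
have hy i : `|z.2 0 i - y 0 i| < r by apply: lt_trans rr; exact: close.
have hq i : `|z.2 0 i - q 0 i| < r.
  apply: (le_lt_trans (ler_distD (y 0 i) _ _)); rewrite (splitr r) ltrD//.
    exact: close.
  exact: lt_trans (yq i) lr.
split; first by rewrite distrC; have [] := hr p y sp sy hp hy.
move=> lambda g cg g0 gl; rewrite distrC.
have [_ ->//] := hr p q sp sq hp hq.
by move=> i t t01; apply: le_trans lr2; exact: gl.
Qed.

Let S2 := (simplex `*` simplex) : set (borel V * borel V).

Lemma measurable_grid2_cell l (c : colour l) :
  measurable (S2 `&` [set z | grid2 l z = c]).
Proof.
have mS2 : measurable S2 by apply: measurableX; exact: measurable_simplex.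
rewrite (_ : _ `&` _ = (S2 `&` [set z | grid l (z.1 : V) = c.1]) `&`
    (S2 `&` [set z | grid l (z.2 : V) = c.2])); last first.
  apply/seteqP; split=> z; first by move=> [Sz /= <-].
  by move=> [[Sz e1] [_ e2]]; split=> //=; rewrite /grid2 e1 e2 -surjective_pairing.
apply: measurableI; apply: measurable_grid => // i; apply: measurable_funTS.
  exact: (measurableT_comp (measurable_coord i) measurable_fst).
exact: (measurableT_comp (measurable_coord i) measurable_snd).
Qed.

(** A value is attached to each cell, bounded by [M] in all cases, and admissible as soon as some
    bounded value is. *)
Lemma cell_values (eta M : R) l : 0 <= M -> (forall x, `|F x| <= M) ->
  exists v : colour l -> R,
  (forall c, `|v c| <= M) /\
  (forall c u, `|u| <= M -> cell_value eta c u -> cell_value eta c (v c)).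
Proof.
move=> M0 FM.
have /choice[v hv] : forall c : colour l, exists v, `|v| <= M /\
    (forall u, `|u| <= M -> cell_value eta c u -> cell_value eta c v).
  move=> c; have [[v [vM vc]]|h] := pselect (exists v, `|v| <= M /\ cell_value eta c v).
    by exists v; split.
  exists 0; split; first by rewrite normr0.
  by move=> u uM uc; exfalso; apply: h; exists u.
by exists v; split=> c; [have [] := hv c|have [_] := hv c].
Qed.

(** The sets [B l], of points whose cells are good at all levels from [l] on, increase to the square
    of the simplex; continuity from below yields one level at which the bad cells have small
    mass. *)
Lemma cell_values_full (J : probability (borel V * borel V)%type R) (eta M : R) :
  0 < eta -> 0 <= M -> (forall x, `|F x| <= M) -> J S2 = 1%E ->
  exists l (v : colour l -> R), (forall c, `|v c| <= M) /\
    \sum_c (~~ `[< cell_value eta c (v c) >])%:R *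
       fine (J (S2 `&` [set z | grid2 l z = c])) <= eta.
Proof.
move=> eta0 M0 FM JS2.
pose v l := projT1 (cid (cell_values eta l M0 FM)).
have hv l : (forall c, `|v l c| <= M) /\
  (forall c u, `|u| <= M -> cell_value eta c u -> cell_value eta c (v l c)).
  exact: projT2 (cid (cell_values eta l M0 FM)).
have mS2 : measurable S2 by apply: measurableX; exact: measurable_simplex.
pose W l := S2 `&` [set z | `[< cell_value eta (grid2 l z) (v l (grid2 l z)) >]].
have mW l : measurable (W l).
  have := measurable_colour (@measurable_grid2_cell l)
    [pred c | `[< cell_value eta c (v l c) >]].
  exact.
pose B l := \bigcap_(k in [set k | (l <= k)%N]) W k.
have mB l : measurable (B l) by apply: bigcap_measurable => //; exists l => /=.
have UB : \bigcup_l B l = S2.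
  apply/seteqP; split=> [z [l _ /(_ l (leqnn l))[]]//|z [s1 s2]].
  have [l _ hl] := cell_value_eventually eta0 s1 s2.
  exists l => // k lk; split; first by split.
  by apply/asboolP; have [_] := hv k; apply => //; exact: hl.
have ndB : nondecreasing_seq B.
  move=> l k lk; apply/subsetPset => z Bz j /= kj; apply: Bz => /=.
  exact: leq_trans lk kj.
have mUB : measurable (\bigcup_l B l) by exact: bigcup_measurable.
have cB : J (B l) @[l --> \oo] --> 1%E.
  by rewrite -JS2 -UB; exact: nondecreasing_cvg_mu.
have /fine_cvgP[_ /cvgrPdist_le/(_ _ eta0)[l _ /(_ l (leqnn l))/= hB]] := cB.
exists l, (v l); split; first by have [] := hv l.
have -> := colour_mass J mS2 (@measurable_grid2_cell l)
   [pred c | ~~ `[< cell_value eta c (v l c) >]].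
have mBad := measurable_colour (@measurable_grid2_cell l)
   [pred c | ~~ `[< cell_value eta c (v l c) >]].
apply: le_trans hB; apply: le_trans (ler_norm _).
have -> : 1 - fine (J (B l)) = fine (J (~` B l)).
  have -> : J (~` B l) = (1 - J (B l))%E by exact: probability_setC.
  by rewrite fineB// fin_num_measure.
rewrite fine_le ?fin_num_measure//; first exact: measurableC.
apply: le_measure; rewrite ?inE//; first exact: measurableC.
by move=> z [_ /= /negP h] /(_ l (leqnn l))[].
Qed.

(** Outside three kinds of failure the cell value is within [eta]; each failure (bad cell, bad
    subordinator, distant endpoint) is charged at most [2 * M]. *)
Lemma path_value_close (eta M lambda : R) l (v : colour l -> R) (p y q : V)
    (g : 'I_n -> R -> R) (b : bool) :
  0 < eta -> (forall x, `|F x| <= M) -> (forall c, `|v c| <= M) ->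
  simplex p -> simplex y -> simplex q -> 0 < lambda ->
  (forall i, subordinator_path (g i)) ->
  (~~ b -> forall i, 0 < g i lambda /\
     forall t, 0 <= t <= 1 -> `|g i (t * lambda) / g i lambda - t| <= l.+2%:R^-1) ->
  `|F (path_of (gamma_bridge lambda g p q)) - v (grid2 l (p, y))| <=
  eta + 2 * M * ((~~ `[< cell_value eta (grid2 l (p, y)) (v (grid2 l (p, y))) >])%:R +
                 b%:R + l.+1%:R ^+ 2 * enorm (q - y) ^+ 2).
Proof.
move=> eta0 FM vM sp sy sq l0 gP gb.
have M0 : 0 <= M by rewrite (le_trans _ (vM (grid2 l (p, y)))).
have M20 : 0 <= 2 * M by rewrite mulr_ge0.
have triv (x : R) : 1 <= x ->
    `|F (path_of (gamma_bridge lambda g p q)) - v (grid2 l (p, y))| <= eta + 2 * M * x.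
  move=> x1; apply: (@le_trans _ _ (2 * M)).
    by rewrite (le_trans (ler_normB _ _))// mulr_natl mulr2n lerD.
  by rewrite -[leLHS]mulr1 -[leLHS]add0r lerD ?(ltW eta0)// ler_wpM2l.
have d0 : 0 <= l.+1%:R ^+ 2 * enorm (q - y) ^+ 2 by rewrite mulr_ge0 ?sqr_ge0.
case: asboolP => [cv|_]; last first.
  by apply: triv; rewrite -addrA lerDl addr_ge0.
case: b gb => [_|/(_ isT) gb].
  by apply: triv; rewrite add0r lerDl.
rewrite !add0r.
have l10 : 0 < l.+1%:R :> R by rewrite ltr0n.
(* Markov's device: an endpoint off by 1 / (l + 1) in some coordinate makes (l + 1)^2 times the
   square distance at least 1. *)
have [yq|/existsNP[i /negP]] := pselect (forall i, `|y 0 i - q 0 i| < l.+1%:R^-1); last first.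
  rewrite -leNgt => yq; apply: triv.
  have h : (l.+1%:R^-1 : R) ^+ 2 <= enorm (q - y) ^+ 2.
    rewrite enorm_sqr (bigD1 i)//= (@le_trans _ _ ((q - y) 0 i ^+ 2))//.
      rewrite !mxE -(real_normK (num_real (q 0 i - y 0 i))) distrC.
      by rewrite lerXn2r ?nnegrE ?invr_ge0// ltW.
    by rewrite lerDl sumr_ge0// => k _; exact: sqr_ge0.
  apply: (@le_trans _ _ (l.+1%:R ^+ 2 * l.+1%:R^-1 ^+ 2)).
    by rewrite exprVn mulfV// gt_eqF// exprn_gt0.
  by rewrite ler_wpM2l// sqr_ge0.
have [_ h] := cv p y q sp sy sq erefl yq.
rewrite (le_trans (h lambda g _ _ _))//.
- apply: (@cadlag_gamma_bridge _ _ lambda l.+2%:R^-1) => //.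
  (* The tolerance is 1 / (l + 2) rather than 1 / (l + 1), so that it is below 1 also for l = 0. *)
  + by rewrite invf_lt1 ?ltr0n// ltr1n.
  + by move=> i; have [] := gb i.
  + by move=> i; have [] := gb i.
- move=> i t /andP[t0 t1]; have [g0 _] := gb i.
  rewrite divr_ge0 ?(ltW g0)//; apply: subordinator_path_ge0 => //.
  by rewrite mulr_ge0// ltW.
- by move=> i; have [] := gb i.
- by rewrite lerDl mulr_ge0.
Qed.

(** The deterministic core: the hypotheses on the sequences are the properties of one typical
    outcome, and none of them involves [F]. *)
Lemma path_average_cvg (J : probability (borel V * borel V)%type R) (M : R)
    (p y q : nat -> V) (g : nat -> 'I_n -> R -> R) (lambda : nat -> R)
    (nu : forall N, 'S_N -> R) :
  (forall x, `|F x| <= M) -> J S2 = 1%E ->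
  (forall j, simplex (p j)) -> (forall j, simplex (y j)) -> (forall j, simplex (q j)) ->
  (forall j i, subordinator_path (g j i)) ->
  (forall L, \forall N \near \oo, L <= lambda N) ->
  (\forall N \near \oo, (forall s, 0 <= nu N s) /\ \sum_s nu N s = 1) ->
  (forall e : R, 0 < e -> \forall N \near \oo,
    \sum_s nu N s * \sum_(j < N) enorm (q (s j) - y j) ^+ 2 <= e * N%:R) ->
  (forall l (c : colour l),
    (fun N : nat => (\sum_(j < N) ((grid2 l (p j, y j) == c)%:R : R)) / N%:R) @ \oo -->
    fine (J (S2 `&` [set z | grid2 l z = c]))) ->
  (forall e delta : R, 0 < e -> 0 < delta -> exists K (b : nat -> bool),
    (forall j, ~~ b j -> forall i k, (K <= k)%N ->
      `|g j i (k.+1 ^ 2)%N%:R - (k.+1 ^ 2)%N%:R| <= e * (k.+1 ^ 2)%N%:R) /\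
    \forall N \near \oo, \sum_(j < N) ((b j)%:R : R) <= delta * N%:R) ->
  (fun N => \sum_(s : 'S_N) nu N s *
     ((\sum_(j < N) F (path_of (gamma_bridge (lambda N) (g j) (p j) (q (s j))))) / N%:R))
  @ \oo --> (\int[J]_(z in S2) F (displacement z))%R.
Proof.
move=> FM JS2 sp sy sq gP lamy nuP msq freq gam.
have mS2 : measurable S2 by apply: measurableX; exact: measurable_simplex.
have M0 : 0 <= M by rewrite (le_trans _ (FM point)).
apply/cvgrPdist_le => eps eps0.
(* The error budget: the integral against its cell sum, twice [eta] for frequencies against masses,
   the cell errors along the sample, and [2 * M * eta] each for bad subordinators and distant
   endpoints add up to [4 * eta + 8 * (M * eta)]. *)
pose eta := eps / (4 + 8 * M).
have eta0 : 0 < eta by rewrite divr_gt0// ltr_pwDl// mulr_ge0.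
have arith (I A a b x z u t : R) : `|a - b| <= eta -> `|x - z| <= eta ->
    `|I - a| <= x -> `|A - b| <= z + u + t -> x <= eta + 2 * M * eta ->
    u <= 2 * M * eta -> t <= 2 * M * eta -> `|I - A| <= 4 * eta + 8 * (M * eta).
  rewrite !ler_norml.
  by do ![move=> /andP[? ?]]; move=> *; apply/andP; split; lra.
have [l [v [vM bad]]] := cell_values_full eta0 M0 FM JS2.
pose bd c : R := (~~ `[< cell_value eta c (v c) >])%:R.
pose mass c := fine (J (S2 `&` [set z | grid2 l z = c])).
have [e e0 he] : exists2 e : R, 0 < e & forall K : nat, exists2 L : R, 0 < L &
  forall g : R -> R, subordinator_path g ->
    (forall k, (K <= k)%N -> `|g (k.+1 ^ 2)%N%:R - (k.+1 ^ 2)%N%:R| <= e * (k.+1 ^ 2)%N%:R) ->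
    forall lambda, L <= lambda -> 0 < g lambda /\
      forall t, 0 <= t <= 1 -> `|g (t * lambda) / g lambda - t| <= l.+2%:R^-1.
  apply: subordinator_bridge_close.
  by rewrite invr_gt0 ltr0n/= invf_lt1 ?ltr0n// ltr1n.
have [K [b [hb bN]]] := gam e eta e0 eta0.
have [L L0 hL] := he K.
pose fr c N : R := (\sum_(j < N) ((grid2 l (p j, y j) == c)%:R : R)) / N%:R.
have l20 : 0 < l.+1%:R ^+ 2 :> R by rewrite exprn_gt0.
pose k c := eta + 2 * M * bd c.
have mass1 : \sum_c mass c = 1.
  have := colour_mass J mS2 (@measurable_grid2_cell l) predT.
  under eq_bigr do rewrite mul1r.
  rewrite -/mass => ->; rewrite (_ : _ `&` _ = S2) ?JS2//.
  by apply/seteqP; split=> z // [].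
have kmass : \sum_c k c * mass c <= eta + 2 * M * eta.
  have E c : k c * mass c = eta * mass c + 2 * M * (bd c * mass c) by rewrite /k; ring.
  rewrite (eq_bigr _ (fun c _ => E c)).
  by rewrite big_split/= -!mulr_sumr mass1 mulr1 lerD2l ler_wpM2l// mulr_ge0.
have vI : `|(\int[J]_(z in S2) F (displacement z))%R - \sum_c v c * mass c| <=
    \sum_c k c * mass c.
  apply: (Rintegral_colour_close mS2 (@measurable_grid2_cell l) (v := v) (k := k)).
    apply: measurable_bounded_integrable => //.
    - by rewrite ltey_eq fin_num_measure.
    - apply: (measurableT_comp (measurable_continuous_functional cF)).
      exact: measurable_displacement.
    - exists M; split; first exact: num_real.
      by move=> x Mx z _; exact: (le_trans (FM _) (ltW Mx)).
  move=> [z1 z2] [s1 s2] /=; rewrite /k /bd; case: asboolP => [cv|_].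
    rewrite mulr0 addr0.
    have [] := cv z1 z2 z2 s1 s2 s2 erefl => // i.
    by rewrite subrr normr0 invr_gt0.
  rewrite mulr1 (le_trans (ler_normB _ _))// -[leLHS]add0r lerD ?(ltW eta0)//.
  by rewrite mulr_natl mulr2n lerD.
have vfr : (fun N => \sum_c v c * fr c N) @ \oo --> \sum_c v c * mass c.
  by apply: cvg_sumr => c; apply: cvgM; [exact: cvg_cst|exact: freq].
have kfr : (fun N => \sum_c k c * fr c N) @ \oo --> \sum_c k c * mass c.
  by apply: cvg_sumr => c; apply: cvgM; [exact: cvg_cst|exact: freq].
have /cvgrPdist_le/(_ _ eta0) vfr' := vfr.
have /cvgrPdist_le/(_ _ eta0) kfr' := kfr.
have msq' := msq _ (divr_gt0 eta0 l20).
near=> N.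
have N0 : (0 < N)%N by near: N; exact: nbhs_infty_gt.
have N0' : 0 < N%:R :> R by rewrite ltr0n.
have [nu0 nu1] : (forall s, 0 <= nu N s) /\ \sum_s nu N s = 1 by near: N.
have lamL : L <= lambda N by near: N; exact: lamy.
have hv : `|\sum_c v c * mass c - \sum_c v c * fr c N| <= eta by near: N.
have hk : `|\sum_c k c * mass c - \sum_c k c * fr c N| <= eta by near: N.
have hm : \sum_s nu N s * \sum_(j < N) enorm (q (s j) - y j) ^+ 2 <=
  eta / l.+1%:R ^+ 2 * N%:R by near: N.
have hbN : \sum_(j < N) (b j)%:R <= eta * N%:R by near: N.
have frE (u : colour l -> R) :
    \sum_c u c * fr c N = (\sum_(j < N) u (grid2 l (p j, y j))) / N%:R.
  rewrite /fr; under eq_bigr do rewrite mulrA mulr_sumr.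
  rewrite -mulr_suml exchange_big/=; congr (_ / _); apply: eq_bigr => j _.
  rewrite (bigD1 (grid2 l (p j, y j)))//= eqxx mulr1 big1 ?addr0// => c.
  by rewrite eq_sym => /negbTE ->; rewrite mulr0.
pose path (s : 'S_N) (j : 'I_N) := F (path_of (gamma_bridge (lambda N) (g j) (p j) (q (s j)))).
pose dd (s : 'S_N) (j : 'I_N) := enorm (q (s j) - y j) ^+ 2.
(* Since the weights sum to 1, the terms that do not depend on [s] are moved under the average, and
   [path_value_close] applies to each pair (s, j). *)
have main : `|\sum_s nu N s * ((\sum_(j < N) path s j) / N%:R) - \sum_c v c * fr c N| <=
    \sum_c k c * fr c N + 2 * M * ((\sum_(j < N) (b j)%:R) / N%:R) +
    2 * M * (l.+1%:R ^+ 2 * ((\sum_s nu N s * \sum_(j < N) dd s j) / N%:R)).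
  rewrite !frE.
  have -> : (\sum_(j < N) v (grid2 l (p j, y j))) / N%:R =
      \sum_s nu N s * ((\sum_(j < N) v (grid2 l (p j, y j))) / N%:R).
    by rewrite -mulr_suml nu1 mul1r.
  rewrite -sumrB (le_trans (ler_norm_sum _ _ _))//.
  have -> : (\sum_(j < N) k (grid2 l (p j, y j))) / N%:R +
      2 * M * ((\sum_(j < N) (b j)%:R) / N%:R) +
      2 * M * (l.+1%:R ^+ 2 * ((\sum_s nu N s * \sum_(j < N) dd s j) / N%:R)) =
    \sum_s nu N s * ((\sum_(j < N) (k (grid2 l (p j, y j)) + 2 * M * (b j)%:R +
       2 * M * (l.+1%:R ^+ 2 * dd s j))) / N%:R).
    have E s : (\sum_(j < N) (k (grid2 l (p j, y j)) + 2 * M * (b j)%:R +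
       2 * M * (l.+1%:R ^+ 2 * dd s j))) / N%:R =
       (\sum_(j < N) k (grid2 l (p j, y j))) / N%:R +
         2 * M * ((\sum_(j < N) (b j)%:R) / N%:R) +
      2 * M * (l.+1%:R ^+ 2 * ((\sum_(j < N) dd s j) / N%:R)).
      by rewrite !big_split/= -!mulr_sumr; ring.
    under [RHS]eq_bigr do rewrite E mulrDr.
    rewrite [RHS]big_split/=; congr (_ + _).
      by rewrite -[RHS]mulr_suml nu1 mul1r.
    rewrite mulr_suml !mulr_sumr; apply: eq_bigr => s _; ring.
  apply: ler_sum => s _; rewrite -mulrBr normrM (ger0_norm (nu0 s)) ler_wpM2l//.
  rewrite -mulrBl normrM normfV (ger0_norm (ltW N0')) ler_wpM2r ?invr_ge0 ?(ltW N0')//.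
  rewrite -sumrB (le_trans (ler_norm_sum _ _ _))// ler_sum// => j _.
  have -> : k (grid2 l (p j, y j)) + 2 * M * (b j)%:R + 2 * M * (l.+1%:R ^+ 2 * dd s j) =
     eta + 2 * M * (bd (grid2 l (p j, y j)) + (b j)%:R + l.+1%:R ^+ 2 * dd s j).
    by rewrite /k; ring.
  apply: path_value_close => //; first exact: lt_le_trans lamL.
  by move=> bj i; apply: hL => //; exact: hb.
have t1 : (\sum_(j < N) (b j)%:R) / N%:R <= eta by rewrite ler_pdivrMr.
have t2 : l.+1%:R ^+ 2 * ((\sum_s nu N s * \sum_(j < N) dd s j) / N%:R) <= eta.
  by rewrite -ler_pdivlMl// ler_pdivrMr// [_^-1 * _]mulrC.
have epsE : eps = 4 * eta + 8 * (M * eta).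
  by rewrite /eta; field; rewrite gt_eqF// ltr_pwDl// mulr_ge0.
have s1 := ler_wpM2l (mulr_ge0 (ler0n R 2) M0) t1.
have s2 := ler_wpM2l (mulr_ge0 (ler0n R 2) M0) t2.
by rewrite epsE; exact: arith hv hk vI main kmass s1 s2.
Unshelve. all: by end_near.
Qed.

End Cells.

(** * Almost sure frequencies in an i.i.d. sample *)

Section IID.
Context d (Omega : measurableType d) (R : realType) (Pr : probability Omega R).
Context d' (T : measurableType d') (X : nat -> {RV Pr >-> T}) (P : probability T R).
Hypothesis X_iid : iid X P.

Let mX j (A : set T) : measurable A -> measurable (X j @^-1` A).
Proof. by move=> mA; rewrite -[X in measurable X]setTI; exact: measurable_funP. Qed.

Lemma iid_frequency_ae (A : set T) : measurable A ->
  {ae Pr, forall w, (fun N : nat => (\sum_(j < N) (\1_A (X j w) : R)) / N%:R) @ \oo -->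
    fine (P A)}.
Proof.
move=> mA; have [ind law] := X_iid.
have : {ae Pr, forall w, (fun N : nat => (\sum_(j < N) (\1_(X j @^-1` A) w -
    fine (Pr (X j @^-1` A)))) / N%:R) @ \oo --> (0 : R)}.
  apply: (slln_events (E := fun j => X j @^-1` A)) => [j|i j ij]; first exact: mX.
  have := ind [:: i; j] (fun k => X k @^-1` A).
  rewrite !big_cons big_nil mule1 /= inE ij => /(_ isT) <-.
    congr (Pr _); apply/seteqP; split=> [w [wi wj] k /=|w h].
      by rewrite !inE => /orP[/eqP ->|/eqP ->].
    by split; apply: h; rewrite /= !inE eqxx ?orbT.
  move=> k _; apply: sub_sigma_algebra; exists k => //; exists A => //.
  by rewrite setTI.
apply: filterS => w h.
have h1 : (fun N : nat => fine (P A) * (N%:R / N%:R)) @ \oo --> fine (P A).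
  apply: (@cvg_trans _ (cst (fine (P A)) @ \oo)); last exact: cvg_cst.
  apply: near_eq_cvg; near=> N; rewrite mulfV ?mulr1//= pnatr_eq0 -lt0n.
  by near: N; exact: nbhs_infty_gt.
rewrite -[X in _ --> X]add0r; apply: cvg_trans (cvgD h h1).
apply: near_eq_cvg; apply: nearW => N /=.
transitivity ((\sum_(j < N) (\1_A (X j w) : R) - fine (P A) * N%:R) / N%:R +
    fine (P A) * (N%:R / N%:R)); last by rewrite mulrBl -mulrA subrK.
congr (_ / _ + _); rewrite sumrB; congr (_ - _).
rewrite mulr_natr -[N in RHS]card_ord -sumr_const.
by apply: eq_bigr => j _; congr fine; exact: law.
Unshelve. all: by end_near. Qed.

Lemma iid_mem_ae (A : set T) : measurable A -> P A = 1%E ->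
  {ae Pr, forall w, forall j, A (X j w)}.
Proof.
move=> mA PA; apply/ae_foralln => j; have [_ law] := X_iid.
exists (~` (X j @^-1` A)); split=> //; first by apply: measurableC; exact: mX.
have E : Pr (X j @^-1` A) = 1%E by rewrite -PA; exact: law.
by apply: (etrans (probability_setC Pr (mX j mA))); rewrite [X in (1 - X)%E]E subee.
Qed.

End IID.

(** * Growth of the clock lambda_N *)

Section Rate.
Context (R : realType).

Lemma powR_natr_infty (a L : R) : 0 < a -> \forall N \near \oo, L <= N%:R `^ a.
Proof.
move=> a0.
have : \forall N \near \oo, (`|L| + 1) `^ a^-1 <= N%:R :> R by exact: nbhs_infty_ger.
apply: filterS => N h.
apply: (@le_trans _ _ (((`|L| + 1) `^ a^-1) `^ a)).
  by rewrite -powRrM mulVf ?gt_eqF// powRr1 ?addr_ge0// (le_trans (ler_norm _))// lerDl.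
by apply: ge0_ler_powR; rewrite ?nnegrE ?powR_ge0 ?(ltW a0).
Qed.

(** With x = N^(1/n), the quotient is n ln x / (c x^2), and ln x <= x. *)
Lemma ln_over_rate (n : nat) (c e : R) : (0 < n)%N -> 0 < c -> 0 < e ->
  \forall N \near \oo, ln N%:R / (c * N%:R `^ (2 / n%:R)) <= e.
Proof.
move=> n0 c0 e0; have n0' : 0 < n%:R :> R by rewrite ltr0n.
near=> N.
have N0 : (0 < N)%N by near: N; exact: nbhs_infty_gt.
have N0' : 0 < N%:R :> R by rewrite ltr0n.
pose x : R := N%:R `^ n%:R^-1.
have x0 : 0 < x by rewrite powR_gt0.
have hx : n%:R / (c * e) <= x.
  by rewrite /x; near: N; apply: powR_natr_infty; rewrite invr_gt0.
have -> : N%:R `^ (2 / n%:R) = x ^+ 2.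
  by rewrite -powR_mulrn ?(ltW x0)// -powRrM mulrC.
have -> : ln N%:R = n%:R * ln x by rewrite ln_powR mulrA mulfV ?mul1r// gt_eqF.
have lx : ln x <= x.
  by rewrite (le_trans (ltW (ln_sublinear x0))).
rewrite ler_pdivrMr ?mulr_gt0// ?exprn_gt0//.
rewrite ler_pdivrMr ?mulr_gt0// in hx.
rewrite (@le_trans _ _ (n%:R * x))//; first by rewrite ler_wpM2l// ltW.
by rewrite expr2; nra.
Unshelve. all: by end_near. Qed.

End Rate.

(** * Assembly of the almost sure statement *)

Theorem theorem5 (R : realType) (m : nat)
  (P0 P1 : probability (borel 'rV[R]_m.+2) R)
  (hP0 : class_La P0) (hP1 : class_La P1)
  (phi : 'rV[R]_m.+2 -> R)
  (phi_conc : exp_concave phi)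
  (phi_opt : generates_optimal_map P0 P1 phi)
  (phi_C2 : C2_on_simplex phi)
  (alpha alpha' : R) (alpha_gt0 : 0 < alpha) (alpha'_gt0 : 0 < alpha')
  (phi_div : forall q q' : 'rV[R]_m.+2, simplex q -> simplex q' ->
     alpha * enorm (q' - q) ^+ 2 <= L_div phi q' q <=
       alpha' * enorm (q' - q) ^+ 2)
  (J : probability (borel 'rV[R]_m.+2 * borel 'rV[R]_m.+2)%type R)
  (J_opt : optimal_coupling P0 P1 J) (J_monge : monge_coupling P0 J)
  (d : measure_display) (Omega : measurableType d) (Pr : probability Omega R)
  (p q : nat -> {RV Pr >-> borel 'rV[R]_m.+2})
  (g : nat -> 'I_m.+2 -> R -> Omega -> R)
  (p_iid : iid p P0) (q_iid : iid q P1) (g_iid : iid_gamma_vectors Pr g)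
  (pqg_indep : independent3 Pr (sigma_of setT p) (sigma_of setT q)
     (sigma_of [set k | 0 <= k.2] (fun k => g k.1.1 k.1.2 k.2))) :
  let lambda (N : nat) : R := 4 / alpha * N%:R `^ (2 / m.+2%:R) in
  {ae Pr, forall w : Omega,
    weakly_converges
      (fun N => M_random (lambda N) N (fun j => p j w) (fun j => q j w)
                  (fun j i t => g j i t w))
      (image_on (simplex `*` simplex) J (@displacement R m))}.
Proof.
move=> lambda.
pose V := 'rV[R]_m.+2.
have [T J_ind] := J_monge; have [mT JE] := J_ind.
have der := phi_derivable phi_C2.
have mS : measurable (simplex : set (borel V)) by exact: measurable_simplex.
pose S2 := (simplex `*` simplex) : set (borel V * borel V).
have mS2 : measurable S2 by exact: measurableX.
have [mA A1] := matched_start_full hP0 hP1 phi_conc phi_opt phi_C2 alpha_gt0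
  alpha'_gt0 phi_div J_opt J_ind.
have mpT : measurable_fun (simplex : set (borel V)) (fun x : borel V => (x, T x)).
  pose T' (x : borel V) : borel V := if x \in (simplex : set (borel V)) then T x else bary.
  apply: (eq_measurable_fun (fun x : borel V => (x, T' x))) => [x xS|].
    by rewrite /T' xS.
  apply: measurable_funTS; apply: measurable_fun_pair; first exact: measurable_id.
  exact: measurable_fun_extend.
(* As [J] is carried by the graph of [T], cells of pairs become events about p alone, to which the
   law of large numbers for p(j) applies. *)
pose cell l c : set (borel V) := simplex `&` (fun x => (x, T x)) @^-1`
  (S2 `&` [set z | grid2 l z = c]).
have mcell l c : measurable (cell l c) by apply: mpT => //; exact: measurable_grid2_cell.
have P0cell l c : P0 (cell l c) = J (S2 `&` [set z | grid2 l z = c]).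
  by rewrite JE//; exact: measurable_grid2_cell.
(* [T] carries P0 to P1, so the points T p(j) and q(j) fill each grid cell with the same limiting
   frequency; this feeds the matching. *)
pose ycell l c : set (borel V) := simplex `&` T @^-1` (simplex `&` [set x | grid l (x : V) = c]).
pose qcell l c : set (borel V) := simplex `&` [set x | grid l (x : V) = c].
have mqcell l c : measurable (qcell l c).
  by apply: measurable_grid => // i; apply: measurable_funTS; exact: measurable_coord.
have mycell l c : measurable (ycell l c) by apply: mT => //; exact: mqcell.
have P0ycell l c : P0 (ycell l c) = P1 (qcell l c).
  have [/(_ _ (mqcell l c))[_ <-] _] := J_opt.
  rewrite JE; last by apply: measurableX.
  by rewrite /image_on; congr (P0 _); apply/seteqP; split=> x [sx] //= -[].
have JS2 : J S2 = 1%E.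
  apply/eqP; rewrite eq_le probability_le1//= -A1 JE//.
  apply: le_measure; rewrite ?inE//; first exact: mpT.
  by move=> x [sx [sy _] _]; split.
have h1 := iid_mem_ae p_iid mA A1.
have [P1S _ _] := hP1.
have h2 := iid_mem_ae q_iid mS P1S.
have h3 : {ae Pr, forall w, forall l c,
    (fun N : nat => (\sum_(j < N) (\1_(cell l c) (p j w) : R)) / N%:R) @ \oo -->
    fine (J (S2 `&` [set z | grid2 l z = c]))}.
  apply/ae_foralln => l; apply: filter_forall => c.
  by rewrite -P0cell; exact: (iid_frequency_ae p_iid (mcell l c)).
have h4 : {ae Pr, forall w, forall l c,
    (fun N : nat => (\sum_(j < N) (\1_(ycell l c) (p j w) : R)) / N%:R) @ \oo -->
    fine (P1 (qcell l c))}.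
  apply/ae_foralln => l; apply: filter_forall => c.
  by rewrite -P0ycell; exact: (iid_frequency_ae p_iid (mycell l c)).
have h5 : {ae Pr, forall w, forall l c,
    (fun N : nat => (\sum_(j < N) (\1_(qcell l c) (q j w) : R)) / N%:R) @ \oo -->
    fine (P1 (qcell l c))}.
  apply/ae_foralln => l; apply: filter_forall => c.
  exact: (iid_frequency_ae q_iid (mqcell l c)).
have h6 := gamma_subordinator_path_ae g_iid.
have h7 := gamma_bad_frequency_ae g_iid.
have aeI (A B : set Omega) : {ae Pr, forall w, A w} -> {ae Pr, forall w, B w} ->
    {ae Pr, forall w, A w /\ B w} by exact: filterI.
have := aeI _ _ (aeI _ _ (aeI _ _ h1 h2) (aeI _ _ h3 h4)) (aeI _ _ h5 (aeI _ _ h6 h7)).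
(* From here on the outcome is fixed; the test functional is introduced only later. *)
apply: filterS => w [[[pA qS] [pfreq yfreq]] [qfreq [gpath gbad]]].
pose y j : V := T (p j w).
have sp j : simplex (p j w : V) by have [] := pA j.
have gy j : good_endpoint phi (y j) by have [] := pA j.
have sy j : simplex (y j) by exact: (gy j).1.
have py j : (p j w : V) = matched_price phi (y j) by have [_ _ ->] := pA j.
have lamy L : \forall N \near \oo, L <= lambda N.
  have := @powR_natr_infty R (2 / m.+2%:R) (L * (alpha / 4))
    (divr_gt0 (ltr0n R 2) (ltr0n R m.+2)).
  apply: filterS => N h; rewrite /lambda -ler_pdivrMl ?divr_gt0// invf_div mulrC.
  exact: h.
have Gam : \forall N \near \oo, [/\ 0 < lambda N, 0 < Gamma (lambda N) &
    0 < Gamma (lambda N / m.+2%:R)].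
  (* Once lambda N is at least n, both arguments of [Gamma] are at least 1. *)
  have := lamy m.+2%:R; apply: filterS => N lN.
  have n1 : 1 <= m.+2%:R :> R by rewrite ler1n.
  split; first by rewrite (lt_le_trans _ lN).
    by rewrite Gamma_gt0// (le_trans n1).
  by rewrite Gamma_gt0// ler_pdivlMr// mul1r.
pose nu N (s : 'S_N) := nu_weight (lambda N) (fun j => p j w) (fun j => q j w) s.
have nuP : \forall N \near \oo, (forall s : 'S_N, 0 <= nu N s) /\ \sum_(s : 'S_N) nu N s = 1.
  apply: filterS Gam => N [l0 G1 G2].
  exact: (nu_weight_distribution phi_conc der N G1 G2 gy py qS).
have msq (e : R) : 0 < e -> \forall N \near \oo,
    \sum_(s : 'S_N) nu N s * \sum_(j < N) enorm ((q (s j) w : V) - y j) ^+ 2 <= e * N%:R.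
  move=> e0.
  (* The matching contributes alpha' times the first constant and the entropy the second one; after
     division by alpha each gives e / 2. *)
  have e1 : 0 < e * alpha / 2 / alpha' by rewrite !divr_gt0// mulr_gt0.
  have e2 : 0 < e * alpha / 2 by rewrite !divr_gt0// mulr_gt0.
  have match_ev : \forall N \near \oo, exists s : 'S_N,
      \sum_(j < N) enorm ((q (s j) w : V) - y j) ^+ 2 <= e * alpha / 2 / alpha' * N%:R.
    apply: (matching_cost_eventually sy (q := fun j => q j w : V) qS e1) => l c.
    exists (fine (P1 (qcell l c))); split.
      apply: cvg_trans (yfreq l c); apply: near_eq_cvg; apply: nearW => N /=.
      congr (_ / _); apply: eq_bigr => j _; rewrite indicE; congr (_ %:R).
      have [yc|/eqP yc] := eqVneq (grid l (y j)) c.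
        by rewrite mem_set//; split; [exact: sp|split; [exact: sy|exact: yc]].
      by rewrite memNset// => -[_ []].
    apply: cvg_trans (qfreq l c); apply: near_eq_cvg; apply: nearW => N /=.
    congr (_ / _); apply: eq_bigr => j _; rewrite indicE; congr (_ %:R).
    have [qc|/eqP qc] := eqVneq (grid l (q j w : V)) c; last by rewrite memNset// => -[_].
    by rewrite mem_set.
  have rate := @ln_over_rate R m.+2 (4 / alpha) (e * alpha / 2) isT
    (divr_gt0 (ltr0n R 4) alpha_gt0) e2.
  near=> N.
  have [s0 hs0] : exists s : 'S_N,
    \sum_(j < N) enorm ((q (s j) w : V) - y j) ^+ 2 <= e * alpha / 2 / alpha' * N%:R by near: N.
  have [l0 G1 G2] : [/\ 0 < lambda N, 0 < Gamma (lambda N) & 0 < Gamma (lambda N / m.+2%:R)]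
    by near: N.
  have rN : ln N%:R / lambda N <= e * alpha / 2 by near: N.
  apply: (le_trans (nu_weight_mean_square phi_conc der s0 alpha_gt0 (ltW alpha'_gt0)
    l0 G1 G2 phi_div gy py qS)).
  rewrite ler_pdivrMl//.
  have -> : alpha * (e * N%:R) = alpha' * (e * alpha / 2 / alpha' * N%:R) +
      N%:R * (e * alpha / 2) by field; rewrite gt_eqF.
  by rewrite lerD ?ler_wpM2l ?(ltW alpha'_gt0)// -mulrA ler_wpM2l.
have freq l c : (fun N : nat => (\sum_(j < N) ((grid2 l (p j w : V, y j) == c)%:R : R)) / N%:R)
    @ \oo --> fine (J (S2 `&` [set z | grid2 l z = c])).
  apply: cvg_trans (pfreq l c); apply: near_eq_cvg; apply: nearW => N /=.
  congr (_ / _); apply: eq_bigr => j _; rewrite indicE; congr (_ %:R).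
  have [pc|/eqP pc] := eqVneq (grid2 l (p j w : V, y j)) c; last by rewrite memNset// => -[_ [_]].
  by rewrite mem_set//; split; [exact: sp|split; [split; [exact: sp|exact: sy]|exact: pc]].
have gam (e delta : R) : 0 < e -> 0 < delta -> exists K (b : nat -> bool),
    (forall j, ~~ b j -> forall i k, (K <= k)%N ->
      `|g j i (k.+1 ^ 2)%N%:R w - (k.+1 ^ 2)%N%:R| <= e * (k.+1 ^ 2)%N%:R) /\
    \forall N \near \oo, \sum_(j < N) ((b j)%:R : R) <= delta * N%:R.
  move=> e0 delta0; have [K hK] := gbad e delta e0 delta0.
  exists K, (fun j => w \in gamma_bad g e K j); split; last exact: hK.
  move=> j /negP bj i k Kk; rewrite leNgt; apply/negP => dev; apply: bj.
  by rewrite inE; exists k => //; exists i.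
move=> F cF [M FM].
have mF := measurable_continuous_functional cF.
rewrite (integral_image_on mS2 JS2 (@measurable_displacement R m) mF); last by exists M.
have cvF := path_average_cvg cF FM JS2 sp sy qS (fun j i => gpath j i) lamy nuP msq freq gam.
have iF : J.-integrable S2 (EFin \o (F \o @displacement R m)).
  apply: measurable_bounded_integrable => //.
  - by rewrite ltey_eq fin_num_measure.
  - by apply: (measurableT_comp mF); exact: measurable_displacement.
  - exists M; split; first exact: num_real.
    by move=> x Mx z _; exact: (le_trans (FM _) (ltW Mx)).
rewrite -[X in _ --> X]fineK; last exact: integrable_fin_num iF.
apply: (@cvg_trans _ ((fun N => (\sum_(s : 'S_N) nu N s *
   ((\sum_(j < N) F (path_of (gamma_bridge (lambda N) (fun i t => g j i t w)
      (p j w) (q (s j) w)))) / N%:R))%:E) @ \oo)); last first.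
  by apply/fine_cvgP; split; [exact: nearW|exact: cvF].
apply: near_eq_cvg; near=> N; apply/esym.
have [nu0 _] : (forall s : 'S_N, 0 <= nu N s) /\ \sum_(s : 'S_N) nu N s = 1 by near: N.
apply: integral_M_random => //.
by near: N; exact: nbhs_infty_gt.
Unshelve. all: by end_near.
Qed.
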